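(* Let $B,L$ be positive real numbers such that $$\frac{24}{L^2}+\frac{2}{B^2}-1=2A^2>0,$$ and let $\mathcal{D}=(0,L)\times(-B,B)$. Consider the problem $$u_t+(1+u)u_x+u_{xxx}+u_{xyy}=0\quad\text{for }(x,y)\in\mathcal{D},\ t>0,$$ $$u(x,-B,t)=u(x,B,t)=0,\quad x\in(0,L),\ t>0,$$ $$u(0,y,t)=u(L,y,t)=u_x(L,y,t)=0,\quad y\in(-B,B),\ t>0,$$ $$u(x,y,0)=u_0(x,y),\quad (x,y)\in\mathcal{D}.$$ If $$\left((1+x),u_0^2\right)<\frac{9A^4}{16\left(8/L^2+2/B^2\right)}=\frac{(3A^2LB)^2}{32(4B^2+L^2)},$$ then regular solutions $u$ of this problem satisfy, for all $t>0$, the inequality $$\|u\|^2(t)\le\left((1+x),u^2\right)(t)\le e^{-\frac{A^2}{1+L}t}\left((1+x),u_0^2\right).$$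
   Context: Subscripts denote partial derivatives. $(\cdot,\cdot)$ and $\|\cdot\|$ are the inner product and the norm of $L^2(\mathcal{D})$; thus $\left((1+x),u^2\right)(t)=\int_{\mathcal{D}}(1+x)u^2(x,y,t)\,dx\,dy$ and $\|u\|^2(t)=\int_{\mathcal{D}}u^2(x,y,t)\,dx\,dy$. A regular solution is a real-valued function $u$ satisfying the equation almost everywhere and the boundary and initial conditions in the sense of traces, and such that for every finite $T>0$: $u\in L^\infty(0,T;H^2(\mathcal{D}))\cap L^2(0,T;H^3(\mathcal{D}))$, $\Delta u_x\in L^\infty(0,T;L^2(\mathcal{D}))\cap L^2(0,T;H^1(\mathcal{D}))$ and $u_t\in L^\infty(0,T;L^2(\mathcal{D}))\cap L^2(0,T;H^1(\mathcal{D}))$, where $\Delta=\partial_x^2+\partial_y^2$. *)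

(* Defs.v *)
From HB Require Import structures.
From mathcomp Require Import all_boot all_order all_algebra.
From mathcomp Require Export all_classical all_reals all_analysis.

Set Implicit Arguments.
Unset Strict Implicit.
Unset Printing Implicit Defensive.
Import Order.TTheory GRing.Theory Num.Theory.
Import numFieldNormedType.Exports.
Local Open Scope classical_set_scope.
Local Open Scope ring_scope.

Definition mu1 (R : realType) := @lebesgue_measure R.
Definition mu2 (R : realType) := (@mu1 R \x @mu1 R)%E.
Definition mu3 (R : realType) := (@mu2 R \x @mu1 R)%E.
Arguments mu1 {R}.
Arguments mu2 {R}.
Arguments mu3 {R}.

(* The rectangle (0, L) x (-B, B); a point is z = (x, y). *)
Definition rect (R : realType) (L B : R) : set (R * R) :=
  `]0, L[%classic `*` `]- B, B[%classic.

Definition times (R : realType) : set R := `]0, +oo[%classic.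
Arguments times {R}.

Definition L2norm d (T : measurableType d) (R : realType)
    (mu : {measure set T -> \bar R}) (D : set T) (f : T -> R) : \bar R :=
  'N[mu]_2[(EFin \o f) \_ D].

Definition L2fun d (T : measurableType d) (R : realType)
    (mu : {measure set T -> \bar R}) (D : set T) (f : T -> R) : Prop :=
  measurable_fun D f /\ (L2norm mu D f < +oo)%E.

(* Inner product of L^2(D). It is extended real valued; in the theorem it is
   only used for pairs with a nonnegative product. *)
Definition L2dot (R : realType) (D : set (R * R)) (f g : R * R -> R) : \bar R :=
  (\int[mu2]_(z in D) (f z * g z)%:E)%E.

Fixpoint iterD (R : realType) (V : normedModType R) (s : seq V) (f : V -> R) :
    V -> R :=
  if s is e :: s' then 'D_e (iterD s' f) else f.

Definition smooth (R : realType) (V : normedModType R) (f : V -> R) : Prop :=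
  forall s : seq V,
    continuous (iterD s f) /\ forall x e, derivable (iterD s f) x e.

(* C_c^oo(Omega), as functions on the whole space *)
Definition test_function (R : realType) (V : normedModType R) (Omega : set V)
    (phi : V -> R) : Prop :=
  [/\ smooth phi, compact (closure [set x | phi x != 0]) &
      closure [set x | phi x != 0] `<=` Omega].

Definition dxy (R : realType) (i j : nat) (phi : R * R -> R) : R * R -> R :=
  iterD (nseq i (1 : R, 0 : R) ++ nseq j (0 : R, 1 : R)) phi.

Definition loc_integrable (R : realType) (D : set (R * R)) (f : R * R -> R) :=
  forall K : set (R * R), compact K -> K `<=` D ->
    mu2.-integrable K (EFin \o f).

Definition weak_dxy (R : realType) (D : set (R * R)) (i j : nat)
    (f g : R * R -> R) : Prop :=
  [/\ loc_integrable D f, loc_integrable D g &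
    forall phi, test_function D phi ->
      (\int[mu2]_(z in D) (f z * dxy i j phi z)%:E =
       \int[mu2]_(z in D) ((-1) ^+ (i + j) * (g z * phi z))%:E)%E].

(* From here on, [v t] is the function v(., t) on D. *)

Definition jointly_measurable (R : realType) (D : set (R * R)) (I : set R)
    (v : R -> R * R -> R) : Prop :=
  measurable_fun (D `*` I) (fun w : (R * R) * R => v w.2 w.1).

Definition space_derivative (R : realType) (D : set (R * R)) (I : set R)
    (i j : nat) (v w : R -> R * R -> R) : Prop :=
  jointly_measurable D I w /\
  {ae mu1, forall t, I t -> weak_dxy D i j (v t) (w t)}.

(* v \in L^p(I; H^k(D)). The maps I -> L^2(D) that are strongly measurable are
   those that have a jointly measurable representative; since H^k(D) is a closed
   subspace, via all derivatives, of a power of L^2(D), strong measurability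
   into H^k(D) is joint measurability of all the derivatives. The norm of
   H^k(D) is equivalent to the sum of the L^2(D) norms of these derivatives. *)
Definition LpHk (R : realType) (D : set (R * R)) (I : set R) (p : \bar R)
    (k : nat) (v : R -> R * R -> R) : Prop :=
  exists d : nat -> nat -> R -> R * R -> R, d 0 0 = v /\
    forall i j, (i + j <= k)%N ->
      space_derivative D I i j v (d i j) /\
      ('N[mu1]_p[(fun t => L2norm mu2 D (d i j t)) \_ I] < +oo)%E.

(* The derivative of t |-> v(t) as a distribution on (0, +oo) with values in
   L^2(D): \int v(t) eta'(t) dt = - \int w(t) eta(t) dt, where these Bochner
   integrals are elements of L^2(D), that is, functions of z up to equality
   almost everywhere. *)
Definition time_derivative (R : realType) (D : set (R * R))
    (v w : R -> R * R -> R) : Prop :=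
  jointly_measurable D times w /\
  forall eta : R -> R, test_function times eta ->
    {ae mu2, forall z, D z ->
      (\int[mu1]_(t in times) (v t z * 'D_1 eta t)%:E =
       \int[mu1]_(t in times) (- (w t z * eta t))%:E)%E}.

(* [g] is the trace of w \in H^1(D) on the piece of the boundary parametrized by
   arc length by gamma : I -> R^2: restrictions to D of smooth functions
   converge to w in H^1(D) while their values on the boundary piece converge to
   g in L^2(I). *)
Definition has_trace (R : realType) (D : set (R * R)) (gamma : R -> R * R)
    (I : set R) (w : R * R -> R) (g : R -> R) : Prop :=
  exists wx wy : R * R -> R, exists phi : nat -> R * R -> R,
  [/\ [/\ L2fun mu2 D w, L2fun mu2 D wx & L2fun mu2 D wy],
      weak_dxy D 1 0 w wx /\ weak_dxy D 0 1 w wy,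
      forall n, smooth (phi n),
      [/\ L2norm mu2 D (fun z => phi n z - w z) @[n --> \oo] --> 0%E,
          L2norm mu2 D (fun z => dxy 1 0 (phi n) z - wx z) @[n --> \oo] --> 0%E &
          L2norm mu2 D (fun z => dxy 0 1 (phi n) z - wy z) @[n --> \oo] --> 0%E] &
      L2norm mu1 I (fun s => phi n (gamma s) - g s) @[n --> \oo] --> 0%E].

(* The regularity makes t |-> u(t) locally Lipschitz from [0, +oo) to L^2(D), up
   to modification on a null set of times. As usual u denotes this continuous
   representative (field [rs_continuous]), so that u(t) is defined in L^2(D) for
   every t > 0. *)
Record regular_solution_with (R : realType) (L B : R) (u0 : R * R -> R)
    (u ut ux uxxx uxyy : R -> R * R -> R) : Prop := RegularSolutionWith {
  rs_ut : time_derivative (rect L B) u ut;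
  rs_ux : space_derivative (rect L B) times 1 0 u ux;
  rs_uxxx : space_derivative (rect L B) times 3 0 u uxxx;
  rs_uxyy : space_derivative (rect L B) times 1 2 u uxyy;
  rs_regular_u : forall T, 0 < T ->
    LpHk (rect L B) `]0, T[ +oo 2 u /\ LpHk (rect L B) `]0, T[ 2%:E 3 u;
  rs_regular_Delta_ux : forall T, 0 < T ->
    LpHk (rect L B) `]0, T[ +oo 0 (fun t z => uxxx t z + uxyy t z) /\
    LpHk (rect L B) `]0, T[ 2%:E 1 (fun t z => uxxx t z + uxyy t z);
  rs_regular_ut : forall T, 0 < T ->
    LpHk (rect L B) `]0, T[ +oo 0 ut /\ LpHk (rect L B) `]0, T[ 2%:E 1 ut;
  rs_equation : {ae mu3, forall w : (R * R) * R,
    (rect L B `*` times) w ->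
    ut w.2 w.1 + (1 + u w.2 w.1) * ux w.2 w.1 + uxxx w.2 w.1 + uxyy w.2 w.1
      = 0};
  rs_bottom : {ae mu1, forall t, 0 < t ->
    has_trace (rect L B) (fun x => (x, - B)) `]0, L[ (u t) (cst 0)};
  rs_top : {ae mu1, forall t, 0 < t ->
    has_trace (rect L B) (fun x => (x, B)) `]0, L[ (u t) (cst 0)};
  rs_left : {ae mu1, forall t, 0 < t ->
    has_trace (rect L B) (fun y => (0, y)) `]- B, B[ (u t) (cst 0)};
  rs_right : {ae mu1, forall t, 0 < t ->
    has_trace (rect L B) (fun y => (L, y)) `]- B, B[ (u t) (cst 0)};
  rs_right_ux : {ae mu1, forall t, 0 < t ->
    has_trace (rect L B) (fun y => (L, y)) `]- B, B[ (ux t) (cst 0)};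
  rs_L2 : forall t, 0 < t -> L2fun mu2 (rect L B) (u t);
  rs_continuous : forall s, 0 < s ->
    L2norm mu2 (rect L B) (fun z => u t z - u s z) @[t --> s] --> 0%E;
  rs_initial : L2fun mu2 (rect L B) u0 /\
    L2norm mu2 (rect L B) (fun z => u t z - u0 z) @[t --> 0^'+] --> 0%E }.

Definition regular_solution (R : realType) (L B : R) (u0 : R * R -> R)
    (u : R -> R * R -> R) : Prop :=
  exists ut ux uxxx uxyy, regular_solution_with L B u0 u ut ux uxxx uxyy.

(* Main.v *)
(* For fixed t put N = ||u||^2, a = ||u_x||^2, b = ||u_y||^2. Multiplying the
   equation by 2 (1 + x) u and integrating by parts gives
     d/dt ((1+x), u^2) <= - (3 a + b - N - 2/3 \int u^3).
   The Poincare inequalities a >= (8/L^2) N and b >= (2/B^2) N absorb N and leave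
   2 A^2 N. Ladyzhenskaya's inequality \int u^4 <= 4 N (a b)^(1/2) bounds the cubic
   term by A^2 N plus the unused part of a and b, as long as ((1+x), u^2) is below
   the threshold. Then ((1+x), u^2)' <= - A^2/(1+L) ((1+x), u^2).

   The solution is only weak, so the integrations by parts are done on almost
   every line. There the lemma of du Bois-Reymond turns weak derivatives into
   absolutely continuous functions, and zero traces give the end values. In the
   term u_xyy one also needs u_y = 0 on x = L, which is the tangential derivative
   of the boundary condition. In time, the same lemma gives
   u(t, z) = c(z) + \int_0^t u_t(s, z) ds for almost every z, so ((1+x), u^2) is
   absolutely continuous with bounded derivative, and the threshold is never
   crossed. *)

From HB Require Import structures.
Require Import Defs.
From mathcomp Require Import all_boot all_order all_algebra.
From mathcomp Require Import all_classical all_reals all_analysis.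
From mathcomp Require Import unstable measurable_realfun ring lra.
Import Order.TTheory GRing.Theory Num.Theory.
Import numFieldNormedType.Exports.
Set Implicit Arguments.
Unset Strict Implicit.
Unset Printing Implicit Defensive.
Local Open Scope classical_set_scope.
Local Open Scope ring_scope.

(** * Real-valued integrals *)

(** A weak identity passes to lines only off a null set of lines that depends on the test function,
    whereas the lemma of du Bois-Reymond needs all test functions on the same line. It is therefore
    applied with a countable family, built from bumps with rational end points, and on the rectangle
    only products of one-variable test functions are used. The same device serves in time, with a
    point of the rectangle in place of the line. The factor 3 of $a$ comes from the term $u_{xxx}$,
    so that $24=3\cdot8$. Put $P=8/L^2$ and $Q=2/B^2$, so that $3P+Q-1=2A^2$. The cubic integral
    obeys $(\int u^3)^4\le N^2(\int u^4)^2\le16N^4ab$. Since $4ab\le(a+b)^2$, it is enough that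
    $\frac89N^2(a+b)\le Z^2$ with $Z=A^2N+3(a-PN)+(b-QN)$. At $a=PN$, $b=QN$ this reads
    $N\le9A^4/(8(P+Q))$; the threshold is half of that value, and it also controls the excess of $a$
    and $b$. *)

Notation rintegrable mu D f := (mu.-integrable D (EFin \o f)).

Section almost_everywhere.
Context d (T : measurableType d) (R : realType) (mu : {measure set T -> \bar R}).
Implicit Types P Q S : T -> Prop.

Lemma ae_imp P Q : (forall x, P x -> Q x) ->
  {ae mu, forall x, P x} -> {ae mu, forall x, Q x}.
Proof. by move=> PQ; apply: filterS. Qed.

Lemma ae_imp2 P Q S : (forall x, P x -> Q x -> S x) ->
  {ae mu, forall x, P x} -> {ae mu, forall x, Q x} -> {ae mu, forall x, S x}.
Proof. by move=> PQ; apply: filterS2. Qed.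

Lemma ae_imp3 P Q S U : (forall x, P x -> Q x -> S x -> U x) ->
  {ae mu, forall x, P x} -> {ae mu, forall x, Q x} -> {ae mu, forall x, S x} ->
  {ae mu, forall x, U x}.
Proof. by move=> PQ; apply: filterS3. Qed.

Lemma ae_forall_count (I : countType) (P : I -> T -> Prop) :
  (forall i, {ae mu, forall x, P i x}) -> {ae mu, forall x, forall i, P i x}.
Proof.
move=> h; pose Q n x := if unpickle n is Some i then P i x else True.
have : {ae mu, forall x, forall n, Q n x}.
  apply: ae_foralln => n; rewrite /Q; case: (unpickle n) => [i|]; first exact: h.
  exact: aeW.
by apply: ae_imp => x hQ i; have := hQ (pickle i); rewrite /Q pickleK.
Qed.

Lemma measurable_fun_natr (D : set T) (b : T -> bool) : measurable_fun D b ->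
  measurable_fun D (fun x => (b x)%:R : R).
Proof.
move=> mb mD; have mA := mb mD [set true] I.
have m1 : measurable_fun D (\1_(D `&` b @^-1` [set true]) : T -> R).
  by apply: measurable_funTS; exact: measurable_indic.
suff : measurable_fun D (fun x => (b x)%:R : R) by apply.
apply: eq_measurable_fun m1 => x; rewrite inE => Dx; rewrite indicE; congr (_%:R).
by case: (boolP (b x)) => bx; [rewrite mem_set|rewrite memNset// => -[_] /=; apply/negP].
Qed.

End almost_everywhere.

Section real_integrals.
Context d (T : measurableType d) (R : realType) (mu : {measure set T -> \bar R}).
Variables (D : set T) (mD : measurable D).
Implicit Types f g h : T -> R.

Lemma rintegrable_measurable f : rintegrable mu D f -> measurable_fun D f.
Proof. by move=> /measurable_int/measurable_EFinP. Qed.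

Lemma rintegrableD f g : rintegrable mu D f -> rintegrable mu D g ->
  rintegrable mu D (fun x => f x + g x).
Proof. by move=> fi gi; exact: (integrableD mD fi gi). Qed.

Lemma rintegrableB f g : rintegrable mu D f -> rintegrable mu D g ->
  rintegrable mu D (fun x => f x - g x).
Proof. by move=> fi gi; exact: (integrableB mD fi gi). Qed.

Lemma rintegrableZ k f : rintegrable mu D f -> rintegrable mu D (fun x => k * f x).
Proof. by move=> fi; exact: (integrableZl mD k fi). Qed.

Lemma rintegrableN f : rintegrable mu D f -> rintegrable mu D (fun x => - f x).
Proof. by move=> fi; exact: (integrableN fi). Qed.

Lemma rintegrable_norm f : rintegrable mu D f -> rintegrable mu D (fun x => `|f x|).
Proof. by move=> fi; exact: (integrable_norm fi). Qed.

Lemma rintegrable_le f g : measurable_fun D f ->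
  (forall x, D x -> `|f x| <= g x) -> rintegrable mu D g -> rintegrable mu D f.
Proof.
move=> mf fg gi; apply: (le_integrable mD _ _ gi); first exact/measurable_EFinP.
by move=> x Dx /=; rewrite lee_fin (le_trans (fg _ Dx))// ler_norm.
Qed.

Lemma eq_rintegrable f g : (forall x, D x -> f x = g x) ->
  rintegrable mu D f -> rintegrable mu D g.
Proof.
by move=> fg; apply: eq_integrable => // x; rewrite inE => Dx /=; rewrite fg.
Qed.

Lemma rintegrable_bounded f h M : measurable_fun D h ->
  (forall x, D x -> `|h x| <= M) -> rintegrable mu D f ->
  rintegrable mu D (fun x => h x * f x).
Proof.
move=> mh hM fi.
apply: (@rintegrable_le _ (fun x => M * `|f x|)).
- by apply: measurable_funM => //; exact: rintegrable_measurable.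
- by move=> x Dx; rewrite normrM ler_wpM2r// hM.
- exact/rintegrableZ/rintegrable_norm.
Qed.

Lemma EFin_Rintegral f : rintegrable mu D f ->
  (\int[mu]_(x in D) (f x)%:E)%E = (\int[mu]_(x in D) f x)%:E.
Proof. by move=> fi; rewrite /Rintegral fineK//; exact: (integrable_fin_num mD fi). Qed.

Lemma RintegralN f : rintegrable mu D f ->
  \int[mu]_(x in D) (- f x) = - \int[mu]_(x in D) f x.
Proof.
move=> fi; rewrite -[RHS]mulN1r -RintegralZl//.
by apply: eq_Rintegral => x _; rewrite mulN1r.
Qed.

Lemma ae_eq_rintegrable f g : measurable_fun D g ->
  {ae mu, forall x, D x -> f x = g x} -> rintegrable mu D f -> rintegrable mu D g.
Proof.
move=> mg fg fi; apply/integrableP; split; first exact/measurable_EFinP.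
have /integrableP[mf] := fi; apply: le_lt_trans.
rewrite le_eqVlt; apply/orP; left; apply/eqP; apply: ge0_ae_eq_integral => //.
- by apply: measurableT_comp => //; exact/measurable_EFinP.
- by apply: measurableT_comp => //; exact/measurable_EFinP.
- by apply: filterS fg => x /[apply] /= ->.
Qed.

Lemma ae_eq_Rintegral f g : measurable_fun D f -> measurable_fun D g ->
  {ae mu, forall x, D x -> f x = g x} ->
  \int[mu]_(x in D) f x = \int[mu]_(x in D) g x.
Proof.
move=> mf mg fg; congr fine; apply: ae_eq_integral => //; try exact/measurable_EFinP.
by apply: filterS fg => x /[apply] /= ->.
Qed.

Lemma ae_le_Rintegral f g : rintegrable mu D f -> rintegrable mu D g ->
  {ae mu, forall x, D x -> f x <= g x} ->
  \int[mu]_(x in D) f x <= \int[mu]_(x in D) g x.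
Proof.
move=> fi gi fg.
have mf := rintegrable_measurable fi; have mg := rintegrable_measurable gi.
(* The order holds only almost everywhere. The maximum dominates [f] everywhere and equals [g]
   almost everywhere. *)
have mi : rintegrable mu D (fun x => Num.max (f x) (g x)).
  apply: (@rintegrable_le _ (fun x => `|f x| + `|g x|)).
  - exact: measurable_maxr.
  - move=> x Dx; rewrite /Num.max; case: ifP => _; first by rewrite lerDr.
    by rewrite lerDl.
  - by apply: rintegrableD; exact: rintegrable_norm.
have -> : \int[mu]_(x in D) g x = \int[mu]_(x in D) Num.max (f x) (g x).
  apply: ae_eq_Rintegral => //; first exact: rintegrable_measurable.
  by apply: filterS fg => x /[apply] xy; rewrite max_r.
by apply: le_Rintegral => // x _; rewrite le_max lexx.
Qed.

Lemma ae_eq0_of_Rintegral_norm f : rintegrable mu D f ->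
  \int[mu]_(x in D) `|f x| <= 0 -> {ae mu, forall x, D x -> f x = 0}.
Proof.
move=> fi f0.
have mf := measurable_int _ fi.
have /(ae_eq_integral_abs _ mD mf) : (\int[mu]_(x in D) `|(EFin \o f) x| = 0)%E.
  under eq_integral do rewrite /=.
  rewrite (EFin_Rintegral (rintegrable_norm fi)); congr EFin.
  by apply/eqP; rewrite eq_le f0/=; apply: Rintegral_ge0.
by apply: filterS => x /[apply] -[].
Qed.

(** Measurability of [f] is a separate clause, since that of its square says nothing about the sign
    of [f]. *)
Definition sqintegrable f :=
  measurable_fun D f /\ rintegrable mu D (fun x => f x ^+ 2).

Lemma sqintegrable_mul f g : sqintegrable f -> sqintegrable g ->
  rintegrable mu D (fun x => f x * g x).
Proof.
move=> [mf fi] [mg gi].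
apply: (@rintegrable_le _ (fun x => f x ^+ 2 + g x ^+ 2)).
- exact: measurable_funM.
- move=> x _; rewrite normrM -(real_normK (num_real (f x))).
  rewrite -(real_normK (num_real (g x))).
  by nra.
- exact: rintegrableD.
Qed.

Lemma sqintegrable_norm f : sqintegrable f -> sqintegrable (fun x => `|f x|).
Proof.
move=> [mf fi]; split; first exact: measurableT_comp.
by apply: eq_rintegrable fi => x _; rewrite real_normK// num_real.
Qed.

Lemma sqintegrable_bounded f h M : measurable_fun D h ->
  (forall x, D x -> `|h x| <= M) -> sqintegrable f ->
  sqintegrable (fun x => h x * f x).
Proof.
move=> mh hM [mf fi]; split; first exact: measurable_funM.
have : rintegrable mu D (fun x => h x ^+ 2 * f x ^+ 2).
  apply: (@rintegrable_bounded _ _ (M ^+ 2)) => //.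
    exact: measurable_funX.
  by move=> x Dx; rewrite normrX lerXn2r// ?nnegrE// ?(le_trans _ (hM _ Dx)) ?hM.
by apply: eq_rintegrable => x _; rewrite exprMn.
Qed.

Lemma sqintegrableZ k f : sqintegrable f -> sqintegrable (fun x => k * f x).
Proof.
by move=> fi; exact: (@sqintegrable_bounded _ (cst k) `|k|).
Qed.

Lemma sqintegrableD f g : sqintegrable f -> sqintegrable g ->
  sqintegrable (fun x => f x + g x).
Proof.
move=> fi gi; split; first by apply: measurable_funD; [case: fi|case: gi].
have : rintegrable mu D (fun x => f x ^+ 2 + (2 * (f x * g x) + g x ^+ 2)).
  apply: rintegrableD; first by case: fi.
  apply: rintegrableD; last by case: gi.
  exact/rintegrableZ/sqintegrable_mul.
by apply: eq_rintegrable => x _; ring.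
Qed.

Lemma sqintegrableB f g : sqintegrable f -> sqintegrable g ->
  sqintegrable (fun x => f x - g x).
Proof.
move=> fi gi; have := sqintegrableD fi (sqintegrableZ (-1) gi).
by under eq_fun do rewrite mulN1r.
Qed.

Lemma sqintegrable_cst k : (mu D < +oo)%E -> sqintegrable (cst k).
Proof.
move=> Doo; split => //.
apply/integrableP; split; first by apply/measurable_EFinP; exact: (@measurable_cst _ _ T R D (k ^+ 2)).
by rewrite /= (eq_integral (cst `|k ^+ 2|%:E))// integral_cst//= lte_mul_pinfty.
Qed.

Lemma sqintegrable_rintegrable f : (mu D < +oo)%E -> sqintegrable f ->
  rintegrable mu D f.
Proof.
move=> Doo fi; have := sqintegrable_mul (sqintegrable_cst 1 Doo) fi.
by apply: eq_rintegrable => x _; rewrite /= mul1r.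
Qed.

Lemma eq_sqintegrable f g : (forall x, D x -> f x = g x) ->
  sqintegrable f -> sqintegrable g.
Proof.
move=> fg [mf fi]; split.
  by apply: eq_measurable_fun mf => x; rewrite inE; exact: fg.
by apply: eq_rintegrable fi => x Dx; rewrite fg.
Qed.

Lemma cauchy_schwarz_Rintegral f g : sqintegrable f -> sqintegrable g ->
  (\int[mu]_(x in D) (f x * g x)) ^+ 2 <=
  (\int[mu]_(x in D) f x ^+ 2) * (\int[mu]_(x in D) g x ^+ 2).
Proof.
move=> fi gi; set a := \int[mu]_(x in D) f x ^+ 2; set b := \int[mu]_(x in D) g x ^+ 2.
set c := \int[mu]_(x in D) (f x * g x).
have fgi := sqintegrable_mul fi gi; have [_ f2] := fi; have [_ g2] := gi.
have a0 : 0 <= a by apply: Rintegral_ge0 => x _; rewrite sqr_ge0.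
have b0 : 0 <= b by apply: Rintegral_ge0 => x _; rewrite sqr_ge0.
have H s t : 0 <= s ^+ 2 * a + (2 * s * t) * c + t ^+ 2 * b.
  have i1 := rintegrableZ (s ^+ 2) f2; have i2 := rintegrableZ (2 * s * t) fgi.
  have i3 := rintegrableZ (t ^+ 2) g2; have i12 := rintegrableD i1 i2.
  rewrite -!RintegralZl// -(RintegralD mD i1 i2) -(RintegralD mD i12 i3).
  by apply: Rintegral_ge0 => x _; have := sqr_ge0 (s * f x + t * g x); nra.
(* If [b = 0], the form at [(- c, a + 1)] equals $-(a+2)c^2$, which forces $c=0$. Otherwise the form
   at [(b, - c)] equals $b(ab-c^2)$. *)
have [b00|bn0] := eqVneq b 0.
  have Ha := H 1 (- c); have Hb := H (- c) (a + 1).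
  rewrite b00 in Hb *.
  have c2 := sqr_ge0 c.
  nra.
have := H b (- c).
have bp : 0 < b by rewrite lt_def bn0.
move=> H'; rewrite -subr_ge0 -(pmulr_rge0 _ bp).
by apply: le_trans H' _; lra.
Qed.

End real_integrals.

Lemma rintegrable_ae_le d (T : measurableType d) (R : realType) (mu : {measure set T -> \bar R})
    (D : set T) (f g : T -> R) : measurable D -> measurable_fun D f ->
  {ae mu, forall x, D x -> `|f x| <= g x} -> rintegrable mu D g -> rintegrable mu D f.
Proof.
move=> mD mf fg gi; have ngi := rintegrable_norm gi.
have mnf : measurable_fun D (fun x => `|f x|) by exact: measurableT_comp.
have mng := rintegrable_measurable ngi.
(* This minimum is dominated by the norm of [g] everywhere and equals the norm of [f] almost
   everywhere, which transfers integrability. *)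
pose M x := Num.min `|f x| `|g x|.
have mM : measurable_fun D M by exact: measurable_minr.
have iM : rintegrable mu D M.
  apply: (rintegrable_le mD mM _ ngi) => x _.
  by rewrite ger0_norm; [rewrite ge_min lexx orbT|rewrite le_min !normr_ge0].
have fM : {ae mu, forall x, D x -> M x = `|f x|}.
  apply: ae_imp fg => x fg Dx; apply/min_idPl; apply: (le_trans (fg Dx)).
  by rewrite ler_norm.
have nfi := ae_eq_rintegrable mD mnf fM iM.
by apply: (rintegrable_le mD mf _ nfi).
Qed.

(** * Integrals over slices of a product *)

Section product_slices.
Context d1 d2 (T1 : measurableType d1) (T2 : measurableType d2) (R : realType).
Variable m1 : {sigma_finite_measure set T1 -> \bar R}.
Variable m2 : {sigma_finite_measure set T2 -> \bar R}.
Variables (A : set T1) (B : set T2) (mA : measurable A) (mB : measurable B).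
Implicit Types f : T1 * T2 -> R.

Let mAB : measurable (A `*` B). Proof. exact: measurableX. Qed.

Let patch_slice f x : A x -> (fun y => (f \_ (A `*` B)) (x, y)) = (fun y => f (x, y)) \_ B.
Proof.
move=> Ax; apply/funext => y; rewrite !patchE.
case: ifPn => [|/negP]; rewrite inE /= => h.
  by rewrite mem_set//; case: h.
by rewrite memNset// => By; apply: h.
Qed.

Let patch_sliceE f x y : A x ->
  (f \_ (A `*` B)) (x, y) = ((fun y => f (x, y)) \_ B) y.
Proof. by move=> Ax; rewrite -(patch_slice f Ax). Qed.

Let patch_sliceNE f x y : ~ A x -> (f \_ (A `*` B)) (x, y) = 0.
Proof. by move=> Ax; rewrite patchE memNset// => -[]. Qed.

Lemma measurable_slice f x : measurable_fun (A `*` B) f -> A x ->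
  measurable_fun B (fun y => f (x, y)).
Proof.
move=> mf Ax; apply/measurable_restrictT => //.
rewrite -patch_slice//; apply: (measurableT_comp _ (pair1_measurable x)).
exact/(measurable_restrictT _ mAB).
Qed.

Lemma ae_slices (P : T1 * T2 -> Prop) : {ae (m1 \x m2)%E, forall z, P z} ->
  {ae m1, forall x, {ae m2, forall y, P (x, y)}}.
Proof.
move=> [N [mN N0 PN]].
have : {ae m1, forall x, setT x -> m2 (xsection N x) = 0}.
  have mS : measurable_fun setT (m2 \o xsection N) by exact: measurable_fun_xsection.
  apply/(ae_eq_integral_abs _ measurableT mS).
  by rewrite -[RHS]N0; apply: eq_integral => x _ /=; rewrite gee0_abs.
apply: filterS => x /(_ I) Nx0; exists (xsection N x).
split; [exact: measurable_xsection|exact: Nx0|].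
by move=> y nP; rewrite /xsection /=; apply/mem_set/PN.
Qed.

(** Null slices make a set null only when the set is measurable, hence the boolean predicate with
    its joint measurability: the exceptional set is then measurable, and its measure is the integral
    of those of its slices. *)
Lemma ae_of_slices (P : T1 * T2 -> bool) :
  measurable_fun (A `*` B) P ->
  {ae m1, forall x, A x -> {ae m2, forall y, B y -> P (x, y)}} ->
  {ae (m1 \x m2)%E, forall z, (A `*` B) z -> P z}.
Proof.
move=> mP H.
pose N := (A `*` B) `&` P @^-1` [set false].
have mN : measurable N by apply: mP => //.
exists N; split => //; last first.
  move=> z /= /not_implyP[ABz Pz]; split => //.
  by rewrite /= ; apply/negbTE/negP.
have mS : measurable_fun setT (m2 \o xsection N) by exact: measurable_fun_xsection.
have -> : (m1 \x m2)%E N = (\int[m1]_(x in setT) `|(m2 \o xsection N) x|)%E.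
  by apply: eq_integral => x _ /=; rewrite gee0_abs.
apply/(ae_eq_integral_abs _ measurableT mS).
apply: filterS H => x H _ /=.
have [Ax|nAx] := pselect (A x); last first.
  rewrite (_ : xsection N x = set0) ?measure0// -subset0 => y.
  by rewrite /xsection /= inE => -[[]].
have [M [mM M0 HM]] := H Ax.
apply: (@subset_measure0 _ _ _ m2 _ M) => //; first exact: measurable_xsection.
move=> y; rewrite /xsection /= inE => -[[_ By] /= Pf]; apply: HM => /=.
by move=> /(_ By); rewrite Pf.
Qed.

(** Fubini for real-valued integrals: on the slices where [f] fails to be integrable the real inner
    integral may differ from the extended one, but these slices form a null set. *)
Lemma fubini_slices f : rintegrable (m1 \x m2)%E (A `*` B) f ->
  [/\ {ae m1, forall x, A x -> rintegrable m2 B (fun y => f (x, y))},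
      rintegrable m1 A (fun x => \int[m2]_(y in B) f (x, y)) &
      \int[(m1 \x m2)%E]_(z in A `*` B) f z =
      \int[m1]_(x in A) \int[m2]_(y in B) f (x, y)].
Proof.
move=> /(integrable_mkcond _ mAB); rewrite restrict_EFin => fi.
have FE x : fubini_F m2 (EFin \o f \_ (A `*` B)) x =
    ((fun x => \int[m2]_(y in B) (f (x, y))%:E) \_ A)%E x.
  rewrite /fubini_F patchE; case: ifPn => [|/negP]; rewrite inE => Ax.
    rewrite [RHS]integral_mkcond; apply: eq_integral => y _.
    by rewrite /= patch_sliceE// !patchE; case: ifPn.
  rewrite -[RHS](integral0 m2 setT); apply: eq_integral => y _.
  by rewrite /= patch_sliceNE.
have ae1 : {ae m1, forall x, A x -> rintegrable m2 B (fun y => f (x, y))}.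
  apply: filterS (ae_integrable1 fi) => x + Ax => fxi.
  apply/(integrable_mkcond _ mB); rewrite restrict_EFin -patch_slice//.
have Fi := integrable_fubini_F fi.
have mF : measurable_fun A (fun x => \int[m2]_(y in B) f (x, y)).
  apply: (@measurableT_comp _ _ _ _ _ _ (@fine R)) => //.
  apply/measurable_restrictT => //.
  rewrite -(funext FE); exact: (measurable_int _ Fi).
have FiA : m1.-integrable A (fun x => \int[m2]_(y in B) (f (x, y))%:E)%E.
  by apply/(integrable_mkcond _ mA); rewrite -(funext FE).
have aeE : {ae m1, forall x, A x -> (\int[m2]_(y in B) (f (x, y))%:E)%E = (\int[m2]_(y in B) f (x, y))%:E}.
  by apply: filterS ae1 => x /[apply] h; rewrite EFin_Rintegral.
split => //.
  apply/integrableP; split; first exact/measurable_EFinP.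
  have /integrableP[mG] := FiA; apply: le_lt_trans.
  rewrite le_eqVlt; apply/orP; left; apply/eqP; apply: ge0_ae_eq_integral => //.
  - by apply: measurableT_comp => //; exact/measurable_EFinP.
  - exact: measurableT_comp.
  - by apply: filterS aeE => x /[apply] /= ->.
congr fine; rewrite integral_mkcond restrict_EFin -(integral12_prod_meas1 fi).
transitivity (\int[m1]_x ((fun x => \int[m2]_(y in B) (f (x, y))%:E) \_ A) x)%E.
  by apply: eq_integral => x _; exact: FE.
rewrite -integral_mkcond; apply: ae_eq_integral => //; first exact: (measurable_int _ FiA).
exact/measurable_EFinP.
Qed.

(** Tonelli's criterion with an integrable majorant [g] of the slice integrals; an essential bound
    in time supplies such a majorant directly. *)
Lemma fubini_tonelli_slices f : measurable_fun (A `*` B) f ->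
  {ae m1, forall x, A x -> rintegrable m2 B (fun y => f (x, y))} ->
  (exists2 g, rintegrable m1 A g &
     {ae m1, forall x, A x -> \int[m2]_(y in B) `|f (x, y)| <= g x}) ->
  rintegrable (m1 \x m2)%E (A `*` B) f.
Proof.
move=> mf aef [g gi fg].
apply/(integrable_mkcond _ mAB); rewrite restrict_EFin.
have mF : measurable_fun setT (EFin \o f \_ (A `*` B)).
  by apply/measurable_EFinP; exact/(measurable_restrictT _ mAB).
apply/(integrable12ltyP _ _ mF).
have -> : (\int[m1]_x \int[m2]_y `|(EFin \o f \_ (A `*` B)) (x, y)| =
   \int[m1]_(x in A) \int[m2]_(y in B) `|(f (x, y))%:E|)%E.
  rewrite [RHS]integral_mkcond; apply: eq_integral => x _.
  rewrite patchE; case: ifPn => [|/negP]; rewrite inE => Ax.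
    rewrite [RHS]integral_mkcond; apply: eq_integral => y _.
    rewrite /= patch_sliceE//.
    by rewrite !patchE; case: ifPn; rewrite ?normr0.
  rewrite -[RHS](integral0 m2 setT); apply: eq_integral => y _.
  by rewrite /= patch_sliceNE//= normr0.
have /integrableP[mg] := gi; apply: le_lt_trans.
apply: ae_ge0_le_integral => //.
- by move=> x _; exact: integral_ge0.
- have := measurable_fun_fubini_tonelli_F (m2 := m2) (abse \o (EFin \o f \_ (A `*` B))).
  move=> /(_ (measurableT_comp (@abse_measurable R setT) mF)) /(_ (fun x => abse_ge0 _)) h.
  have : measurable_fun A (fubini_F m2 (abse \o (EFin \o f \_ (A `*` B)))) by exact: measurable_funTS.
  apply: eq_measurable_fun => x; rewrite inE => Ax.
  rewrite /fubini_F [RHS]integral_mkcond; apply: eq_integral => y _.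
  rewrite /= patch_sliceE//.
  by rewrite !patchE; case: ifPn; rewrite ?normr0.
- exact: measurableT_comp.
- apply: filterS2 aef fg => x h1 h2 Ax.
  rewrite [X in (X <= _)%E](EFin_Rintegral mB (rintegrable_norm (h1 Ax))) /= lee_fin.
  by rewrite (le_trans (h2 Ax))// ler_norm.
Qed.

End product_slices.

Section product_swap.
Context d1 d2 (T1 : measurableType d1) (T2 : measurableType d2) (R : realType).
Variable m1 : {sigma_finite_measure set T1 -> \bar R}.
Variable m2 : {sigma_finite_measure set T2 -> \bar R}.
Variables (A : set T1) (B : set T2) (mA : measurable A) (mB : measurable B).

Let swap_measure : {measure set (T1 * T2)%type -> \bar R} :=
  measure_function_pushforward__canonical__measure_function_Measure
    (m2 \x m1)%E (@measurable_swap _ _ T2 T1).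

(** The push-forward of one product under the exchange of coordinates agrees with the other product
    on measurable rectangles, and the product measure is determined by these values. *)
Lemma product_measure_swap (N : set (T1 * T2)) : measurable N ->
  (m2 \x m1)%E (@swap T2 T1 @^-1` N) = (m1 \x m2)%E N.
Proof.
move=> mN; symmetry.
rewrite (@product_measure_unique _ _ T1 T2 R m1 m2 swap_measure)// => C E mC mE.
rewrite /= /pushforward.
rewrite (_ : _ @^-1` _ = E `*` C); first by rewrite product_measure1E// muleC.
by apply/seteqP; split => -[x y] /= [].
Qed.

Lemma ae_swap (P : T1 * T2 -> Prop) : {ae (m1 \x m2)%E, forall z, P z} ->
  {ae (m2 \x m1)%E, forall z, P (swap z)}.
Proof.
move=> [N [mN N0 PN]]; exists (@swap T2 T1 @^-1` N); split.
- by rewrite -[X in measurable X]setTI; exact: measurable_swap.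
- by rewrite product_measure_swap.
- by move=> z /= /PN.
Qed.

Lemma measurable_fun_swap (f : T1 * T2 -> R) : measurable_fun (A `*` B) f ->
  measurable_fun (B `*` A) (fun z => f (swap z)).
Proof.
move=> mf; apply: (measurable_comp _ _ mf); first exact: measurableX.
  by move=> _ [[y x] /= [By Ax] <-].
by apply: measurable_funTS; exact: measurable_swap.
Qed.

Lemma rintegrable_swap (f : T1 * T2 -> R) :
  rintegrable (m1 \x m2)%E (A `*` B) f ->
  rintegrable (m2 \x m1)%E (B `*` A) (fun z => f (swap z)) /\
  \int[(m2 \x m1)%E]_(z in B `*` A) f (swap z) =
  \int[(m1 \x m2)%E]_(z in A `*` B) f z.
Proof.
move=> fi; have mf := rintegrable_measurable fi.
have mf' := measurable_fun_swap mf.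
have E : (B `*` A) = @swap T2 T1 @^-1` (A `*` B).
  by apply/seteqP; split => -[x y] /= [].
have ms := @measurable_swap _ _ T2 T1.
have mAB : measurable (A `*` B) by exact: measurableX.
have EI (g : T1 * T2 -> \bar R) : measurable_fun (A `*` B) g -> (forall z, 0 <= g z)%E ->
   (\int[(m2 \x m1)]_(z in B `*` A) g (swap z) = \int[(m1 \x m2)]_(z in A `*` B) g z)%E.
  move=> mg g0.
  have := @ge0_integral_pushforward _ _ (T2 * T1)%type (T1 * T2)%type R swap ms (m2 \x m1)%E (A `*` B) g.
  rewrite -E => <- //.
  apply: (@eq_measure_integral _ _ _ _ _ swap_measure) => C mC _.
  by rewrite /= /pushforward product_measure_swap.
split.
  apply/integrableP; split; first exact/measurable_EFinP.
  have /integrableP[mg] := fi; rewrite -(EI (abse \o (EFin \o f)))//; last exact: (fun z => abse_ge0 _).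
  exact: measurableT_comp.
have /measurable_EFinP mE := mf.
rewrite /Rintegral integralE [in RHS]integralE.
rewrite -(EI (EFin \o f)^\+%E (measurable_funepos mE) (funepos_ge0 _)).
rewrite -(EI (EFin \o f)^\-%E (measurable_funeneg mE) (funeneg_ge0 _)).
by congr (fine (_ - _)); apply: eq_integral => z _; rewrite ?funeposE ?funenegE.
Qed.

End product_swap.

(** * Smooth functions *)

Section smooth_closure.
Context (R : realType) (V : normedModType R).
Implicit Types f g : V -> R.

(** Differentiation acts on [f] itself and lowers the order, so that stability under sums, products
    and compositions goes by induction on [k]. *)
Fixpoint smooth_order k f : Prop :=
  [/\ continuous f, forall x e, derivable f x e &
      if k is k'.+1 then forall e, smooth_order k' ('D_e f) else True].

Lemma iterD_rcons s e f : Defs.iterD (rcons s e) f = Defs.iterD s ('D_e f).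
Proof. by elim: s => //= e' s ->. Qed.

Lemma smoothP f : smooth f <-> forall k, smooth_order k f.
Proof.
split=> [sf k|sf].
  elim: k f sf => [|k IH] f sf /=.
    by have [cf df] := sf [::]; split.
  have [cf df] := sf [::]; split=> // e; apply: IH => s.
  by rewrite -iterD_rcons; exact: sf.
move=> s; have := sf (size s).
elim/last_ind: s f {sf} => [|s e IH] f; first by case.
by rewrite size_rcons iterD_rcons => -[_ _ /(_ e)]; exact: IH.
Qed.

Lemma smooth_orderW k f : smooth_order k.+1 f -> smooth_order k f.
Proof.
elim: k f => [|k IH] f [cf df Df]; first by split.
split => // e; apply: IH; exact: Df.
Qed.

Lemma smooth_orderD k f g :
  smooth_order k f -> smooth_order k g -> smooth_order k (f \+ g).
Proof.
elim: k f g => [|k IH] f g [cf df Df] [cg dg Dg];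
  (split; [move=> x; exact: cvgD (cf x) (cg x)|
           move=> x e; exact: derivableD (df x e) (dg x e)|]); first exact: I.
move=> e; rewrite (_ : 'D_e _ = 'D_e f \+ 'D_e g); first exact: (IH _ _ (Df e) (Dg e)).
by apply/funext => x; exact: deriveD (df x e) (dg x e).
Qed.

Lemma smooth_orderM k f g :
  smooth_order k f -> smooth_order k g -> smooth_order k (f \* g).
Proof.
elim: k f g => [|k IH] f g sf sg; have [cf df Df] := sf; have [cg dg Dg] := sg;
  (split; [move=> x; exact: cvgM (cf x) (cg x)|
           move=> x e; exact: derivableM (df x e) (dg x e)|]); first exact: I.
move=> e; rewrite (_ : 'D_e _ = (f \* 'D_e g) \+ (g \* 'D_e f)).
  apply: smooth_orderD.
    exact: (IH _ _ (smooth_orderW sf) (Dg e)).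
  exact: (IH _ _ (smooth_orderW sg) (Df e)).
by apply/funext => x; exact: deriveM (df x e) (dg x e).
Qed.

Lemma smooth_order_cst k c : smooth_order k (cst c : V -> R).
Proof.
elim: k c => [|k IH] c; split => //.
- by move=> x; exact: cvg_cst.
- by move=> x; exact: cvg_cst.
- move=> e; rewrite (_ : 'D_e _ = cst 0); first exact: IH.
  by apply/funext => x; exact: derive_cst.
Qed.

Lemma smoothM f g : smooth f -> smooth g -> smooth (f \* g).
Proof. by move=> /smoothP sf /smoothP sg; apply/smoothP => k; exact: smooth_orderM. Qed.

Lemma smoothD f g : smooth f -> smooth g -> smooth (f \+ g).
Proof. by move=> /smoothP sf /smoothP sg; apply/smoothP => k; exact: smooth_orderD. Qed.

Lemma smooth_cst c : smooth (cst c : V -> R).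
Proof. by apply/smoothP => k; exact: smooth_order_cst. Qed.

Lemma smooth_continuous f : smooth f -> continuous f.
Proof. by move=> /(_ [::])[]. Qed.

Lemma smooth_derivable f x e : smooth f -> derivable f x e.
Proof. by move=> /(_ [::])[]. Qed.

Lemma smooth_derive f e : smooth f -> smooth ('D_e f).
Proof. by move=> sf s; rewrite -iterD_rcons; exact: sf. Qed.

End smooth_closure.

Section smooth_comp_affine.
Variables (R : realType) (V W : normedModType R) (j E : V -> W).
Hypothesis jE : forall (h : R) e x, h *: E e + j x = j (h *: e + x).
Hypothesis cj : continuous j.

Let quotient_comp (g : W -> R) x e :
  (fun h : R => h^-1 *: ((g \o shift (j x)) (h *: E e) - g (j x))) =
  (fun h : R => h^-1 *: (((g \o j) \o shift x) (h *: e) - (g \o j) x)).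
Proof. by apply/funext => h /=; rewrite jE. Qed.

(** [jE] says that [j] is affine with linear part [E]: the difference quotients of [g \o j] in
    direction [e] are those of [g] in direction [E e]. This covers affine substitutions,
    projections, slices and the exchange of coordinates. *)
Lemma derive_comp_affine (g : W -> R) e : 'D_e (g \o j) = 'D_(E e) g \o j.
Proof. by apply/funext => x /=; rewrite /derive quotient_comp. Qed.

Lemma smooth_comp_affine (g : W -> R) : smooth g -> smooth (g \o j).
Proof.
move=> /smoothP sg; apply/smoothP => k; move: (sg k) => {sg}.
have dE (h : W -> R) x e : derivable h (j x) (E e) -> derivable (h \o j) x e.
  by rewrite /derivable quotient_comp.
have H (h : W -> R) : continuous h -> continuous (h \o j).
  by move=> ch x; apply: continuous_comp; [exact: cj|exact: ch].
elim: k g => [|k IH] g [cg dg Dg].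
  by split; [exact: H|move=> x e; exact: dE|].
split; [exact: H|by move=> x e; exact: dE|].
by move=> e; rewrite derive_comp_affine; apply: IH; exact: Dg.
Qed.

End smooth_comp_affine.

Section smooth_real.
Context (R : realType).
Implicit Types (f g : R -> R) (x y c d e : R).

Lemma smooth_affine f c d : smooth f -> smooth (fun y => f (c * y + d)).
Proof.
apply: (@smooth_comp_affine R R R (fun y => c * y + d) (fun e => c * e)).
  by move=> h e x; rewrite /GRing.scale /=; ring.
move=> x; apply: cvgD; last exact: cvg_cst.
by apply: cvgM; [exact: cvg_cst|exact: cvg_id].
Qed.

(** [smooth] asks for derivatives in every direction, which on the line all reduce to direction 1 by
    the substitution of [e * h] for [h]. *)
Lemma derive_real f x e : derivable f x 1 -> derivable f x e /\ 'D_e f x = e * 'D_1 f x.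
Proof.
move=> df.
have [->|e0] := eqVneq e 0; first by rewrite mul0r derive0; split; [exact: derivable0|].
have H : h^-1 *: ((f \o shift x) (h *: e) - f x) @[h --> 0^'] --> e * 'D_1 f x.
  have dfl : h^-1 *: ((f \o shift x) (h *: 1) - f x) @[h --> 0^'] --> 'D_1 f x by exact: df.
  have : (e * h)^-1 *: ((f \o shift x) ((e * h) *: 1) - f x) @[h --> 0^'] --> 'D_1 f x.
    apply: (cvg_comp (fun h => e * h) _ _ dfl).
    move=> A [r /= r0 rA]; exists (r / `|e|); first by rewrite /= divr_gt0// normr_gt0.
    move=> h /= hr h0; apply: rA; last by rewrite mulf_neq0.
    move: hr; rewrite /= !sub0r !normrN normrM ltr_pdivlMr ?normr_gt0//.
    by rewrite mulrC.
  move=> /(cvgM (cvg_cst e)) /=.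
  apply: cvg_trans; apply: near_eq_cvg; near=> h.
  have h0 : h != 0 by near: h; exact: nbhs_dnbhs_neq.
  rewrite /= /GRing.scale /= mulr1 (mulrC h e) invfM; field.
  by rewrite h0 e0.
by split; [apply/cvg_ex; eexists; exact: H|exact/cvg_lim].
Unshelve. all: by end_near. Qed.

Lemma smooth_order1 k f g : (forall x, is_derive x 1 f (g x)) ->
  smooth_order k g -> smooth_order k.+1 f.
Proof.
move=> fg sg; have df x : derivable f x 1 by [].
split.
- by move=> x; apply/differentiable_continuous/derivable1_diffP.
- by move=> x e; exact: (derive_real e (df x)).1.
- move=> e; rewrite (_ : 'D_e f = cst e \* g).
    by apply: smooth_orderM => //; exact: smooth_order_cst.
  apply/funext => x; rewrite (derive_real e (df x)).2.
  by congr (_ * _); apply: derive_val.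
Qed.

End smooth_real.

(** * Test functions on an interval *)

Section flat.
Context (R : realType).
Implicit Types x y : R.

(* The factor [x^-n] makes the family closed under differentiation. *)
Definition flat n x : R := if 0 < x then x^-1 ^+ n * expR (- x^-1) else 0.

Lemma flat_ge0 n x : 0 <= flat n x.
Proof.
rewrite /flat; case: ifPn => // x0.
by rewrite mulr_ge0 ?expR_ge0// exprn_ge0// invr_ge0 ltW.
Qed.

(** This is $t^{n+1}\le(n+1)!\,e^t$ at $t=1/x$. *)
Lemma flat_le n x : flat n x <= n.+1`!%:R * `|x|.
Proof.
rewrite /flat; case: ifPn => x0; last by rewrite mulr_ge0.
have xi0 : 0 < x^-1 by rewrite invr_gt0.
rewrite gtr0_norm// expRN -ler_pdivlMr ?invr_gt0 ?expR_gt0// invrK.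
have := expR_ge1Dxn n (ltW xi0) => h.
have f0 : 0 < n.+1`!%:R :> R by rewrite ltr0n fact_gt0.
have : x^-1 ^+ n.+1 <= n.+1`!%:R * expR (x^-1).
  rewrite -ler_pdivrMl// mulrC; apply: le_trans h.
  by rewrite lerDr.
rewrite exprS -(ler_pM2l x0) mulrA mulfV ?gt_eqF// mul1r.
by move/le_trans; apply; rewrite mulrA (mulrC x).
Qed.

Lemma flat0_le1 x : flat 0 x <= 1.
Proof.
rewrite /flat; case: ifPn => // x0.
by rewrite expr0 mul1r -expR0 ler_expR oppr_le0 invr_ge0 ltW.
Qed.

Lemma is_derive_flat n x :
  is_derive x 1 (flat n) (flat n.+2 x - n%:R * flat n.+1 x).
Proof.
have [x0|x0|->] := ltrgt0P x.
- apply: (@near_eq_is_derive _ _ _ (fun y => y^-1 ^+ n * expR (- y^-1))).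
  + near=> y; rewrite /flat ifT//.
    by near: y; exact: lt_nbhsr.
  + have xn0 : x != 0 by rewrite gt_eqF.
    have d1 : is_derive x 1 (fun y : R => y^-1) (- x ^- 2).
      by have := is_deriveV xn0 (is_derive_id x 1); rewrite /GRing.scale /= mulr1.
    have d2 : is_derive x 1 (fun y : R => - y^-1) (x ^- 2).
      by apply: is_derive_eq; rewrite opprK.
    have d3 : is_derive x 1 (fun y : R => expR (- y^-1)) (x ^- 2 * expR (- x^-1)).
      by rewrite mulrC; exact: (is_derive1_comp (is_derive_expR _) d2).
    have d4 : is_derive x 1 (fun y : R => y^-1 ^+ n) (n%:R * x^-1 ^+ n.-1 * (- x ^- 2)).
      have e1 : is_derive (x^-1) 1 (fun t : R => t ^+ n) (n%:R * x^-1 ^+ n.-1).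
        split; first exact: exprn_derivable.
        by rewrite exp_derive /GRing.scale /= mulr1.
      exact: (is_derive1_comp e1 d1).
    have d5 := is_deriveM d4 d3.
    rewrite (_ : _ - _ = x^-1 ^+ n *: (x ^- 2 * expR (- x^-1)) +
      expR (- x^-1) *: (n%:R * x^-1 ^+ n.-1 * (- x ^- 2))); first exact: d5.
    rewrite /flat x0 /GRing.scale /=.
    case: n {d4 d5} => [|n]; first by rewrite !mul0r !mulr0 !expr0 subr0 mul1r addr0; field.
    rewrite -pred_Sn !exprVn !exprS /=; field.
    by rewrite xn0 expf_neq0.
- apply: (@near_eq_is_derive _ _ _ (cst 0)).
  + near=> y; rewrite /flat ifF//; apply/negbTE; rewrite -leNgt ltW//.
    by near: y; exact: lt_nbhsl.
  + have -> : flat n.+2 x - n%:R * flat n.+1 x = 0.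
      by rewrite /flat !(lt_gtF x0) mulr0 subr0.
    exact: is_derive_cst.
- rewrite /flat ltxx mulr0 subr0.
  have H : h^-1 *: ((flat n \o shift 0) (h *: 1) - flat n 0) @[h --> 0^'] --> (0 : R).
    apply/cvgr0Pnorm_le => e e0; near=> h.
    have h0 : h != 0 by near: h; exact: nbhs_dnbhs_neq.
    rewrite /= addr0 /GRing.scale /= mulr1 {2}/flat ltxx subr0 normrM normfV.
    rewrite ger0_norm ?flat_ge0// mulrC ler_pdivrMr ?normr_gt0//.
    (* For positive [h], [flat n h] is [h] times [flat n.+1 h]. The linear bound on the latter makes
       [flat n] quadratically small at 0, so that its difference quotients there tend to 0. *)
    apply: (@le_trans _ _ (n.+2`!%:R * `|h| * `|h|)).
      have := flat_le n.+1 h; rewrite /flat; case: ifPn => [hp|_ _]; last by rewrite !mulr_ge0.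
      rewrite exprS -mulrA => /(ler_wpM2l (ltW hp)).
      rewrite mulVKf// => /le_trans; apply.
      by rewrite gtr0_norm// mulrC.
    rewrite ler_wpM2r// -ler_pdivlMl ?ltr0n ?fact_gt0//.
    near: h; apply: dnbhs0_le; rewrite mulr_gt0// invr_gt0 ltr0n fact_gt0.
  split; first by apply/cvg_ex; exists 0.
  exact/cvg_lim.
Unshelve. all: by end_near. Qed.

Lemma smooth_flat n : smooth (flat n).
Proof.
apply/smoothP => k; elim: k n => [|k IH] n.
  have df x : derivable (flat n) x 1 by have [] := is_derive_flat n x.
  split; last exact: I.
  - by move=> x; apply/differentiable_continuous/derivable1_diffP.
  - by move=> x e; exact: (derive_real e (df x)).1.
apply: (@smooth_order1 _ _ _ (flat n.+2 \+ (cst (- n%:R) \* flat n.+1))).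
  by move=> x; have := is_derive_flat n x; rewrite /= mulNr.
by apply: smooth_orderD => //; apply: smooth_orderM => //; exact: smooth_order_cst.
Qed.

(** Positive exactly on []p, q[]. The scaling by [n.+1] makes the bumps tend to 1 on this interval,
    so that they approximate its indicator. *)
Definition bump p q n x : R :=
  flat 0 (n.+1%:R * x + - (n.+1%:R * p)) * flat 0 (- n.+1%:R * x + n.+1%:R * q).

Lemma smooth_bump p q n : smooth (bump p q n).
Proof. by apply: smoothM; apply: smooth_affine; exact: smooth_flat. Qed.

Lemma bump_ge0 p q n x : 0 <= bump p q n x.
Proof. by rewrite mulr_ge0// flat_ge0. Qed.

Lemma bump_le1 p q n x : bump p q n x <= 1.
Proof. by rewrite -(mulr1 1) ler_pM// ?flat_ge0// flat0_le1. Qed.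

Lemma bumpE p q n x : p < x -> x < q ->
  bump p q n x = expR (- ((x - p)^-1 / n.+1%:R)) * expR (- ((q - x)^-1 / n.+1%:R)).
Proof.
move=> px xq; have n0 : 0 < n.+1%:R :> R by rewrite ltr0n.
have -> : bump p q n x = flat 0 (n.+1%:R * (x - p)) * flat 0 (n.+1%:R * (q - x)).
  by rewrite /bump; congr (flat _ _ * flat _ _); ring.
by rewrite /flat !pmulr_rgt0// !subr_gt0 px xq !expr0 !mul1r !invfM ![n.+1%:R^-1 * _]mulrC.
Qed.

Lemma bump_gt0 p q n x : p < x -> x < q -> 0 < bump p q n x.
Proof. by move=> px xq; rewrite bumpE// mulr_gt0// expR_gt0. Qed.

Lemma bump_eq0 p q n x : ~~ (p < x < q) -> bump p q n x = 0.
Proof.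
have n0 : 0 < n.+1%:R :> R by rewrite ltr0n.
have -> : bump p q n x = flat 0 (n.+1%:R * (x - p)) * flat 0 (n.+1%:R * (q - x)).
  by rewrite /bump; congr (flat _ _ * flat _ _); ring.
rewrite /flat !pmulr_rgt0// !subr_gt0 negb_and => /orP[] /negbTE ->.
  by rewrite mul0r.
by rewrite mulr0.
Qed.

Lemma bump_cvg p q x : p < x -> x < q -> bump p q n x @[n --> \oo] --> (1 : R).
Proof.
move=> px xq; 
rewrite (_ : (fun n => bump p q n x) = fun n =>
  expR (- ((x - p)^-1 / n.+1%:R)) * expR (- ((q - x)^-1 / n.+1%:R))); last first.
  by apply/funext => n; rewrite bumpE.
have H (c : R) : expR (- (c / n.+1%:R)) @[n --> \oo] --> (1 : R).
  rewrite -[X in _ --> X]expR0; apply: continuous_cvg; first exact: continuous_expR.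
  rewrite -[X in _ --> X]oppr0; apply: cvgN; rewrite -[X in _ --> X](mulr0 c).
  by apply: cvgM; [exact: cvg_cst|exact: cvg_harmonic].
by rewrite -[X in _ --> X](mulr1 1); apply: cvgM; exact: H.
Qed.

End flat.

Section tests.
Context (R : realType).
Implicit Types (f g : R -> R) (a b c d : R).

Definition test_itv a b f := smooth f /\
  exists p q, [/\ a < p, q < b & forall x, ~~ (p <= x <= q) -> f x = 0].

Lemma test_itv_smooth a b f : test_itv a b f -> smooth f.
Proof. by case. Qed.

Lemma test_itv_measurable a b f : test_itv a b f -> measurable_fun setT f.
Proof. by move=> [/smooth_continuous cf _]; exact: continuous_measurable_fun. Qed.

Lemma test_itv_bounded a b f : test_itv a b f -> exists M, forall x, `|f x| <= M.
Proof.
move=> [/smooth_continuous cf [p [q [_ _ f0]]]].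
have [pq|qp] := leP p q; last first.
  exists 0 => x; rewrite f0 ?normr0//; apply/negP => /andP[px xq].
  by have := lt_le_trans qp (le_trans px xq); rewrite ltxx.
have cnf : {within `[p, q], continuous (fun x => `|f x|)}.
  apply: continuous_subspaceT => x; apply: continuous_comp; first exact: cf.
  exact: norm_continuous.
have [c _ fc] := EVT_max pq cnf.
exists `|f c| => x; have [xpq|xpq] := boolP (p <= x <= q).
  by apply: fc; rewrite in_itv.
by rewrite f0// normr0.
Qed.

Lemma test_itv_bump a b p q n : a < p -> q < b -> test_itv a b (bump p q n).
Proof.
move=> ap qb; split; first exact: smooth_bump.
exists p, q; split => // x xpq; apply: bump_eq0; apply: contra xpq.
by move=> /andP[/ltW -> /ltW ->].
Qed.

Lemma test_itvB a b f g k : test_itv a b f -> test_itv a b g ->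
  test_itv a b (fun x => f x + k * g x).
Proof.
move=> [sf [p [q [ap qb f0]]]] [sg [p' [q' [ap' qb' g0]]]]; split.
  by apply: (smoothD sf); apply: (smoothM _ sg); exact: smooth_cst.
exists (Num.min p p'), (Num.max q q'); split.
- by rewrite lt_min ap.
- by rewrite gt_max qb.
move=> x; rewrite negb_and -!ltNge !lt_min !gt_max => /orP[/andP[h1 h2]|/andP[h1 h2]].
  by rewrite f0 ?g0 ?mulr0 ?addr0// negb_and -!ltNge ?h1 ?h2.
by rewrite f0 ?g0 ?mulr0 ?addr0// negb_and -!ltNge ?h1 ?h2 orbT.
Qed.

Lemma test_itv_derive a b f : test_itv a b f -> test_itv a b ('D_1 f).
Proof.
move=> [sf [p [q [ap qb f0]]]]; split; first exact: smooth_derive.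
exists p, q; split => // x xpq.
rewrite (@near_eq_derive _ _ _ _ (cst 0)); first by rewrite derive_cst.
move: xpq; rewrite negb_and -!ltNge => /orP[xp|xq].
  near=> y; rewrite f0// negb_and -!ltNge; apply/orP; left.
  by near: y; exact: lt_nbhsl.
near=> y; rewrite f0// negb_and -!ltNge; apply/orP; right.
by near: y; exact: lt_nbhsr.
Unshelve. all: by end_near. Qed.

(** The vanishing mean makes the primitive that starts at minus infinity vanish again to the right
    of the support. *)
Lemma test_itv_primitive a b f : test_itv a b f ->
  \int[lebesgue_measure]_(x in `]a, b[) f x = 0 ->
  exists2 F, test_itv a b F & 'D_1 F = f.
Proof.
move=> tf; have [sf [p [q [ap qb f0]]]] := tf => fI0.
have cf := smooth_continuous sf.
have fpatch (D : set R) : `[p, q] `<=` D -> f \_ D = f.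
  move=> pqD; apply/funext => x; rewrite patchE; case: ifPn => // xD.
  rewrite f0//; apply: contra xD => xpq; apply/mem_set/pqD.
  by rewrite /= in_itv.
have fi : rintegrable lebesgue_measure setT f.
  have : rintegrable lebesgue_measure `[p, q] f.
    apply: continuous_compact_integrable; first exact: segment_compact.
    exact: continuous_subspaceT.
  move/(@integrable_mkcond _ _ _ lebesgue_measure _ (EFin \o f) (measurable_itv _)).
  by rewrite restrict_EFin fpatch.
have IfT D : measurable D -> `[p, q] `<=` D -> \int[lebesgue_measure]_(x in D) f x = 0.
  move=> mD pqD; rewrite Rintegral_mkcond fpatch// -fI0 [RHS]Rintegral_mkcond fpatch//.
  by move=> x; rewrite /= !in_itv/= => /andP[px xq]; rewrite (lt_le_trans ap)//= (le_lt_trans xq).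
pose F x := \int[lebesgue_measure]_(t in `]-oo, x]) f t.
have dF (x : R) : is_derive x (1 : R) F (f x).
  have [] := @continuous_FTC1 R f -oo%O x (x + 1) _ _ _ _.
  - by rewrite ltrDl.
  - by apply: integrableS fi.
  - exact: ltNyr.
  - exact: cf.
  by move=> h1 h2; split; [exact: h1|rewrite -derive1E; exact: h2].
exists F; last by apply/funext => x; exact: derive_val.
split.
  by apply/smoothP => k; apply: smooth_orderW; apply: smooth_order1 dF _; move/smoothP : sf; apply.
exists p, q; split => // x.
rewrite negb_and -!ltNge => /orP[xp|xq]; last first.
  by apply: IfT => // y; rewrite /= !in_itv/= => /andP[_ yq]; rewrite (le_trans yq)// ltW.
rewrite /F (@eq_Rintegral _ _ _ _ _ (cst 0)); first by rewrite Rintegral_cst// mul0r.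
move=> y; rewrite inE /= in_itv/= => yx.
by rewrite f0// negb_and -ltNge (le_lt_trans yx xp).
Qed.

End tests.

(** * Absolutely continuous functions *)

Section tensor.
Context d1 d2 (T1 : measurableType d1) (T2 : measurableType d2) (R : realType).
Variable m1 : {sigma_finite_measure set T1 -> \bar R}.
Variable m2 : {sigma_finite_measure set T2 -> \bar R}.
Variables (A : set T1) (B : set T2) (mA : measurable A) (mB : measurable B).

Lemma measurable_fun_fst (f : T1 -> R) : measurable_fun A f ->
  measurable_fun (A `*` B) (fun z => f z.1).
Proof.
move=> mf; apply: (measurable_comp mA _ mf); first by move=> _ [[x y] /= [Ax _] <-].
by apply: measurable_funTS; exact: measurable_fst.
Qed.

Lemma measurable_fun_snd (g : T2 -> R) : measurable_fun B g ->
  measurable_fun (A `*` B) (fun z => g z.2).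
Proof.
move=> mg; apply: (measurable_comp mB _ mg); first by move=> _ [[x y] /= [_ By] <-].
by apply: measurable_funTS; exact: measurable_snd.
Qed.

Lemma rintegrable_tensor (f : T1 -> R) (g : T2 -> R) :
  rintegrable m1 A f -> rintegrable m2 B g ->
  rintegrable (m1 \x m2)%E (A `*` B) (fun z => f z.1 * g z.2) /\
  \int[(m1 \x m2)%E]_(z in A `*` B) (f z.1 * g z.2) =
  (\int[m1]_(x in A) f x) * (\int[m2]_(y in B) g y).
Proof.
move=> fi gi.
have fgi : rintegrable (m1 \x m2)%E (A `*` B) (fun z => f z.1 * g z.2).
  apply: fubini_tonelli_slices => //.
  - apply: measurable_funM.
      exact: measurable_fun_fst (rintegrable_measurable fi).
    exact: measurable_fun_snd (rintegrable_measurable gi).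
  - by apply: aeW => x Ax; exact: (rintegrableZ mB (f x) gi).
  - exists (fun x => \int[m2]_(y in B) `|g y| * `|f x|).
      by apply: rintegrableZ => //; exact: rintegrable_norm.
    apply: aeW => x Ax /=; under eq_Rintegral do rewrite normrM.
    by rewrite RintegralZl//; [rewrite mulrC|exact: rintegrable_norm].
split => //.
have [_ _ ->] := fubini_slices mA mB fgi.
rewrite -RintegralZr//; apply: eq_Rintegral => x _ /=.
by rewrite RintegralZl.
Qed.

End tensor.

Section AC.
Context (R : realType).
Notation mu := (@lebesgue_measure R).
Notation Rm := (measurableTypeR R).
Implicit Types (p q P Q : R -> R) (a b c x s : R).

Let mIoo a b : measurable (`]a, b[%classic : set Rm).
Proof. exact: measurable_itv. Qed.

Lemma set_itvoo_eq0 b : `]b, b[%classic = set0 :> set R.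
Proof. by rewrite set_itv_ge ?bnd_simp ?ltxx. Qed.

Lemma rintegrable_sub a b c d f : a <= c -> d <= b ->
  rintegrable mu `]a, b[ f -> rintegrable mu `]c, d[ f.
Proof.
move=> ac db; apply: integrableS => //.
by move=> x; rewrite /= !in_itv/= => /andP[cx xd]; rewrite (le_lt_trans ac)//= (lt_le_trans xd).
Qed.

Lemma Rintegral_oo_split a b x f : a <= x <= b -> rintegrable mu `]a, b[ f ->
  \int[mu]_(t in `]a, b[) f t = \int[mu]_(t in `]a, x[) f t + \int[mu]_(t in `]x, b[) f t.
Proof.
move=> /andP[ax xb] fi.
have [xb'|] := ltP x b; last first.
  move=> bx; have -> : x = b by apply/eqP; rewrite eq_le xb.
  by rewrite set_itvoo_eq0 Rintegral_set0 addr0.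
have := @Rintegral_itvB R f (BRight a) (BLeft b) x fi.
rewrite !bnd_simp => /(_ ax xb') <-.
have E := Rintegral_itv_bndo_bndc (rintegrable_sub (lexx a) xb fi).
by rewrite E addrC subrK.
Qed.

Lemma Rintegral_lt a b s q : s <= b ->
  \int[mu]_(t in `]a, b[) ((t < s)%R%:R * q t) = \int[mu]_(t in `]a, s[) q t.
Proof.
move=> sb; transitivity (\int[mu]_(t in `]a, b[) (q \_ `]-oo, s[) t).
  apply: eq_Rintegral => t _; rewrite patchE.
  case: ifPn => [|/negP]; rewrite inE /= in_itv/= => ts.
    by rewrite ts mul1r.
  by rewrite (negbTE (introN idP ts)) mul0r.
rewrite -Rintegral_mkcondr; congr Rintegral; apply/seteqP; split => t /=; rewrite !in_itv/=.
  by move=> [/andP[-> _] ->].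
by move=> /andP[-> ts]; rewrite ts (lt_le_trans ts sb).
Qed.

(** The square is cut along its diagonal, and Fubini is applied to each half in the order that
    leaves a primitive inside. This is integration by parts for two primitives, without any
    differentiation. *)
Lemma fubini_triangle a b p q : rintegrable mu `]a, b[ p -> rintegrable mu `]a, b[ q ->
  [/\ rintegrable mu `]a, b[ (fun x => p x * \int[mu]_(t in `]a, x[) q t),
      rintegrable mu `]a, b[ (fun x => q x * \int[mu]_(t in `]a, x[) p t) &
      (\int[mu]_(x in `]a, b[) p x) * (\int[mu]_(x in `]a, b[) q x) =
      \int[mu]_(x in `]a, b[) (p x * \int[mu]_(t in `]a, x[) q t) +
      \int[mu]_(x in `]a, b[) (q x * \int[mu]_(t in `]a, x[) p t)].
Proof.
move=> pi qi.
have mI := mIoo a b.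
have [Ki KE] := rintegrable_tensor mI mI pi qi.
have mlt : measurable_fun (`]a, b[%classic `*` `]a, b[%classic : set (Rm * Rm))
    (fun z : Rm * Rm => (z.2 < z.1)%R%:R : R).
  apply: measurable_funTS; apply: measurable_fun_natr.
  exact: (measurable_fun_ltr measurable_snd measurable_fst).
have K1i : rintegrable (mu \x mu)%E (`]a, b[%classic `*` `]a, b[%classic)
    (fun z : Rm * Rm => (z.2 < z.1)%R%:R * (p z.1 * q z.2)).
  apply: (@rintegrable_bounded _ _ _ _ _ _ _ _ 1) => //; first exact: measurableX.
  by move=> z _; case: (_ < _); rewrite ?normr1 ?normr0.
have K2i : rintegrable (mu \x mu)%E (`]a, b[%classic `*` `]a, b[%classic)
    (fun z : Rm * Rm => (1 - (z.2 < z.1)%R%:R) * (p z.1 * q z.2)).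
  apply: (@rintegrable_bounded _ _ _ _ _ _ _ _ 1) => //; first exact: measurableX.
    exact: measurable_funB.
  by move=> z _; case: (_ < _); rewrite ?subr0 ?subrr ?normr1 ?normr0.
have [_ F1i F1E] := fubini_slices mI mI K1i.
have [K2i' K2E] := rintegrable_swap mI mI K2i.
have [_ F2i F2E] := fubini_slices mI mI K2i'.
have E1 x : `]a, b[%classic x -> \int[mu]_(y in `]a, b[) ((y < x)%R%:R * (p x * q y)) =
    p x * \int[mu]_(t in `]a, x[) q t.
  rewrite /= in_itv/= => /andP[ax xb].
  rewrite (Rintegral_lt _ (fun y => p x * q y) (ltW xb)) RintegralZl//.
  by apply: (@rintegrable_sub a b) => //; exact: ltW.
have E2 y : `]a, b[%classic y -> \int[mu]_(x in `]a, b[) ((1 - (y < x)%R%:R) * (p x * q y)) =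
    q y * \int[mu]_(t in `]a, y[) p t.
  rewrite /= in_itv/= => /andP[ay yb].
  transitivity (\int[mu]_(x in `]a, b[) (q y * ((x <= y)%R%:R * p x))).
    by apply: eq_Rintegral => x _; rewrite leNgt; case: (_ < _); rewrite /=; ring.
  have le_i : rintegrable mu `]a, b[ (fun x => (x <= y)%R%:R * p x).
    have : rintegrable mu `]a, b[ (fun x => p x - (y < x)%R%:R * p x).
      apply: rintegrableB => //; apply: (@rintegrable_bounded _ _ _ _ _ _ _ _ 1) => //.
        by apply: measurable_fun_natr; exact: measurable_fun_ltr.
      by move=> z _; case: (_ < _); rewrite ?normr1 ?normr0.
    apply: (eq_rintegrable mI) => x _; rewrite leNgt; case: (_ < _) => /=; ring.
  rewrite RintegralZl//; congr (_ * _).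
  rewrite -(Rintegral_lt _ p (ltW yb)); apply: ae_eq_Rintegral => //.
  - exact: rintegrable_measurable le_i.
  - apply: measurable_funM; last exact: rintegrable_measurable pi.
    by apply: measurable_fun_natr; exact: measurable_fun_ltr.
  - exists [set y]; split => //; first exact: lebesgue_measure_set1.
    move=> x /= /not_implyP[_ H]; apply: contrapT => /eqP xy; apply: H.
    by rewrite le_eqVlt (negbTE xy).
split.
- by apply: (eq_rintegrable mI _ F1i) => x; exact: E1.
- by apply: (eq_rintegrable mI _ F2i) => y; exact: E2.
- rewrite -KE.
  transitivity (\int[(mu \x mu)%E]_(z in `]a, b[%classic `*` `]a, b[%classic)
     ((z.2 < z.1)%R%:R * (p z.1 * q z.2) + (1 - (z.2 < z.1)%R%:R) * (p z.1 * q z.2))).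
    by apply: eq_Rintegral => z _; ring.
  rewrite RintegralD//; last exact: measurableX.
  congr (_ + _).
    by rewrite F1E; apply: eq_Rintegral => x; rewrite inE; exact: E1.
  by rewrite -K2E F2E; apply: eq_Rintegral => x; rewrite inE; exact: E2.
Qed.

(* [P] is absolutely continuous on [a, b] and [P' = p] almost everywhere. *)
Definition AC a b P p := rintegrable mu `]a, b[ p /\
  forall x, a <= x <= b -> P x = P a + \int[mu]_(t in `]a, x[) p t.

Lemma AC_sub a b c P p : c <= b -> AC a b P p -> AC a c P p.
Proof.
move=> cb [pi PE]; split; first exact: rintegrable_sub pi.
by move=> x /andP[ax xc]; apply: PE; rewrite ax (le_trans xc).
Qed.

Lemma AC_Rintegral a b P p : a <= b -> AC a b P p -> \int[mu]_(t in `]a, b[) p t = P b - P a.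
Proof. by move=> ab [pi PE]; rewrite (PE b) ?ab ?lexx// addrC addKr. Qed.

Lemma AC_measurable a b P p : AC a b P p -> measurable_fun (`]a, b[%classic : set Rm) P.
Proof.
move=> [pi PE].
have i1 : rintegrable mu `]a, b[ (cst 1).
  apply: sqintegrable_rintegrable => //; last apply: sqintegrable_cst => //.
    by rewrite /= lebesgue_measure_itv/=; case: ifP => _; rewrite -?EFinB ltry.
  by rewrite /= lebesgue_measure_itv/=; case: ifP => _; rewrite -?EFinB ltry.
(* Against the constant 1 the triangle formula says that the primitive of [p] is integrable, in
   particular measurable. *)
have [h _ _] := fubini_triangle i1 pi.
have : measurable_fun (`]a, b[%classic : set Rm) (fun x => P a + 1 * \int[mu]_(t in `]a, x[) p t).
  by apply: measurable_funD => //; exact: rintegrable_measurable h.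
apply: eq_measurable_fun => x; rewrite inE /= in_itv/= => /andP[ax xb].
by rewrite mul1r [in RHS]PE// ltW//= ltW.
Qed.

Lemma AC_bound a b P p x : AC a b P p -> a <= x <= b ->
  `|P x| <= `|P a| + \int[mu]_(t in `]a, b[) `|p t|.
Proof.
move=> [pi PE] /[dup] axb /andP[ax xb]; rewrite PE// (le_trans (ler_normD _ _))// lerD2l.
have pxi := rintegrable_sub (lexx a) xb pi.
apply: (le_trans (le_normr_Rintegral _ pxi)) => //.
rewrite [leRHS](Rintegral_oo_split axb); last exact: rintegrable_norm.
by rewrite lerDl Rintegral_ge0.
Qed.

Lemma AC_cst a b k : AC a b (cst k) (cst 0).
Proof.
split; first exact: integrable0.
by move=> x _; rewrite Rintegral_cst// mul0r addr0.
Qed.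

Lemma AC_affine a b k : AC a b (fun x => k + x) (cst 1).
Proof.
split.
  apply: sqintegrable_rintegrable => //; last apply: sqintegrable_cst => //.
    by rewrite /= lebesgue_measure_itv/=; case: ifP => _; rewrite -?EFinB ltry.
  by rewrite /= lebesgue_measure_itv/=; case: ifP => _; rewrite -?EFinB ltry.
move=> x /andP[ax xb]; rewrite Rintegral_cst//= lebesgue_measure_itv/= lte_fin.
case: ltP => [|xa]; first by rewrite /= mul1r => _; ring.
by rewrite mulr0 addr0; congr (_ + _); apply/eqP; rewrite eq_le xa.
Qed.

Lemma AC_add a b P p Q q : AC a b P p -> AC a b Q q ->
  AC a b (fun x => P x + Q x) (fun x => p x + q x).
Proof.
move=> [pi PE] [qi QE]; split; first exact: rintegrableD.
move=> x axb; have /andP[ax xb] := axb.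
rewrite PE// QE// RintegralD//; [|exact: rintegrable_sub pi|exact: rintegrable_sub qi].
ring.
Qed.

(** Expand both factors around their values at [a]; the product of the two increments is given by
    [fubini_triangle] on []a, x[]. *)
Lemma AC_mul a b P p Q q : AC a b P p -> AC a b Q q ->
  AC a b (fun x => P x * Q x) (fun x => p x * Q x + P x * q x).
Proof.
move=> acP acQ; have [pi PE] := acP; have [qi QE] := acQ.
have mP := AC_measurable acP; have mQ := AC_measurable acQ.
have inab x : `]a, b[%classic x -> a <= x <= b.
  by rewrite /= in_itv/= => /andP[/ltW -> /ltW ->].
split.
  apply: rintegrableD => //.
    have : rintegrable mu `]a, b[ (fun x => Q x * p x).
      apply: (rintegrable_bounded _ mQ (fun x xi => AC_bound acQ (inab x xi)) pi) => //.
    by apply: (eq_rintegrable (mIoo a b)) => x _; rewrite mulrC.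
  by apply: (rintegrable_bounded _ mP (fun x xi => AC_bound acP (inab x xi)) qi).
move=> x axb; have /andP[ax xb] := axb.
have pxi := rintegrable_sub (lexx a) xb pi; have qxi := rintegrable_sub (lexx a) xb qi.
have [h1 h2 h3] := fubini_triangle pxi qxi.
rewrite PE// QE//.
transitivity (P a * Q a + (Q a * \int[mu]_(t in `]a, x[) p t + (P a * \int[mu]_(t in `]a, x[) q t
   + (\int[mu]_(t in `]a, x[) p t) * (\int[mu]_(t in `]a, x[) q t)))); first by ring.
congr (_ + _); rewrite h3 -!RintegralZl// -!RintegralD//; try by repeat apply: rintegrableD => //; apply: rintegrableZ.
  apply: eq_Rintegral => y; rewrite inE /= in_itv/= => /andP[ay yx].
  have ayb : a <= y <= b by rewrite ltW//= (le_trans (ltW yx)).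
  by rewrite (PE y)// (QE y)//; ring.
all: try exact: rintegrableZ.
all: try (by apply: rintegrableD => //; apply: rintegrableZ).
Qed.

Lemma AC_scale a b k P p : AC a b P p -> AC a b (fun x => k * P x) (fun x => k * p x).
Proof.
move=> [pi PE]; split; first exact: rintegrableZ.
move=> x axb; have /andP[ax xb] := axb.
by rewrite PE// mulrDr RintegralZl//; exact: rintegrable_sub pi.
Qed.

Lemma AC_eq a b P p q : (forall x, a < x < b -> p x = q x) -> AC a b P p -> AC a b P q.
Proof.
move=> pq [pi PE]; split.
  by apply: eq_rintegrable pi => // x; rewrite /= in_itv/=; exact: pq.
move=> x axb; have /andP[ax xb] := axb; rewrite PE//; congr (_ + _).
apply: eq_Rintegral => y; rewrite inE /= in_itv/= => /andP[ay yx].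
by apply: pq; rewrite ay (lt_le_trans yx).
Qed.

Lemma AC_ae a b P p q : measurable_fun (`]a, b[%classic : set Rm) q ->
  {ae mu, forall x, `]a, b[%classic x -> p x = q x} -> AC a b P p -> AC a b P q.
Proof.
move=> mq pq [pi PE]; split.
  exact: ae_eq_rintegrable pi.
move=> x axb; have /andP[ax xb] := axb; rewrite PE//; congr (_ + _).
have ss : `]a, x[%classic `<=` `]a, b[%classic.
  by move=> y; rewrite /= !in_itv/= => /andP[-> yx]; rewrite (lt_le_trans yx).
apply: ae_eq_Rintegral => //.
- by apply: rintegrable_measurable; exact: rintegrable_sub pi.
- exact: measurable_funS mq.
- by apply: ae_imp pq => y + yi; apply; exact: ss.
Qed.

Lemma AC_left a b p : rintegrable mu `]a, b[ p ->
  AC a b (fun x => \int[mu]_(t in `]a, x[) p t) p.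
Proof.
move=> pi; split => // x _.
by rewrite set_itvoo_eq0 Rintegral_set0 add0r.
Qed.

Lemma AC_right a b p : rintegrable mu `]a, b[ p ->
  AC a b (fun x => - \int[mu]_(t in `]x, b[) p t) p.
Proof.
move=> pi; split => // x axb.
by rewrite (Rintegral_oo_split axb pi) opprD addrAC addNr add0r.
Qed.

(** The function $xP$ has the integrable density $xp+P$, and $xp$ is integrable because $x$ is
    bounded on the interval. *)
Lemma AC_rintegrable a b P p : AC a b P p -> rintegrable mu `]a, b[ P.
Proof.
move=> acP; have [h _] := AC_mul acP (AC_affine a b 0).
have [pi _] := acP.
have : rintegrable mu `]a, b[ (fun x => (p x * (0 + x) + P x * 1) - x * p x).
  apply: rintegrableB => //.
  apply: (@rintegrable_bounded _ _ _ _ _ _ _ _ (Num.max `|a| `|b|)) => //.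
  move=> x; rewrite /= in_itv/= => /andP[ax xb].
  rewrite le_max; have [x0|x0] := leP 0 x.
    by rewrite [`|x|]ger0_norm// [`|b|]ger0_norm ?(ltW xb) ?orbT// (le_trans x0)// ltW.
  by rewrite [`|x|]ltr0_norm// [`|a|]ltr0_norm ?(lt_trans ax)// lerN2 ltW.
by apply: (eq_rintegrable (mIoo a b)) => x _; ring.
Qed.

End AC.

(** * Weak derivatives on an interval *)

Section reals_1d.
Context (R : realType).
Notation mu := (@lebesgue_measure R).
Notation Rm := (measurableTypeR R).
Implicit Types (f g h P F : R -> R) (a b c x : R).

Let mIoo a b : measurable (`]a, b[%classic : set Rm).
Proof. exact: measurable_itv. Qed.

Lemma measure_itvoo_lty a b : (mu `]a, b[%classic < +oo)%E.
Proof. by rewrite /= lebesgue_measure_itv/=; case: ifP => _; rewrite -?EFinB ltry. Qed.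

Lemma ae_exists_itv a b (P : R -> Prop) : a < b ->
  {ae mu, forall x, `]a, b[%classic x -> P x} -> exists2 x, `]a, b[%classic x & P x.
Proof.
move=> ab [N [mN N0 PN]]; apply: contrapT => nP.
have abN : `]a, b[%classic `<=` N.
  by move=> x xab; apply: PN => /= /(_ xab) Px; apply: nP; exists x.
have : (mu `]a, b[%classic <= mu N)%E by apply: le_measure => //; rewrite inE.
by rewrite [X in (_ <= X)%E]N0 /= lebesgue_measure_itv/= lte_fin ab -EFinB lee_fin subr_le0 leNgt ab.
Qed.

(** The primitive vanishes at the rational points of the interval. At almost every [x] it is
    differentiable with derivative [g x], and both its value and its derivative there are limits
    along rational points, hence zero. *)
Lemma rational_zero_integrals a b g : rintegrable mu `]a, b[ g ->
  (forall r : rat, a < ratr r < b -> \int[mu]_(x in `]a, ratr r[) g x = 0) ->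
  {ae mu, forall x, `]a, b[%classic x -> g x = 0}.
Proof.
move=> gi g0; pose f := g \_ `]a, b[.
have fi : rintegrable mu setT f.
  by have := (@integrable_mkcond _ _ _ mu _ (EFin \o g) (mIoo a b)).1 gi; rewrite restrict_EFin.
pose F y := \int[mu]_(t in `]-oo, y]) f t.
have FE y : a < y < b -> F y = \int[mu]_(x in `]a, y[) g x.
  move=> /andP[ay yb].
  rewrite /F -Rintegral_mkcondr.
  rewrite (_ : _ `&` _ = `]a, y]%classic); last first.
    apply/seteqP; split => x /=; rewrite !in_itv/=; first by move=> [-> /andP[-> _]].
    by move=> /andP[-> xy]; rewrite xy (le_lt_trans xy).
  by rewrite Rintegral_itv_bndo_bndc//; apply: rintegrable_sub gi => //; exact: ltW.
have F0 (r : rat) : a < ratr r < b -> F (ratr r) = 0 by move=> h; rewrite FE// g0.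
have lf : locally_integrable setT f by apply: open_integrable_locally => //; exact: openT.
have fiy y : rintegrable mu `]-oo, y] f by apply: integrableS fi.
have := FTC1Ny fiy lf.
apply: ae_imp => x [dF F'x]; rewrite /= in_itv/= => axb; have /andP[ax xb] := axb.
have fx : f x = g x by rewrite /f patchE mem_set//= in_itv.
rewrite -fx -F'x derive1E.
have Fx0 : F x = 0.
  have cF : {for x, continuous F} by apply/differentiable_continuous/derivable1_diffP.
  apply: contrapT => /eqP Fn0.
  have /cF : nbhs (F x) [set y | y != 0] by apply: open_nbhs_nbhs; split => //; exact: open_neq0.
  move=> [e /= e0 He].
  have : Num.max a (x - e) < Num.min b (x + e).
    rewrite lt_min !gt_max; have : a < b by exact: lt_trans ax xb.
    by move=> ab; apply/andP; split; apply/andP; split; lra.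
  move=> /rat_in_itvoo[r]; rewrite in_itv/= gt_max lt_min => /andP[/andP[ar xr] /andP[rb re]].
  have := He (ratr r); rewrite /= F0 ?ar// eqxx => H.
  suff : false by []; apply: H; rewrite ltr_norml; lra.
apply: contrapT => /eqP dn0.
have := dF; rewrite /derivable => /cvg_ex [l Hl].
have El : 'D_1 F x = l by exact/cvg_lim.
rewrite El in dn0.
have /Hl [e /= e0 He] : nbhs l [set y | y != 0] by apply: open_nbhs_nbhs; split => //; exact: open_neq0.
have : x < Num.min b (x + e) by rewrite lt_min xb ltrDl.
move=> /rat_in_itvoo[r]; rewrite in_itv/= lt_min => /andP[xr /andP[rb re]].
have := He (ratr r - x); rewrite /= sub0r normrN => H.
have : `|ratr r - x| < e by rewrite gtr0_norm ?subr_gt0//; lra.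
move=> /H /(_ _); rewrite subr_eq0 gt_eqF// => /(_ isT).
have -> : (ratr r - x)%:A + x = ratr r :> R by rewrite [_%:A]mulr1 subrK.
have Fr : F (ratr r) = 0 by apply: F0; rewrite rb (lt_trans ax xr).
by rewrite -/(F (ratr r)) -/(F x) Fr Fx0 subrr scaler0 eqxx.
Qed.

Lemma bump_integral_cvg p q g : rintegrable mu `]p, q[ g ->
  \int[mu]_(x in `]p, q[) (bump p q n x * g x) @[n --> \oo] -->
  \int[mu]_(x in `]p, q[) g x.
Proof.
move=> gi.
have mb n : measurable_fun (`]p, q[%classic : set Rm) (bump p q n).
  by apply: measurable_funTS; exact: continuous_measurable_fun (smooth_continuous (smooth_bump p q n)).
have bgi n : rintegrable mu `]p, q[ (fun x => bump p q n x * g x).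
  apply: (rintegrable_bounded (mIoo p q) (mb n) _ gi (M := 1)) => x _.
  by rewrite ger0_norm ?bump_ge0// bump_le1.
have cvg_ae : {ae mu, forall x, `]p, q[%classic x ->
    (bump p q n x * g x)%:E @[n --> \oo] --> (g x)%:E}.
  apply: aeW => x; rewrite /= in_itv/= => /andP[px xq].
  apply: cvg_EFin; first by apply: nearW.
  rewrite -[X in _ --> X]mul1r; apply: cvgM; last exact: cvg_cst.
  exact: bump_cvg.
have dom : {ae mu, forall x n, `]p, q[%classic x ->
    (`|(bump p q n x * g x)%:E| <= `|g x|%:E)%E}.
  apply: aeW => x n _ /=; rewrite lee_fin normrM ger0_norm ?bump_ge0//.
  by rewrite ler_piMl// bump_le1.
have [_ _ H] := @dominated_convergence _ _ _ mu _ (mIoo p q)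
   (fun n => EFin \o (fun x => bump p q n x * g x)) (EFin \o g) (EFin \o (fun x => `|g x|))
   (fun n => measurable_int _ (bgi n)) (measurable_int _ gi) cvg_ae (rintegrable_norm gi) dom.
by apply: fine_cvg; rewrite fineK; last exact: (integrable_fin_num (mIoo p q) gi).
Qed.

Lemma bump_Rintegral a b p q n g : a <= p -> q <= b ->
  \int[mu]_(x in `]a, b[) (bump p q n x * g x) =
  \int[mu]_(x in `]p, q[) (bump p q n x * g x).
Proof.
move=> ap qb; rewrite Rintegral_mkcond [RHS]Rintegral_mkcond; congr Rintegral.
apply/funext => x; rewrite !patchE.
case: ifPn => [|/negP]; rewrite inE /= in_itv/= => xab.
  case: ifPn => [//|/negP]; rewrite inE /= in_itv/= => xpq.
  by rewrite bump_eq0 ?mul0r//; apply/negP.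
case: ifPn => [|//]; rewrite inE /= in_itv/= => /andP[px xq].
by exfalso; apply: xab; rewrite (le_lt_trans ap)//= (lt_le_trans xq).
Qed.

(** The bumps tend to the indicator of []p, q[], so that [g] has integral zero over every inner
    rational interval. Only countably many bumps are tested, and only integrability on inner
    intervals enters. *)
Lemma fundamental_lemma a b g :
  (forall p q : rat, a < ratr p -> ratr q < b -> rintegrable mu `]ratr p, ratr q[ g) ->
  (forall (p q : rat) n, a < ratr p -> ratr q < b ->
     \int[mu]_(x in `]a, b[) (bump (ratr p) (ratr q) n x * g x) = 0) ->
  {ae mu, forall x, `]a, b[%classic x -> g x = 0}.
Proof.
move=> gi gb0.
have g0 (p q : rat) : a < ratr p -> ratr q < b -> \int[mu]_(x in `]ratr p, ratr q[) g x = 0.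
  move=> ap qb; have := bump_integral_cvg (gi _ _ ap qb).
  rewrite (_ : (fun n => _) = cst 0); first by move/(cvg_lim (@Rhausdorff R)) => <-; rewrite lim_cst.
  by apply/funext => n /=; rewrite -(@bump_Rintegral a b) ?ltW// gb0.
have : {ae mu, forall x, forall pq : rat * rat,
    a < ratr pq.1 -> ratr pq.2 < b -> `]ratr pq.1, ratr pq.2[%classic x -> g x = 0}.
  apply: ae_forall_count => -[p q] /=.
  have [ap|nap] := boolP (a < ratr p :> R); last by apply: aeW.
  have [qb|nqb] := boolP (ratr q < b :> R); last by apply: aeW.
  have H : {ae mu, forall x, `]ratr p, ratr q[%classic x -> g x = 0}.
    apply: rational_zero_integrals; first exact: gi.
    by move=> r /andP[pr rq]; apply: g0 => //; exact: lt_trans rq qb.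
  by apply: ae_imp H => x h _ _.
apply: ae_imp => x H; rewrite /= in_itv/= => /andP[ax xb].
have /rat_in_itvoo[p] := ax; rewrite in_itv/= => /andP[ap px].
have /rat_in_itvoo[q] := xb; rewrite in_itv/= => /andP[xq qb].
by apply: (H (p, q)) => //=; rewrite in_itv/= px.
Qed.

Lemma AC_smooth a b F : a <= b -> smooth F -> AC a b F ('D_1 F).
Proof.
move=> ab sF.
have dF x : derivable F x 1 by exact: smooth_derivable.
have cF := smooth_continuous sF.
have cdF := smooth_continuous (smooth_derive (1 : R) sF).
have Ii c d : rintegrable mu `]c, d[ ('D_1 F).
  apply: (@integrableS _ _ _ mu `[c, d] `]c, d[) => //; first exact: subset_itv_oo_cc.
  apply: continuous_compact_integrable; first exact: segment_compact.
  exact: continuous_subspaceT.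
split; first exact: Ii.
move=> x /andP[ax xb]; have [->|axn] := eqVneq x a.
  by rewrite set_itvoo_eq0 Rintegral_set0 addr0.
have ax' : a < x by rewrite lt_neqAle eq_sym axn.
have : (\int[mu]_(y in `[a, x]) ('D_1 F y)%:E = (F x)%:E - (F a)%:E)%E.
  apply: continuous_FTC2 => //.
  - exact: continuous_subspaceT.
  - split; first by move=> y _.
    + by apply: cvg_at_right_filter; exact: cF.
    + by apply: cvg_at_left_filter; exact: cF.
  - by move=> y _; rewrite derive1E.
rewrite -integral_itv_bndo_bndc; last first.
  by apply/measurable_EFinP; apply: measurable_funTS; exact: continuous_measurable_fun.
rewrite -integral_itv_obnd_cbnd; last first.
  by apply/measurable_EFinP; apply: measurable_funTS; exact: continuous_measurable_fun.
by rewrite (EFin_Rintegral (mIoo a x) (Ii a x)) -EFinB => -[->]; rewrite addrC subrK.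
Qed.

Lemma test_itv_bnd a b F : test_itv a b F -> F a = 0 /\ F b = 0.
Proof.
move=> [_ [p [q [ap qb F0]]]]; split; apply: F0.
  by rewrite negb_and -ltNge ap.
by rewrite negb_and -!ltNge qb orbT.
Qed.

Lemma test_itv_rintegrable a b F g : test_itv a b F -> rintegrable mu `]a, b[ g ->
  rintegrable mu `]a, b[ (fun x => F x * g x).
Proof.
move=> tF gi; have [M FM] := test_itv_bounded tF.
by apply: (rintegrable_bounded (mIoo a b) _ _ gi) => //; apply: measurable_funTS; exact: test_itv_measurable tF.
Qed.

(* The mean over ]a, b[ is zero, so this is the derivative of a test function. *)
Definition balanced_bump a b (p0 q0 p q : R) n x : R :=
  bump p q n x + - ((\int[mu]_(t in `]a, b[) bump p q n t) /
    (\int[mu]_(t in `]a, b[) bump p0 q0 0 t)) * bump p0 q0 0 x.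

Lemma bump_Rintegral_gt0 a b p q n : a < p -> p < q -> q < b ->
  0 < \int[mu]_(t in `]a, b[) bump p q n t.
Proof.
move=> ap pq qb; have tb := test_itv_bump n ap qb.
have bi : rintegrable mu `]a, b[ (bump p q n).
  have := test_itv_rintegrable tb (AC_affine a b 0).1.
  by apply: (eq_rintegrable (mIoo a b)) => x _; rewrite /= mulr1.
rewrite lt_def Rintegral_ge0 ?andbT; last by move=> x _; exact: bump_ge0.
apply/negP => /eqP b0.
have : {ae mu, forall x, `]a, b[%classic x -> bump p q n x = 0}.
  apply: ae_eq0_of_Rintegral_norm => //.
  by rewrite -b0; under eq_Rintegral do rewrite ger0_norm ?bump_ge0//.
have ss x : `]p, q[%classic x -> `]a, b[%classic x.
  by rewrite /= !in_itv/= => /andP[px xq]; rewrite (lt_trans ap)//= (lt_trans xq).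
move=> h; have /(ae_exists_itv pq)[x] : {ae mu, forall x, `]p, q[%classic x -> bump p q n x = 0}.
  by apply: ae_imp h => x h xpq; apply: h; exact: ss.
by rewrite /= in_itv/= => /andP[px xq]; apply/eqP; rewrite gt_eqF// bump_gt0.
Qed.

Lemma balanced_bump_primitive a b p0 q0 p q n :
  a < p0 -> p0 < q0 -> q0 < b -> a < p -> q < b ->
  exists2 F, test_itv a b F & 'D_1 F = balanced_bump a b p0 q0 p q n.
Proof.
move=> ap0 pq0 qb0 ap qb; apply: test_itv_primitive.
  by apply: test_itvB; exact: test_itv_bump.
have bi p' q' n' : a < p' -> q' < b -> rintegrable mu `]a, b[ (bump p' q' n').
  move=> ap' qb'; have := test_itv_rintegrable (test_itv_bump n' ap' qb') (AC_affine a b 0).1.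
  by apply: (eq_rintegrable (mIoo a b)) => x _; rewrite /= mulr1.
rewrite RintegralD//; [|exact: bi|by apply: rintegrableZ => //; exact: bi].
rewrite RintegralZl//; last exact: bi.
by rewrite mulNr divfK ?subrr// gt_eqF// bump_Rintegral_gt0.
Qed.

(** Let $k$ be $g$ minus the primitive of $h$. Integration by parts gives $\int F'k=0$, where $F'$
    is a bump corrected by a multiple of the fixed bump [b0]. If $C$ is the mean of $k$ with weight
    [b0], all bumps annihilate $k-C$, and the fundamental lemma applies. *)
Lemma du_bois_reymond a b p0 q0 g h :
  a < p0 -> p0 < q0 -> q0 < b ->
  rintegrable mu `]a, b[ g -> rintegrable mu `]a, b[ h ->
  (forall (p q : rat) n, a < ratr p -> ratr q < b -> exists F, [/\ test_itv a b F,
     'D_1 F = balanced_bump a b p0 q0 (ratr p) (ratr q) n &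
     \int[mu]_(x in `]a, b[) ('D_1 F x * g x + F x * h x) = 0]) ->
  exists c, {ae mu, forall x, `]a, b[%classic x -> g x = c + \int[mu]_(t in `]a, x[) h t}.
Proof.
move=> ap0 pq0 qb0 gi hi H.
have ab : a <= b by rewrite ltW// (lt_trans ap0)// (lt_trans pq0).
have acH := AC_left hi.
set Hf := (fun x => _) in acH.
have Hi := AC_rintegrable acH.
pose k x := g x - Hf x.
have ki : rintegrable mu `]a, b[ k by exact: rintegrableB.
pose b0 := bump p0 q0 0.
pose C := (\int[mu]_(x in `]a, b[) (b0 x * k x)) / \int[mu]_(x in `]a, b[) b0 x.
have tb0 : test_itv a b b0 by exact: test_itv_bump.
exists C.
have bi p' q' n' : a < p' -> q' < b -> rintegrable mu `]a, b[ (bump p' q' n').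
  move=> ap' qb'; have := test_itv_rintegrable (test_itv_bump n' ap' qb') (AC_affine a b 0).1.
  by apply: (eq_rintegrable (mIoo a b)) => x _; rewrite /= mulr1.
have kCi : rintegrable mu `]a, b[ (fun x => k x - C).
  by apply: rintegrableB => //; exact: AC_rintegrable (AC_cst a b C).
have : {ae mu, forall x, `]a, b[%classic x -> k x - C = 0}.
  apply: fundamental_lemma => p q.
    by move=> ap qb; apply: rintegrable_sub kCi; exact: ltW.
  move=> n ap qb; have [F [tF DF F0]] := H p q n ap qb.
  have dFt := test_itv_derive tF.
  have [Fa Fb] := test_itv_bnd tF.
  have acF := AC_smooth ab (test_itv_smooth tF).
  have IH : \int[mu]_(x in `]a, b[) ('D_1 F x * Hf x + F x * h x) = 0.
    by rewrite (AC_Rintegral ab (AC_mul acF acH)) Fa Fb !mul0r subrr.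
  have i1 := test_itv_rintegrable dFt gi; have i2 := test_itv_rintegrable tF hi.
  have i3 := test_itv_rintegrable dFt Hi.
  have Ik : \int[mu]_(x in `]a, b[) ('D_1 F x * k x) = 0.
    transitivity (\int[mu]_(x in `]a, b[) (('D_1 F x * g x + F x * h x) - ('D_1 F x * Hf x + F x * h x))).
      by apply: eq_Rintegral => x _; rewrite /k; ring.
    by rewrite RintegralB ?F0 ?IH ?subrr//; exact: rintegrableD.
  have tb := test_itv_bump n ap qb.
  have i4 := test_itv_rintegrable tb ki; have i5 := test_itv_rintegrable tb0 ki.
  pose kappa := (\int[mu]_(t in `]a, b[) bump (ratr p) (ratr q) n t) / \int[mu]_(t in `]a, b[) b0 t.
  have E : \int[mu]_(x in `]a, b[) (bump (ratr p) (ratr q) n x * k x + - kappa * (b0 x * k x)) = 0.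
    rewrite -[RHS]Ik; apply: eq_Rintegral => x _.
    have -> : 'D_1 F x = balanced_bump a b p0 q0 (ratr p) (ratr q) n x by rewrite -DF.
    by rewrite /balanced_bump -/kappa -/b0; ring.
  rewrite RintegralD// in E; last exact: rintegrableZ.
  rewrite RintegralZl// in E.
  have -> : \int[mu]_(x in `]a, b[) (bump (ratr p) (ratr q) n x * (k x - C)) =
    \int[mu]_(x in `]a, b[) (bump (ratr p) (ratr q) n x * k x) -
    C * \int[mu]_(x in `]a, b[) (bump (ratr p) (ratr q) n x).
    rewrite -RintegralZl//; last exact: bi.
    rewrite -RintegralB//; last by apply: rintegrableZ => //; exact: bi.
    by apply: eq_Rintegral => x _; ring.
  by rewrite -[RHS]E /C /kappa /b0; ring.
by apply: ae_imp => x /[apply] /eqP; rewrite subr_eq0 /k subr_eq => /eqP.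
Qed.

End reals_1d.

(** The family is chosen before [g] and [h]. This order of quantifiers is what permits one null set
    of lines for all test functions. *)
Lemma countable_test_functions (R : realType) (a b : R) : a < b ->
  exists F : rat * rat * nat -> R -> R, (forall i, test_itv a b (F i)) /\
  forall g h, rintegrable (@lebesgue_measure R) `]a, b[ g -> rintegrable (@lebesgue_measure R) `]a, b[ h ->
    (forall i, \int[@lebesgue_measure R]_(x in `]a, b[) ('D_(1 : R) (F i) x * g x + F i x * h x) = 0) ->
    exists c, {ae @lebesgue_measure R, forall x, `]a, b[%classic x ->
      g x = c + \int[@lebesgue_measure R]_(t in `]a, x[) h t}.
Proof.
move=> ab.
pose p0 := a + (b - a) / 3; pose q0 := a + (b - a) * 2 / 3.
have ap0 : a < p0 by rewrite /p0; lra.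
have pq0 : p0 < q0 by rewrite /p0 /q0; lra.
have qb0 : q0 < b by rewrite /q0; lra.
(* The zero function is the default at indices whose end points do not lie inside []a, b[]. *)
have t0 : test_itv a b (cst 0 : R -> R).
  by split; [exact: smooth_cst|exists p0, q0].
have Ex (i : rat * rat * nat) : exists F, test_itv a b F /\ (a < ratr i.1.1 -> ratr i.1.2 < b ->
    'D_(1 : R) F = balanced_bump a b p0 q0 (ratr i.1.1) (ratr i.1.2) i.2).
  have [ap|nap] := boolP (a < ratr i.1.1 :> R); last by exists (cst 0).
  have [qb|nqb] := boolP (ratr i.1.2 < b :> R); last by exists (cst 0).
  by have [F tF DF] := balanced_bump_primitive i.2 ap0 pq0 qb0 ap qb; exists F.
exists (fun i => sval (cid (Ex i))); split; first by move=> i; have [] := svalP (cid (Ex i)).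
move=> g h gi hi H; apply: (du_bois_reymond ap0 pq0 qb0 gi hi) => p q n ap qb.
have [tF DF] := svalP (cid (Ex (p, q, n))).
by exists (sval (cid (Ex (p, q, n)))); split => //; exact: DF.
Qed.

(** * Identities on a line *)

Section slices.
Context (R : realType).
Notation mu := (@lebesgue_measure R).
Notation Rm := (measurableTypeR R).
Implicit Types (f g h p q P Q V : R -> R) (a b c x L : R).

Let mIoo a b : measurable (`]a, b[%classic : set Rm).
Proof. exact: measurable_itv. Qed.

(* The right side exceeds the left one by [P 0 ^+ 2], the boundary term of
   2/3 w V^3 + w V^2 + 2 w V Q - 2 V P - w P^2, where [w = 1 + x]. *)
Lemma energy_slice L V P Q r : 0 <= L -> AC 0 L V P -> AC 0 L P Q -> AC 0 L Q r ->
  V 0 = 0 -> V L = 0 -> P L = 0 ->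
  \int[mu]_(x in `]0, L[) (3 * P x ^+ 2 - V x ^+ 2 - 2 / 3 * V x ^+ 3) <=
  \int[mu]_(x in `]0, L[) (2 * (1 + x) * V x * (1 + V x) * P x + 2 * (1 + x) * V x * r x).
Proof.
move=> L0 acV acP acQ V0 VL PL.
have acw := AC_affine 0 L 1.
have acVV := AC_mul acV acV.
have acE := AC_add (AC_scale (2 / 3) (AC_mul acw (AC_mul acV acVV)))
  (AC_add (AC_mul acw acVV) (AC_add (AC_scale 2 (AC_mul acw (AC_mul acV acQ)))
  (AC_add (AC_scale (- 2) (AC_mul acV acP)) (AC_scale (- 1) (AC_mul acw (AC_mul acP acP)))))).
have acG := AC_add (AC_scale 3 (AC_mul acP acP)) (AC_add (AC_scale (- 1) acVV)
  (AC_scale (- (2 / 3)) (AC_mul acV acVV))).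
have ei := acE.1; have gi := AC_rintegrable acG.
have IE := AC_Rintegral L0 acE.
rewrite /= V0 VL PL in IE.
rewrite -subr_ge0.
have -> : \int[mu]_(x in `]0, L[) (3 * P x ^+ 2 - V x ^+ 2 - 2 / 3 * V x ^+ 3) =
  \int[mu]_(x in `]0, L[) (3 * (P x * P x) + ((- 1) * (V x * V x) + (- (2 / 3)) * (V x * (V x * V x)))).
  by apply: eq_Rintegral => x _; ring.
have -> : \int[mu]_(x in `]0, L[) (2 * (1 + x) * V x * (1 + V x) * P x + 2 * (1 + x) * V x * r x) =
  \int[mu]_(x in `]0, L[) (3 * (P x * P x) + ((- 1) * (V x * V x) + (- (2 / 3)) * (V x * (V x * V x)))) + P 0 ^+ 2.
  have -> : P 0 ^+ 2 = (1 + L) * 0 - - (P 0 ^+ 2) by ring.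
  have := IE; rewrite [X in _ = X](_ : _ = (1 + L) * 0 - - (P 0 ^+ 2)); last by ring.
  move=> <-; rewrite -(RintegralD (mIoo 0 L) gi ei).
  by apply: eq_Rintegral => x _ /=; field.
by rewrite addrC addKr sqr_ge0.
Qed.

(** The integrand is the derivative of $(1+x)P^2$, of which only $-P(0)^2$ survives. With $P=v_y$
    this is where $v_y=0$ on $x=L$ enters. *)
Lemma weighted_square_slice L P q : 0 <= L -> AC 0 L P q -> P L = 0 ->
  \int[mu]_(x in `]0, L[) (P x ^+ 2 + 2 * (1 + x) * P x * q x) <= 0.
Proof.
move=> L0 acP PL; have acE := AC_mul (AC_affine 0 L 1) (AC_mul acP acP).
have IE := AC_Rintegral L0 acE; rewrite PL in IE.
have -> : \int[mu]_(x in `]0, L[) (P x ^+ 2 + 2 * (1 + x) * P x * q x) = - (P 0 ^+ 2).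
  rewrite [RHS](_ : _ = (1 + L) * (0 * 0) - (1 + 0) * (P 0 * P 0)); last by ring.
  by rewrite -IE; apply: eq_Rintegral => x _ /=; ring.
by rewrite oppr_le0 sqr_ge0.
Qed.

Lemma product_slice a b V q S t : a <= b -> AC a b V q -> AC a b S t ->
  V a = 0 -> V b = 0 -> \int[mu]_(x in `]a, b[) (q x * S x + V x * t x) = 0.
Proof.
move=> ab acV acS Va Vb.
by rewrite (AC_Rintegral ab (AC_mul acV acS)) Va Vb !mul0r subrr.
Qed.

(** Integrating the derivative of $V^2$ instead of that of $V$ bounds $V^2$ uniformly on the line by
    a single integral; two such bounds in perpendicular directions yield Ladyzhenskaya's
    inequality. *)
Lemma sup_slice a b V p x : AC a b V p -> V a = 0 -> a <= x <= b ->
  V x ^+ 2 <= 2 * \int[mu]_(t in `]a, b[) `|V t * p t|.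
Proof.
move=> acV Va axb.
have ac2 := AC_mul acV acV.
have := AC_bound ac2 axb; rewrite Va mul0r normr0 add0r -expr2 ger0_norm ?sqr_ge0//.
move=> /le_trans; apply.
have i2 : rintegrable mu `]a, b[ (fun t => V t * p t).
  have := rintegrableZ (mIoo a b) 2^-1 ac2.1.
  by apply: (eq_rintegrable (mIoo a b)) => t _; field.
rewrite -RintegralZl//; last exact: rintegrable_norm.
rewrite le_eqVlt; apply/orP; left; apply/eqP; apply: eq_Rintegral => t _.
by rewrite [p t * V t]mulrC -mulr2n normrMn mulr_natl.
Qed.

Lemma cauchy_schwarz_slice a x p : a <= x -> sqintegrable mu `]a, x[ p ->
  (\int[mu]_(t in `]a, x[) p t) ^+ 2 <= (x - a) * \int[mu]_(t in `]a, x[) p t ^+ 2.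
Proof.
move=> ax pi.
have oneI : sqintegrable mu `]a, x[ (cst 1).
  apply: sqintegrable_cst; first exact: mIoo.
  by rewrite /= lebesgue_measure_itv/=; case: ifP => _; rewrite -?EFinB ltry.
have := cauchy_schwarz_Rintegral (mIoo a x) oneI pi.
under eq_Rintegral do rewrite /= mul1r.
move=> /le_trans; apply; rewrite ler_wpM2r ?Rintegral_ge0//; first by move=> t _; exact: sqr_ge0.
under eq_Rintegral do rewrite /= expr1n.
rewrite Rintegral_cst//= lebesgue_measure_itv/= lte_fin mul1r.
by case: ltP => [_|xa]; rewrite //= subr_ge0.
Qed.

Lemma sqintegrable_sub a b c d p : a <= c -> d <= b ->
  sqintegrable mu `]a, b[ p -> sqintegrable mu `]c, d[ p.
Proof.
move=> ac db [mp pi]; split; last exact: rintegrable_sub pi.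
apply: measurable_funS mp => //.
by move=> x; rewrite /= !in_itv/= => /andP[cx xd]; rewrite (le_lt_trans ac)//= (lt_le_trans xd).
Qed.

Lemma integral_affine a b k : a <= b ->
  \int[mu]_(x in `]a, b[) (k * (x - a)) = k * (b - a) ^+ 2 / 2.
Proof.
move=> ab; have ac1 := AC_affine a b (- a).
have ac2 := AC_scale (k / 2) (AC_mul ac1 ac1).
have := AC_Rintegral ab ac2; rewrite addNr mul0r mulr0 subr0 => E.
rewrite [RHS](_ : _ = k / 2 * ((- a + b) * (- a + b))); last by ring.
by rewrite -E; apply: eq_Rintegral => x _ /=; field.
Qed.

(** Cauchy-Schwarz on []a, x[] gives $V(x)^2\le(x-a)K$, and the integral of $x-a$ is $(b-a)^2/2$. *)
Lemma half_poincare_left a b V p : a <= b -> AC a b V p -> V a = 0 ->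
  sqintegrable mu `]a, b[ p ->
  \int[mu]_(x in `]a, b[) V x ^+ 2 <= (b - a) ^+ 2 / 2 * \int[mu]_(x in `]a, b[) p x ^+ 2.
Proof.
move=> ab acV Va pi; set K := \int[mu]_(x in `]a, b[) p x ^+ 2.
have acW := AC_scale K (AC_affine a b (- a)).
have -> : (b - a) ^+ 2 / 2 * K = K * (b - a) ^+ 2 / 2 by ring.
rewrite -integral_affine//; apply: le_Rintegral => //.
- have := AC_rintegrable (AC_mul acV acV).
  by apply: (eq_rintegrable (mIoo a b)) => x _; rewrite expr2.
- have := AC_rintegrable acW.
  by apply: (eq_rintegrable (mIoo a b)) => x _; rewrite /=; ring.
- move=> x; rewrite /= in_itv/= => /andP[ax xb].
  have := acV.2 x; rewrite Va add0r => -> //; last by rewrite !ltW.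
  have pxi := sqintegrable_sub (lexx a) (ltW xb) pi.
  apply: (le_trans (cauchy_schwarz_slice (ltW ax) pxi)).
  rewrite mulrC ler_wpM2r ?subr_ge0 ?(ltW ax)//.
  rewrite /K (@Rintegral_oo_split _ a b x); first last.
    by case: pi.
    by rewrite !ltW.
  by rewrite lerDl Rintegral_ge0// => t _; exact: sqr_ge0.
Qed.

Lemma half_poincare_right a b V p : a <= b -> AC a b V p -> V b = 0 ->
  sqintegrable mu `]a, b[ p ->
  \int[mu]_(x in `]a, b[) V x ^+ 2 <= (b - a) ^+ 2 / 2 * \int[mu]_(x in `]a, b[) p x ^+ 2.
Proof.
move=> ab acV Vb pi; set K := \int[mu]_(x in `]a, b[) p x ^+ 2.
have K0 : 0 <= K by apply: Rintegral_ge0 => t _; exact: sqr_ge0.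
have acW := AC_add (AC_cst a b (K * (b - a))) (AC_scale (- K) (AC_affine a b (- a))).
have WI : \int[mu]_(x in `]a, b[) (K * (b - x)) = K * (b - a) ^+ 2 / 2.
  have ac1 := AC_affine a b (- b).
  have := AC_Rintegral ab (AC_scale (- K / 2) (AC_mul ac1 ac1)).
  rewrite addNr mul0r mulr0 => E.
  rewrite [RHS](_ : _ = 0 - - K / 2 * ((- b + a) * (- b + a))); last by ring.
  by rewrite -E; apply: eq_Rintegral => x _ /=; field.
have -> : (b - a) ^+ 2 / 2 * K = K * (b - a) ^+ 2 / 2 by ring.
rewrite -WI; apply: le_Rintegral => //.
- have := AC_rintegrable (AC_mul acV acV).
  by apply: (eq_rintegrable (mIoo a b)) => x _; rewrite expr2.
- have := AC_rintegrable acW.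
  by apply: (eq_rintegrable (mIoo a b)) => x _; rewrite /=; ring.
- move=> x; rewrite /= in_itv/= => /andP[ax xb].
  have axb : a <= x <= b by rewrite !ltW.
  have -> : V x = - \int[mu]_(t in `]x, b[) p t.
    have := acV.2 b; rewrite Vb ab lexx => /(_ isT).
    rewrite (Rintegral_oo_split axb acV.1) addrA => /esym/eqP.
    by rewrite -acV.2// addr_eq0 => /eqP ->.
  rewrite sqrrN.
  have pxi := sqintegrable_sub (ltW ax) (lexx b) pi.
  apply: (le_trans (cauchy_schwarz_slice (ltW xb) pxi)).
  rewrite mulrC ler_wpM2r ?subr_ge0 ?(ltW xb)//.
  rewrite /K (@Rintegral_oo_split _ a b x)//; last by case: pi.
  by rewrite lerDr Rintegral_ge0// => t _; exact: sqr_ge0.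
Qed.

(* Each half of the interval is estimated from its own end: this gives the
   constant 8 in place of the optimal pi^2. *)
Lemma poincare_slice a b V p : a <= b -> AC a b V p -> V a = 0 -> V b = 0 ->
  sqintegrable mu `]a, b[ p ->
  8 / (b - a) ^+ 2 * \int[mu]_(x in `]a, b[) V x ^+ 2 <= \int[mu]_(x in `]a, b[) p x ^+ 2.
Proof.
move=> ab acV Va Vb pi.
have [ba|ab'] := leP b a.
  rewrite (_ : b = a); last by apply/eqP; rewrite eq_le ba.
  by rewrite set_itvoo_eq0 !Rintegral_set0 mulr0.
pose m := (a + b) / 2.
have am : a <= m by rewrite /m; lra.
have mb : m <= b by rewrite /m; lra.
have amb : a <= m <= b by rewrite am.
have acR : AC m b V p.
  split; first exact: rintegrable_sub acV.1.
  move=> x /andP[mx xb]; have axb : a <= x <= b by rewrite xb (le_trans am).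
  rewrite (acV.2 x axb) (acV.2 m amb) -addrA; congr (_ + _).
  by apply: Rintegral_oo_split; rewrite ?am//; exact: rintegrable_sub acV.1.
have h1 := half_poincare_left am (AC_sub mb acV) Va (sqintegrable_sub (lexx a) mb pi).
have h2 := half_poincare_right mb acR Vb (sqintegrable_sub am (lexx b) pi).
have V2i : rintegrable mu `]a, b[ (fun x => V x ^+ 2).
  have := AC_rintegrable (AC_mul acV acV).
  by apply: (eq_rintegrable (mIoo a b)) => x _; rewrite expr2.
rewrite (Rintegral_oo_split amb V2i) (Rintegral_oo_split amb pi.2).
have d0 : 0 < (b - a) ^+ 2 by rewrite exprn_gt0// subr_gt0.
rewrite mulrAC ler_pdivrMr//.
have e1 : (m - a) ^+ 2 / 2 = (b - a) ^+ 2 / 8 by rewrite /m; field.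
have e2 : (b - m) ^+ 2 / 2 = (b - a) ^+ 2 / 8 by rewrite /m; field.
by rewrite e1 in h1; rewrite e2 in h2; nra.
Qed.

End slices.

(** * Test functions on a rectangle *)

Section tensor_tests.
Context (R : realType).
Implicit Types (f g : R -> R) (a b c d : R).

Lemma smooth_fst f : smooth f -> smooth (fun z : R * R => f z.1).
Proof. by apply: (@smooth_comp_affine _ _ _ fst fst) => // z; exact: cvg_fst. Qed.

Lemma smooth_snd f : smooth f -> smooth (fun z : R * R => f z.2).
Proof. by apply: (@smooth_comp_affine _ _ _ snd snd) => // z; exact: cvg_snd. Qed.

Definition tensor f g (z : R * R) := f z.1 * g z.2.

Lemma smooth_tensor f g : smooth f -> smooth g -> smooth (tensor f g).
Proof. by move=> sf sg; apply: smoothM; [exact: smooth_fst|exact: smooth_snd]. Qed.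

Lemma derive_tensor1 f g : smooth f -> 'D_(1, 0) (tensor f g) = tensor ('D_1 f) g.
Proof.
move=> sf; apply/funext => -[x y].
have df : h^-1 *: ((f \o shift x) (h *: 1) - f x) @[h --> 0^'] --> 'D_1 f x.
  have df0 : derivable f x 1 by exact: smooth_derivable.
  exact: df0.
apply/cvg_lim => //.
have gc : (fun _ : R => g y) h @[h --> 0^'] --> g y by exact: cvg_cst.
have H : (h^-1 *: ((f \o shift x) (h *: 1) - f x)) * g y @[h --> 0^'] --> 'D_1 f x * g y.
  exact: cvgM.
move: H.
apply: cvg_trans; apply: near_eq_cvg; apply: nearW => h /=.
rewrite /tensor /= /GRing.scale /= mulr0 add0r; ring.
Qed.

Lemma derive_tensor2 f g : smooth g -> 'D_(0, 1) (tensor f g) = tensor f ('D_1 g).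
Proof.
move=> sg; apply/funext => -[x y].
have dg : h^-1 *: ((g \o shift y) (h *: 1) - g y) @[h --> 0^'] --> 'D_1 g y.
  have dg0 : derivable g y 1 by exact: smooth_derivable.
  exact: dg0.
apply/cvg_lim => //.
have fc : (fun _ : R => f x) h @[h --> 0^'] --> f x by exact: cvg_cst.
have H : f x * (h^-1 *: ((g \o shift y) (h *: 1) - g y)) @[h --> 0^'] --> f x * 'D_1 g y.
  exact: cvgM.
move: H.
apply: cvg_trans; apply: near_eq_cvg; apply: nearW => h /=.
rewrite /tensor /= /GRing.scale /= mulr0 add0r; ring.
Qed.

Definition derive_iter k f : R -> R := iter k (fun h : R -> R => 'D_(1 : R) h) f.

Lemma smooth_derive_iter k f : smooth f -> smooth (derive_iter k f).
Proof. by move=> sf; elim: k => [|k IH]; [exact: sf|exact: (smooth_derive (1 : R) IH)]. Qed.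

Lemma test_itv_derive_iter a b k f : test_itv a b f -> test_itv a b (derive_iter k f).
Proof. by move=> tf; elim: k => [|k IH]; [exact: tf|exact: (test_itv_derive IH)]. Qed.

Lemma dxy_tensor i j f g : smooth f -> smooth g ->
  dxy i j (tensor f g) = tensor (derive_iter i f) (derive_iter j g).
Proof.
move=> sf sg; elim: i => [|i IH].
  rewrite /dxy /=; elim: j => [//|j IH] /=.
  by rewrite IH (derive_tensor2 _ (smooth_derive_iter j sg)).
by rewrite /dxy /= -/(dxy i j (tensor f g)) IH (derive_tensor1 _ (smooth_derive_iter i sf)).
Qed.

Lemma tensor_support a b c d f g : test_itv a b f -> test_itv c d g ->
  exists K : set (R * R), [/\ compact K, measurable (K : set (measurableTypeR R * measurableTypeR R)),
    K `<=` `]a, b[%classic `*` `]c, d[%classic &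
    forall z, tensor f g z != 0 -> K z].
Proof.
move=> [_ [p [q [ap qb f0]]]] [_ [r [s [cr sd g0]]]].
exists (`[p, q]%classic `*` `[r, s]%classic); split.
- by apply: compact_setX; exact: segment_compact.
- by apply: measurableX; exact: measurable_itv.
- move=> [x y] /= []; rewrite !in_itv/= => /andP[px xq] /andP[ry ys].
  by rewrite (lt_le_trans ap)//= (le_lt_trans xq)//= (lt_le_trans cr)//= (le_lt_trans ys).
- move=> [x y]; rewrite /tensor /= => fg0; split => /=; rewrite in_itv/=; apply/negPn/negP => h.
    by move: fg0; rewrite f0// mul0r eqxx.
  by move: fg0; rewrite g0// mulr0 eqxx.
Qed.

Lemma test_function_tensor a b c d f g : test_itv a b f -> test_itv c d g ->
  test_function (`]a, b[%classic `*` `]c, d[%classic) (tensor f g).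
Proof.
move=> tf tg; have [K [cK _ KD fK]] := tensor_support tf tg.
have clK : closed K by apply: compact_closed => //; exact: Rhausdorff_pair.
have sK : closure [set x | tensor f g x != 0] `<=` K.
  by have := closure_subset (fun z (h : tensor f g z != 0) => fK z h); rewrite -(closure_id K).1.
split.
- exact: smooth_tensor (test_itv_smooth tf) (test_itv_smooth tg).
- by apply: (subclosed_compact _ cK sK); exact: closed_closure.
- exact: subset_trans KD.
Qed.

Lemma test_function_itv a b f : test_itv a b f -> test_function `]a, b[ f.
Proof.
move=> [sf [p [q [ap qb f0]]]].
have sK : closure [set x | f x != 0] `<=` `[p, q].
  have /closure_id -> : closed (`[p, q]%classic : set R) by exact: itv_closed.
  apply: closure_subset => x /= fx; rewrite in_itv/=; apply/negPn/negP => h.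
  by move: fx; rewrite f0// eqxx.
split => //.
- by apply: (subclosed_compact _ (@segment_compact _ p q) sK); exact: closed_closure.
- move=> x /sK; rewrite /= !in_itv/= => /andP[px xq].
  by rewrite (lt_le_trans ap)//= (le_lt_trans xq).
Qed.

End tensor_tests.

(** * Weak derivatives tested against products *)

Section weak_tensor.
Context (R : realType).
Notation mu := (@lebesgue_measure R).
Notation mm := (mu \x mu)%E.
Notation Rm := (measurableTypeR R).
Variables (a b c d : R).
Notation X := (`]a, b[%classic : set Rm).
Notation Y := (`]c, d[%classic : set Rm).
Implicit Types (u v k : R * R -> R) (f g : R -> R).

Let mXY : measurable (X `*` Y). Proof. exact: measurableX. Qed.

Lemma measurable_tensor (A : set (Rm * Rm)) f g :
  test_itv a b f -> test_itv c d g -> measurable_fun A (tensor f g).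
Proof.
move=> tf tg; apply: measurable_funTS; apply: measurable_funM.
  exact: (measurableT_comp (test_itv_measurable tf) measurable_fst).
exact: (measurableT_comp (test_itv_measurable tg) measurable_snd).
Qed.

Lemma bounded_tensor f g :
  test_itv a b f -> test_itv c d g -> exists M, forall z, `|tensor f g z| <= M.
Proof.
move=> tf tg; have [M fM] := test_itv_bounded tf; have [N gN] := test_itv_bounded tg.
by exists (M * N) => z; rewrite normrM ler_pM.
Qed.

Lemma rintegrable_loc_tensor u f g : loc_integrable (X `*` Y) u ->
  test_itv a b f -> test_itv c d g ->
  rintegrable mm (X `*` Y) (fun z => tensor f g z * u z).
Proof.
move=> lu tf tg; have [K [cK mK KD fK]] := tensor_support tf tg.
have uK : rintegrable mm K u by exact: lu.
have [M fM] := bounded_tensor tf tg.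
have hK : rintegrable mm K (fun z => tensor f g z * u z).
  by apply: (rintegrable_bounded mK _ _ uK (M := M)) => //; exact: measurable_tensor.
have := (@integrable_mkcond _ _ _ mm _ (EFin \o (fun z => tensor f g z * u z)) mK).1 hK.
rewrite restrict_EFin => /(@integrableS _ _ _ mm setT (X `*` Y) _ measurableT mXY (@subsetT _ _)).
apply: (eq_rintegrable mXY) => z _; rewrite patchE; case: ifPn => // /negP zK.
have [->|/fK zK'] := eqVneq (tensor f g z) 0; first by rewrite mul0r.
by exfalso; apply: zK; rewrite inE.
Qed.

Lemma weak_tensor i j u v f g : weak_dxy (X `*` Y) i j u v ->
  test_itv a b f -> test_itv c d g ->
  \int[mm]_(z in X `*` Y) (tensor (derive_iter i f) (derive_iter j g) z * u z) =
  (-1) ^+ (i + j) * \int[mm]_(z in X `*` Y) (tensor f g z * v z).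
Proof.
move=> [lu lv H] tf tg.
have := H _ (test_function_tensor tf tg).
rewrite dxy_tensor; [|exact: test_itv_smooth tf|exact: test_itv_smooth tg].
have i1 := rintegrable_loc_tensor lu (test_itv_derive_iter i tf) (test_itv_derive_iter j tg).
have i2 := rintegrable_loc_tensor lv tf tg.
move=> E; rewrite -RintegralZl//.
have -> : \int[mm]_(z in X `*` Y) (tensor (derive_iter i f) (derive_iter j g) z * u z) =
  \int[mm]_(z in X `*` Y) (u z * tensor (derive_iter i f) (derive_iter j g) z).
  by apply: eq_Rintegral => z _; rewrite mulrC.
have -> : \int[mm]_(z in X `*` Y) ((-1) ^+ (i + j) * (tensor f g z * v z)) =
  \int[mm]_(z in X `*` Y) ((-1) ^+ (i + j) * (v z * tensor f g z)).
  by apply: eq_Rintegral => z _; rewrite [tensor _ _ _ * _]mulrC.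
by rewrite /Rintegral; congr fine; exact: E.
Qed.

Lemma loc_integrable_oo k p q r s : loc_integrable (X `*` Y) k ->
  a < p -> q < b -> c < r -> s < d ->
  rintegrable mm (`]p, q[%classic `*` `]r, s[%classic) k.
Proof.
move=> lk ap qb cr sd.
have cK : compact (`[p, q]%classic `*` `[r, s]%classic : set (R * R)).
  by apply: compact_setX; exact: segment_compact.
have KD : (`[p, q]%classic `*` `[r, s]%classic : set (R * R)) `<=` X `*` Y.
  move=> [x y] /= []; rewrite !in_itv/= => /andP[px xq] /andP[ry ys].
  by rewrite (lt_le_trans ap)//= (le_lt_trans xq)//= (lt_le_trans cr)//= (le_lt_trans ys).
apply: (@integrableS _ _ _ mm (`[p, q]%classic `*` `[r, s]%classic)); last exact: lk.
- by apply: measurableX; exact: measurable_itv.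
- by apply: measurableX; exact: measurable_itv.
- by move=> [x y] /= [xpq yrs]; split; exact: subset_itv_oo_cc.
Qed.

Lemma fubini_swapped (A B : set Rm) k : measurable A -> measurable B ->
  rintegrable mm (A `*` B) k ->
  [/\ {ae mu, forall y, B y -> rintegrable mu A (fun x => k (x, y))},
      rintegrable mu B (fun y => \int[mu]_(x in A) k (x, y)) &
      \int[mm]_(z in A `*` B) k z = \int[mu]_(y in B) \int[mu]_(x in A) k (x, y)].
Proof.
move=> mA mB ki; have [ki' E] := rintegrable_swap mA mB ki.
have [h1 h2 h3] := fubini_slices mB mA ki'.
by split => //; rewrite -E.
Qed.

(** The one-variable lemma is used twice. For each rational bump in $x$ it shows that the
    $x$-integral of the bump times [k] vanishes for almost every $y$; off the union of these null
    sets it applies to [k] along the line. *)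
Lemma tensor_fundamental_lemma k : loc_integrable (X `*` Y) k ->
  (forall f g, test_itv a b f -> test_itv c d g ->
     \int[mm]_(z in X `*` Y) (tensor f g z * k z) = 0) ->
  {ae mu, forall y, Y y -> {ae mu, forall x, X x -> k (x, y) = 0}}.
Proof.
move=> lk H.
have mI (p q : R) : measurable (`]p, q[%classic : set Rm) by exact: measurable_itv.
have G0 : {ae mu, forall y, forall i : rat * rat * nat, Y y ->
    a < ratr i.1.1 -> ratr i.1.2 < b ->
    \int[mu]_(x in X) (bump (ratr i.1.1) (ratr i.1.2) i.2 x * k (x, y)) = 0}.
  apply: ae_forall_count => -[[p q] n] /=.
  have [ap|nap] := boolP (a < ratr p :> R); last by apply: aeW.
  have [qb|nqb] := boolP (ratr q < b :> R); last by apply: aeW.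
  have tb := test_itv_bump n ap qb.
  suff : {ae mu, forall y, Y y ->
      \int[mu]_(x in X) (bump (ratr p) (ratr q) n x * k (x, y)) = 0}.
    by apply: ae_imp => y h Yy _ _; exact: h.
  apply: fundamental_lemma.
  - move=> r s cr sd.
    have ki := loc_integrable_oo lk ap qb cr sd.
    have bki : rintegrable mm (`]ratr p, ratr q[%classic `*` `]ratr r, ratr s[%classic)
        (fun z => bump (ratr p) (ratr q) n z.1 * k z).
      apply: (rintegrable_bounded _ _ _ ki (M := 1)) => //.
      - exact: measurableX.
      - apply: measurable_funTS.
        exact: (measurableT_comp (test_itv_measurable tb) measurable_fst).
      - by move=> z _; rewrite ger0_norm ?bump_ge0// bump_le1.
    have [_ + _] := fubini_swapped (mI _ _) (mI _ _) bki.
    apply: (eq_rintegrable (mI _ _)) => y _ /=.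
    by rewrite (@bump_Rintegral _ a b)// ltW.
  - move=> r s m cr sd.
    have tb' := test_itv_bump m cr sd.
    pose P := `]ratr p, ratr q[%classic : set Rm; pose J := `]ratr r, ratr s[%classic : set Rm.
    have ki := loc_integrable_oo lk ap qb cr sd.
    have bki : rintegrable mm (P `*` J) (fun z => bump (ratr p) (ratr q) n z.1 * k z).
      apply: (rintegrable_bounded _ _ _ ki (M := 1)) => //.
      - exact: measurableX.
      - apply: measurable_funTS.
        exact: (measurableT_comp (test_itv_measurable tb) measurable_fst).
      - by move=> z _; rewrite ger0_norm ?bump_ge0// bump_le1.
    have tki : rintegrable mm (P `*` J)
        (fun z => tensor (bump (ratr p) (ratr q) n) (bump (ratr r) (ratr s) m) z * k z).
      apply: (@integrableS _ _ _ mm (X `*` Y) (P `*` J) _ mXY (measurableX (mI _ _) (mI _ _))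
        _ (rintegrable_loc_tensor lk tb tb')).
      move=> [x y] /=; rewrite /P /J /= !in_itv/= => -[/andP[px xq] /andP[ry ys]].
      by rewrite (lt_trans ap px) (lt_trans xq qb) (lt_trans cr ry) (lt_trans ys sd).
    have [hi1 hi2 _] := fubini_swapped (mI _ _) (mI _ _) bki.
    have [_ ti2 tE] := fubini_swapped (mI _ _) (mI _ _) tki.
    rewrite (@bump_Rintegral _ c d) ?ltW//.
    transitivity (\int[mm]_(z in P `*` J)
        (tensor (bump (ratr p) (ratr q) n) (bump (ratr r) (ratr s) m) z * k z)).
      rewrite tE; apply: ae_eq_Rintegral; first exact: mI.
      - apply: measurable_funM; last first.
          have := rintegrable_measurable hi2; apply: eq_measurable_fun => y _.
          by rewrite (@bump_Rintegral _ a b)// ltW.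
        by apply: measurable_funTS; exact: test_itv_measurable tb'.
      - exact: rintegrable_measurable ti2.
      - apply: ae_imp hi1 => y hi1 Jy; rewrite (@bump_Rintegral _ a b) ?ltW//.
        rewrite -RintegralZl; [|exact: mI|exact: hi1].
        by apply: eq_Rintegral => x _; rewrite /tensor /=; ring.
    rewrite -[RHS](H _ _ tb tb') Rintegral_mkcond [RHS]Rintegral_mkcond; congr Rintegral.
    apply/funext => -[x y]; rewrite !patchE.
    case: ifPn => [|/negP]; rewrite inE /= => xyPJ.
      rewrite mem_set//; move: xyPJ; rewrite /P /J /= !in_itv/= => -[/andP[px xq] /andP[ry ys]].
      by rewrite (lt_trans ap px) (lt_trans xq qb) (lt_trans cr ry) (lt_trans ys sd).
    case: ifPn => // _; rewrite /tensor /=.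
    have [xP|xP] := boolP (ratr p < (x : R) < ratr q); last by rewrite (bump_eq0 _ xP) !mul0r.
    have [yJ|yJ] := boolP (ratr r < (y : R) < ratr s); last by rewrite (bump_eq0 _ yJ) mulr0 mul0r.
    by exfalso; apply: xyPJ; rewrite /P /J /= !in_itv/= xP yJ.
(* As [k] is only locally integrable on the rectangle, its slices are shown integrable on inner
   rational intervals, one inner rectangle at a time. *)
have Ki : {ae mu, forall y, forall i : rat * rat * (rat * rat),
    a < ratr i.1.1 -> ratr i.1.2 < b -> c < ratr i.2.1 -> ratr i.2.2 < d ->
    `]ratr i.2.1, ratr i.2.2[%classic y ->
    rintegrable mu `]ratr i.1.1, ratr i.1.2[ (fun x => k (x, y))}.
  apply: ae_forall_count => -[[p q] [r s]] /=.
  have [ap|nap] := boolP (a < ratr p :> R); last by apply: aeW.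
  have [qb|nqb] := boolP (ratr q < b :> R); last by apply: aeW.
  have [cr|ncr] := boolP (c < ratr r :> R); last by apply: aeW.
  have [sd|nsd] := boolP (ratr s < d :> R); last by apply: aeW.
  have ki := loc_integrable_oo lk ap qb cr sd.
  have [h _ _] := fubini_swapped (mI _ _) (mI _ _) ki.
  by apply: ae_imp h => y h _ _ _ _; exact: h.
apply: ae_imp2 G0 Ki => y G0 Ki /[dup] Yy; rewrite /= in_itv/= => /andP[cy yd].
have /rat_in_itvoo[r] := cy; rewrite in_itv/= => /andP[cr ry].
have /rat_in_itvoo[s] := yd; rewrite in_itv/= => /andP[ys sd].
apply: fundamental_lemma.
  by move=> p q ap qb; apply: (Ki (p, q, (r, s))) => //=; rewrite in_itv/= ry.
by move=> p q n ap qb; exact: (G0 (p, q, n)).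
Qed.

End weak_tensor.

(** * Weak derivatives on a rectangle *)

Section weak_pairs.
Context (R : realType).
Notation mu := (@lebesgue_measure R).
Notation mm := (mu \x mu)%E.
Notation Rm := (measurableTypeR R).
Implicit Types (u v g h k : R * R -> R) (a b c d : R).
Notation I a b := (`]a, b[%classic : set Rm).

Let mI a b : measurable (I a b). Proof. exact: measurable_itv. Qed.
Let mII a b c d : measurable (I a b `*` I c d). Proof. exact: measurableX. Qed.

(* [h] is the weak x-derivative of [g], tested against products only. *)
Definition xpair a b c d g h := forall e f, test_itv a b e -> test_itv c d f ->
  \int[mm]_(z in I a b `*` I c d) (tensor ('D_(1 : R) e) f z * g z) +
  \int[mm]_(z in I a b `*` I c d) (tensor e f z * h z) = 0.

Definition ypair a b c d g h := forall e f, test_itv a b e -> test_itv c d f ->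
  \int[mm]_(z in I a b `*` I c d) (tensor e ('D_(1 : R) f) z * g z) +
  \int[mm]_(z in I a b `*` I c d) (tensor e f z * h z) = 0.

Lemma derive_iterSr n (f : R -> R) : derive_iter n ('D_(1 : R) f) = derive_iter n.+1 f.
Proof. by rewrite /derive_iter iterSr. Qed.

(** Both [g] and [h] are weak derivatives of the same [u]. The relation for [g] tested with the
    derivative of [e] and the one for [h] tested with [e] share the integral that contains [u]; the
    signs differ by one factor $-1$. *)
Lemma weak_xpair a b c d i j u g h :
  weak_dxy (I a b `*` I c d) i j u g -> weak_dxy (I a b `*` I c d) i.+1 j u h ->
  xpair a b c d g h.
Proof.
move=> wg wh e f te tf.
have := weak_tensor wg (test_itv_derive te) tf.
rewrite derive_iterSr (weak_tensor wh te tf) addSn exprS mulN1r mulNr.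
move=> /(congr1 (fun t => (-1) ^+ (i + j) * t)).
rewrite mulrN !mulrA -!exprMn mulrNN mulr1 !expr1n !mul1r => <-.
by rewrite addNr.
Qed.

Lemma weak_ypair a b c d i j u g h :
  weak_dxy (I a b `*` I c d) i j u g -> weak_dxy (I a b `*` I c d) i j.+1 u h ->
  ypair a b c d g h.
Proof.
move=> wg wh e f te tf.
have := weak_tensor wg te (test_itv_derive tf).
rewrite derive_iterSr (weak_tensor wh te tf) addnS exprS mulN1r mulNr.
move=> /(congr1 (fun t => (-1) ^+ (i + j) * t)).
rewrite mulrN !mulrA -!exprMn mulrNN mulr1 !expr1n !mul1r => <-.
by rewrite addNr.
Qed.

(** The plane carries the product sigma-algebra, while continuity and compactness refer to the
    topology; every open set is a countable union of rational rectangles. *)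
Lemma open_measurable_plane (U : set (R * R)) : open U -> measurable (U : set (Rm * Rm)).
Proof.
move=> oU.
pose rect (i : rat * rat * (rat * rat)) : set (Rm * Rm) :=
  I (ratr i.1.1) (ratr i.1.2) `*` I (ratr i.2.1) (ratr i.2.2).
pose F i := if `[< rect i `<=` U >] then rect i else set0.
have -> : U = \bigcup_i F i.
  apply/seteqP; split => [[x y] Uxy|z [i _]]; last first.
    by rewrite /F; case: asboolP => // iU /iU.
  have /nbhs_ballP[e /= e0 eU] : nbhs (x, y) U by apply: open_nbhs_nbhs.
  have near_rat (t : R) : exists i : rat * rat, [/\ t - e < ratr i.1, ratr i.1 < t, t < ratr i.2 & ratr i.2 < t + e].
    have /rat_in_itvoo[p] : t - e < t by lra.
    rewrite in_itv/= => /andP[p1 p2].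
    have /rat_in_itvoo[q] : t < t + e by lra.
    by rewrite in_itv/= => /andP[q1 q2]; exists (p, q).
  have [i [i1 i2 i3 i4]] := near_rat x; have [j [j1 j2 j3 j4]] := near_rat y.
  exists (i, j) => //; rewrite /F; case: asboolP => [_|[]].
    by rewrite /rect /= !in_itv/= i2 i3 j2 j3.
  move=> [x' y']; rewrite /rect /= !in_itv/= => -[/andP[h1 h2] /andP[h3 h4]].
  by apply: eU; split => /=; rewrite /ball /= ltr_norml; lra.
apply: countable_bigcupT_measurable => [|i]; first exact: countableP.
by rewrite /F; case: asboolP => _; [exact: mII|exact: measurable0].
Qed.

Lemma continuous_measurable_plane (f : R * R -> R) : continuous f ->
  measurable_fun (setT : set (Rm * Rm)) f.
Proof.
move=> cf; apply: (measurability _ (RGenOpens.measurableE R)).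
move=> _ [_ [p [q ->] <-]]; rewrite setTI; apply: open_measurable_plane.
by move/continuousP : cf; apply; exact: interval_open.
Qed.

Lemma compact_measurable_plane (K : set (R * R)) : compact K -> measurable (K : set (Rm * Rm)).
Proof.
move=> cK; rewrite -[K]setCK; apply: measurableC; apply: open_measurable_plane.
by rewrite openC; apply: compact_closed.
Qed.

Lemma rintegrable_tensor_mul a b c d e f k : test_itv a b e -> test_itv c d f ->
  rintegrable mm (I a b `*` I c d) k ->
  rintegrable mm (I a b `*` I c d) (fun z => tensor e f z * k z).
Proof.
move=> te tf ki; have [M tM] := bounded_tensor te tf.
exact: (rintegrable_bounded (mII _ _ _ _) (measurable_tensor te tf) (fun z _ => tM z) ki).
Qed.

Lemma tensor_unique a b c d g h :
  measurable_fun (I a b `*` I c d) g -> measurable_fun (I a b `*` I c d) h ->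
  loc_integrable (I a b `*` I c d) g -> loc_integrable (I a b `*` I c d) h ->
  (forall e f, test_itv a b e -> test_itv c d f ->
    \int[mm]_(z in I a b `*` I c d) (tensor e f z * g z) =
    \int[mm]_(z in I a b `*` I c d) (tensor e f z * h z)) ->
  {ae mm, forall z, (I a b `*` I c d) z -> g z = h z}.
Proof.
move=> mg mh lg lh E.
pose k z := g z - h z.
have lk : loc_integrable (I a b `*` I c d) k.
  move=> K cK KD; apply: (integrableB _ (lg K cK KD) (lh K cK KD)).
  exact: compact_measurable_plane.
have H : {ae mu, forall y, I c d y -> {ae mu, forall x, I a b x -> k (x, y) = 0}}.
  apply: tensor_fundamental_lemma lk _ => e f te tf.
  have gi := rintegrable_loc_tensor lg te tf; have hi := rintegrable_loc_tensor lh te tf.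
  transitivity (\int[mm]_(z in I a b `*` I c d) (tensor e f z * g z - tensor e f z * h z)).
    by apply: eq_Rintegral => z _; rewrite /k mulrBr.
  by rewrite RintegralB// E// subrr.
have mg' := measurable_fun_swap (mI a b) (mI c d) mg.
have mh' := measurable_fun_swap (mI a b) (mI c d) mh.
pose P (z : Rm * Rm) : bool := g (unstable.swap z) == h (unstable.swap z).
have mP : measurable_fun (I c d `*` I a b) P by exact: measurable_fun_eqr.
have : {ae mm, forall z, (I c d `*` I a b) z -> P z}.
  apply: (ae_of_slices (mI c d) (mI a b) mP).
  apply: ae_imp H => y hy Yy; apply: ae_imp (hy Yy) => x hx Xx.
  by rewrite /P /unstable.swap /= -subr_eq0; apply/eqP/hx.
move=> /ae_swap; apply: ae_imp => -[x y] + [xab ycd].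
by rewrite /P /unstable.swap /= => /(_ (conj ycd xab)) /eqP.
Qed.

(** The regularity clauses, the equation and the traces each bring their own version of a
    derivative; this identifies the versions almost everywhere. *)
Lemma weak_unique a b c d i j u g h :
  measurable_fun (I a b `*` I c d) g -> measurable_fun (I a b `*` I c d) h ->
  weak_dxy (I a b `*` I c d) i j u g -> weak_dxy (I a b `*` I c d) i j u h ->
  {ae mm, forall z, (I a b `*` I c d) z -> g z = h z}.
Proof.
move=> mg mh wg wh; have [_ lg _] := wg; have [_ lh _] := wh.
apply: tensor_unique => // e f te tf.
have := weak_tensor wg te tf; rewrite (weak_tensor wh te tf).
move=> /(congr1 (fun t => (-1) ^+ (i + j) * t)).
by rewrite !mulrA -!exprMn mulrNN mulr1 !expr1n !mul1r.
Qed.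

Lemma rintegrable_loc (D : set (Rm * Rm)) g : measurable D -> rintegrable mm D g ->
  loc_integrable D g.
Proof.
by move=> mD gi K cK KD; apply: integrableS gi => //; exact: compact_measurable_plane.
Qed.

Lemma xpair_unique a b c d u g h :
  rintegrable mm (I a b `*` I c d) g -> rintegrable mm (I a b `*` I c d) h ->
  xpair a b c d u g -> xpair a b c d u h ->
  {ae mm, forall z, (I a b `*` I c d) z -> g z = h z}.
Proof.
move=> gi hi ug uh.
apply: tensor_unique; [exact: rintegrable_measurable gi|exact: rintegrable_measurable hi| | |].
- exact: rintegrable_loc gi.
- exact: rintegrable_loc hi.
- move=> e f te tf; have := ug e f te tf; rewrite -(uh e f te tf).
  by move=> /addrI.
Qed.

Lemma xpair_swap a b c d g h :
  rintegrable mm (I a b `*` I c d) g -> rintegrable mm (I a b `*` I c d) h ->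
  ypair a b c d g h ->
  xpair c d a b (fun z => g (unstable.swap z)) (fun z => h (unstable.swap z)).
Proof.
move=> gi hi H e f te tf; rewrite -[RHS](H f e tf te).
have sw k e' f' : test_itv a b e' -> test_itv c d f' -> rintegrable mm (I a b `*` I c d) k ->
    \int[mm]_(z in I c d `*` I a b) (tensor f' e' z * k (unstable.swap z)) =
    \int[mm]_(z in I a b `*` I c d) (tensor e' f' z * k z).
  move=> te' tf' ki; have tki := rintegrable_tensor_mul te' tf' ki.
  rewrite -(rintegrable_swap (mI a b) (mI c d) tki).2.
  by apply: eq_Rintegral => -[y x] _; rewrite /tensor /unstable.swap /= [e' _ * _]mulrC.
by rewrite !sw//; exact: test_itv_derive.
Qed.

Lemma rintegrable_test_fst a b c d e k : test_itv a b e ->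
  rintegrable mm (I a b `*` I c d) k ->
  rintegrable mm (I a b `*` I c d) (fun z => e z.1 * k z).
Proof.
move=> te ki; have [M eM] := test_itv_bounded te.
apply: (rintegrable_bounded (mII _ _ _ _) _ (fun z _ => eM z.1) ki).
by apply: measurable_fun_fst => //; apply: measurable_funTS; exact: test_itv_measurable te.
Qed.

Lemma rintegrable_test_snd a b c d f k : test_itv c d f ->
  rintegrable mm (I a b `*` I c d) k ->
  rintegrable mm (I a b `*` I c d) (fun z => f z.2 * k z).
Proof.
move=> tf ki; have [M fM] := test_itv_bounded tf.
apply: (rintegrable_bounded (mII _ _ _ _) _ (fun z _ => fM z.2) ki).
by apply: measurable_fun_snd => //; apply: measurable_funTS; exact: test_itv_measurable tf.
Qed.

(** The fundamental lemma in $y$, applied to the $x$-integrals: it turns an identity tested in both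
    variables into one that holds on almost every horizontal line. *)
Lemma ae_Rintegral_slices_eq0 a b c d k : rintegrable mm (I a b `*` I c d) k ->
  (forall f, test_itv c d f -> \int[mm]_(z in I a b `*` I c d) (f z.2 * k z) = 0) ->
  {ae mu, forall y, I c d y -> \int[mu]_(x in I a b) k (x, y) = 0}.
Proof.
move=> ki H; have [ky Gi _] := fubini_swapped (mI a b) (mI c d) ki.
apply: fundamental_lemma.
  by move=> r s cr sd; apply: rintegrable_sub Gi; exact: ltW.
move=> r s m cr sd; have tb := test_itv_bump m cr sd.
have [_ Bi BE] := fubini_swapped (mI a b) (mI c d) (rintegrable_test_snd tb ki).
rewrite -[RHS](H _ tb) BE; apply: ae_eq_Rintegral => //.
- apply: measurable_funM; last exact: rintegrable_measurable Gi.
  by apply: measurable_funTS; exact: test_itv_measurable tb.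
- exact: rintegrable_measurable Bi.
- by apply: ae_imp ky => y yi Yy; rewrite -RintegralZl//; exact: yi.
Qed.

(** For each member of the countable family in $x$ the tested identity holds on almost every line,
    so on almost every line it holds for the whole family. *)
Lemma xpair_slices a b c d g h : a < b ->
  rintegrable mm (I a b `*` I c d) g -> rintegrable mm (I a b `*` I c d) h ->
  xpair a b c d g h ->
  {ae mu, forall y, I c d y ->
    [/\ rintegrable mu (I a b) (fun x => g (x, y)), rintegrable mu (I a b) (fun x => h (x, y)) &
     exists C, {ae mu, forall x, I a b x -> g (x, y) = C + \int[mu]_(s in I a x) h (s, y)}]}.
Proof.
move=> ab gi hi H; have [Fam [tFam FamP]] := countable_test_functions ab.
have G0 : {ae mu, forall y, forall i, I c d y ->
    \int[mu]_(x in I a b) ('D_(1 : R) (Fam i) x * g (x, y) + Fam i x * h (x, y)) = 0}.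
  apply: ae_forall_count => i; have tF := tFam i; have tdF := test_itv_derive tF.
  apply: (ae_Rintegral_slices_eq0 (k := fun z => 'D_(1 : R) (Fam i) z.1 * g z + Fam i z.1 * h z)).
    have k1 := rintegrable_test_fst tdF gi; have k2 := rintegrable_test_fst tF hi.
    exact: (rintegrableD (mII a b c d) k1 k2).
  move=> f tf; rewrite -[RHS](H _ _ tF tf) -RintegralD//.
  - by apply: eq_Rintegral => z _; rewrite /tensor; ring.
  - exact: rintegrable_tensor_mul tdF tf gi.
  - exact: rintegrable_tensor_mul tF tf hi.
have [gy _ _] := fubini_swapped (mI a b) (mI c d) gi.
have [hy _ _] := fubini_swapped (mI a b) (mI c d) hi.
apply: ae_imp3 G0 gy hy => y G0 gy hy Yy; split; [exact: gy|exact: hy|].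
by apply: FamP; [exact: gy|exact: hy|move=> i; exact: G0].
Qed.

Lemma ypair_slices a b c d g h : c < d ->
  rintegrable mm (I a b `*` I c d) g -> rintegrable mm (I a b `*` I c d) h ->
  ypair a b c d g h ->
  {ae mu, forall x, I a b x ->
    [/\ rintegrable mu (I c d) (fun y => g (x, y)), rintegrable mu (I c d) (fun y => h (x, y)) &
     exists C, {ae mu, forall y, I c d y -> g (x, y) = C + \int[mu]_(s in I c y) h (x, s)}]}.
Proof.
move=> cd gi hi H.
have [gi' _] := rintegrable_swap (mI a b) (mI c d) gi.
have [hi' _] := rintegrable_swap (mI a b) (mI c d) hi.
exact: (xpair_slices cd gi' hi' (xpair_swap gi hi H)).
Qed.

(* The condition [v = 0] on [x = b] is differentiated along that side. *)
Lemma tangential_derivative a b c d v vx vy vxy : a < b -> c < d ->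
  rintegrable mm (I a b `*` I c d) v -> rintegrable mm (I a b `*` I c d) vx ->
  rintegrable mm (I a b `*` I c d) vy -> rintegrable mm (I a b `*` I c d) vxy ->
  ypair a b c d v vy -> ypair a b c d vx vxy ->
  {ae mu, forall y, I c d y -> {ae mu, forall x, I a b x ->
     v (x, y) = - \int[mu]_(s in I x b) vx (s, y)}} ->
  {ae mu, forall y, I c d y -> {ae mu, forall x, I a b x ->
     vy (x, y) = - \int[mu]_(s in I x b) vxy (s, y)}}.
Proof.
move=> ab cd vi vxi vyi vxyi Hv Hvx vE.
have ab' := ltW ab; have cd' := ltW cd.
have [vY _ _] := fubini_swapped (mI a b) (mI c d) vi.
have [vxY _ _] := fubini_swapped (mI a b) (mI c d) vxi.
have [vyY _ _] := fubini_swapped (mI a b) (mI c d) vyi.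
have [vxyY _ _] := fubini_swapped (mI a b) (mI c d) vxyi.
have ibp e (k : R -> R) : test_itv a b e -> rintegrable mu (I a b) k ->
    \int[mu]_(x in I a b) (e x * - \int[mu]_(s in I x b) k s) =
    - \int[mu]_(x in I a b) ((\int[mu]_(s in I a x) e s) * k x).
  move=> te ki; have acW := AC_right ki.
  have ei : rintegrable mu (I a b) e.
    have := test_itv_rintegrable te (AC_affine a b 0).1.
    by apply: (eq_rintegrable (mI _ _)) => x _; rewrite /= mulr1.
  have acA := AC_left ei.
  have := AC_Rintegral ab' (AC_mul acA acW).
  rewrite !set_itvoo_eq0 !Rintegral_set0 oppr0 mulr0 mul0r subrr => E.
  apply/eqP; rewrite -addr_eq0 -[X in _ == X]E; apply/eqP.
  rewrite -RintegralD//.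
  - have := AC_rintegrable acW; exact: test_itv_rintegrable.
  - apply: (rintegrable_bounded (mI _ _) (AC_measurable acA) _ ki) => x.
    by rewrite /= in_itv/= => /andP[ax xb]; apply: (AC_bound acA); rewrite !ltW.
(* Let $A$ be the primitive of $e$ from $a$. The chain is $\int fA\,v_{xy}=-\int f'A\,v_x=\int
   f'e\,v=-\int fe\,v_y$. As $A$ need not vanish at $b$, it is no test function: the first equality
   is proved on vertical lines, where only $f$ is tested, and the second on horizontal lines from
   the representation of $v$, which carries the boundary condition. *)
have key e : test_itv a b e ->
    {ae mu, forall y, I c d y -> \int[mu]_(x in I a b)
       (e x * vy (x, y) + (\int[mu]_(s in I a x) e s) * vxy (x, y)) = 0}.
  move=> te.
  have ei : rintegrable mu (I a b) e.
    have := test_itv_rintegrable te (AC_affine a b 0).1.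
    by apply: (eq_rintegrable (mI _ _)) => x _; rewrite /= mulr1.
  have acA := AC_left ei.
  set A := (fun x => _) in acA.
  have mA : measurable_fun (I a b `*` I c d) (fun z : Rm * Rm => A z.1).
    by apply: measurable_fun_fst => //; exact: AC_measurable acA.
  have [MA AM] : exists MA, forall x, I a b x -> `|A x| <= MA.
    by eexists => x; rewrite /= in_itv/= => /andP[ax xb]; apply: (AC_bound acA); rewrite !ltW.
  have Ai k : rintegrable mm (I a b `*` I c d) k ->
      rintegrable mm (I a b `*` I c d) (fun z => A z.1 * k z).
    by move=> ki; apply: (rintegrable_bounded (mII _ _ _ _) mA _ ki (M := MA)) => z [z1 _]; exact: AM.
  apply: (ae_Rintegral_slices_eq0 (k := fun z => e z.1 * vy z + A z.1 * vxy z)).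
    by apply: rintegrableD => //; [exact: rintegrable_test_fst|exact: Ai].
  move=> f tb; have tf' := test_itv_derive tb.
  transitivity (\int[mm]_(z in I a b `*` I c d) (tensor e f z * vy z) +
      \int[mm]_(z in I a b `*` I c d) (f z.2 * (A z.1 * vxy z))).
    rewrite -RintegralD//.
    - by apply: eq_Rintegral => z _; rewrite /tensor; ring.
    - exact: rintegrable_tensor_mul.
    - exact: rintegrable_test_snd tb (Ai _ vxyi).
  have j1 := rintegrable_test_snd tb (Ai _ vxyi).
  have j2 := rintegrable_test_snd tf' (Ai _ vxi).
  have E1 : \int[mm]_(z in I a b `*` I c d) (f z.2 * (A z.1 * vxy z)) =
      - \int[mm]_(z in I a b `*` I c d) ('D_(1 : R) f z.2 * (A z.1 * vx z)).
    apply/eqP; rewrite -addr_eq0 -RintegralD//.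
    have j12 := rintegrableD (mII _ _ _ _) j1 j2.
    have [_ Ji ->] := fubini_slices (mI a b) (mI c d) j12.
    have : {ae mu, forall x, I a b x -> \int[mu]_(y in I c d)
        (f y * (A x * vxy (x, y)) + 'D_(1 : R) f y * (A x * vx (x, y))) = 0}.
      apply: ae_imp (ypair_slices cd vxi vxyi Hvx) => x /[apply] -[gx hx [C CE]].
      have acf := AC_smooth cd' (test_itv_smooth tb).
      have acv := AC_add (AC_cst c d C) (AC_left hx).
      have := AC_Rintegral cd' (AC_mul acf acv).
      have [-> ->] := test_itv_bnd tb; rewrite !mul0r subrr => E.
      have i3 : rintegrable mu (I c d) (fun y => 'D_(1 : R) f y * vx (x, y) + f y * vxy (x, y)).
        by apply: rintegrableD => //; apply: test_itv_rintegrable => //; exact: test_itv_derive.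
      transitivity (A x * \int[mu]_(y in I c d) ('D_(1 : R) f y * vx (x, y) + f y * vxy (x, y))).
        by rewrite -RintegralZl//; apply: eq_Rintegral => y _; ring.
      rewrite (_ : \int[mu]_(y in _) _ = 0) ?mulr0// -[RHS]E.
      apply: ae_eq_Rintegral => //.
      + exact: rintegrable_measurable i3.
      + exact: rintegrable_measurable (AC_mul acf acv).1.
      + by apply: ae_imp CE => y /[apply] ->; rewrite /= add0r.
    move=> h0; apply/eqP; transitivity (\int[mu]_(x in I a b) (0 : R)).
      by apply: ae_eq_Rintegral => //; exact: rintegrable_measurable Ji.
    by rewrite Rintegral_cst// mul0r.
  have j3 := rintegrable_test_snd tf' (rintegrable_test_fst te vi).
  have E2 : \int[mm]_(z in I a b `*` I c d) ('D_(1 : R) f z.2 * (A z.1 * vx z)) =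
      - \int[mm]_(z in I a b `*` I c d) ('D_(1 : R) f z.2 * (e z.1 * v z)).
    apply/eqP; rewrite -addr_eq0 -RintegralD//.
    have j23 := rintegrableD (mII _ _ _ _) j2 j3.
    have [_ Ji ->] := fubini_swapped (mI a b) (mI c d) j23.
    have : {ae mu, forall y, I c d y -> \int[mu]_(x in I a b)
        ('D_(1 : R) f y * (A x * vx (x, y)) + 'D_(1 : R) f y * (e x * v (x, y))) = 0}.
      apply: ae_imp3 vE vY vxY => y vE vY vxY Yy.
      have vyi' := vY Yy; have vxyi' := vxY Yy.
      have := ibp _ _ te vxyi'.
      have acW := AC_right vxyi'.
      have -> : \int[mu]_(x in I a b) (e x * - \int[mu]_(s in I x b) vx (s, y)) =
         \int[mu]_(x in I a b) (e x * v (x, y)).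
        apply: ae_eq_Rintegral => //.
        - by apply: rintegrable_measurable; apply: test_itv_rintegrable te _; exact: AC_rintegrable acW.
        - by apply: rintegrable_measurable; exact: test_itv_rintegrable te _.
        - by apply: ae_imp (vE Yy) => x /[apply] ->.
      move=> /eqP; rewrite -addr_eq0 -/A => /eqP E.
      have i4 : rintegrable mu (I a b) (fun x => A x * vx (x, y)).
        apply: (rintegrable_bounded (mI _ _) (AC_measurable acA) _ vxyi' (M := MA)) => x xab.
        exact: AM.
      have i5 := test_itv_rintegrable te vyi'.
      transitivity ('D_(1 : R) f y * \int[mu]_(x in I a b) (e x * v (x, y) + A x * vx (x, y))).
        by rewrite -RintegralZl//; [apply: eq_Rintegral => x _; ring|exact: rintegrableD].
      by rewrite RintegralD// E mulr0.
    move=> h0; apply/eqP; transitivity (\int[mu]_(x in I c d) (0 : R)).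
      by apply: ae_eq_Rintegral => //; exact: rintegrable_measurable Ji.
    by rewrite Rintegral_cst// mul0r.
  rewrite E1 E2 opprK -[RHS](Hv _ _ te tb) addrC; congr (_ + _).
  by apply: eq_Rintegral => z _; rewrite /tensor; ring.
have : {ae mu, forall y, forall i : rat * rat * nat, I c d y ->
    a < ratr i.1.1 -> ratr i.1.2 < b -> \int[mu]_(x in I a b)
       (bump (ratr i.1.1) (ratr i.1.2) i.2 x * vy (x, y) +
        (\int[mu]_(s in I a x) bump (ratr i.1.1) (ratr i.1.2) i.2 s) * vxy (x, y)) = 0}.
  apply: ae_forall_count => i.
  have [ap|nap] := boolP (a < ratr i.1.1 :> R); last by apply: aeW.
  have [qb|nqb] := boolP (ratr i.1.2 < b :> R); last by apply: aeW.
  by apply: ae_imp (key _ (test_itv_bump i.2 ap qb)) => y h Yy _ _; exact: h.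
move=> K; apply: ae_imp3 K vyY vxyY => y K vyY vxyY Yy.
have i1 := vyY Yy; have i2 := vxyY Yy; have acW := AC_right i2.
have : {ae mu, forall x, I a b x -> vy (x, y) - (- \int[mu]_(s in I x b) vxy (s, y)) = 0}.
  apply: fundamental_lemma.
    move=> p q ap qb; apply: (@rintegrable_sub _ a b); [exact: ltW|exact: ltW|].
    by apply: rintegrableB => //; exact: AC_rintegrable acW.
  move=> p q n ap qb; have tb := test_itv_bump n ap qb.
  have := K (p, q, n) Yy ap qb => /= E.
  have i3 := test_itv_rintegrable tb i1.
  have i4 := test_itv_rintegrable tb (AC_rintegrable acW).
  transitivity (\int[mu]_(x in I a b) (bump (ratr p) (ratr q) n x * vy (x, y) -
      bump (ratr p) (ratr q) n x * (- \int[mu]_(s in I x b) vxy (s, y)))).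
    by apply: eq_Rintegral => x _; ring.
  rewrite RintegralB//= ibp// opprK -RintegralD//.
  have ei : rintegrable mu (I a b) (bump (ratr p) (ratr q) n).
    have := test_itv_rintegrable tb (AC_affine a b 0).1.
    by apply: (eq_rintegrable (mI _ _)) => x _; rewrite /= mulr1.
  have acA := AC_left ei.
  apply: (rintegrable_bounded (mI _ _) (AC_measurable acA) _ i2) => x.
  by rewrite /= in_itv/= => /andP[ax xb]; apply: (AC_bound acA); rewrite !ltW.
by apply: ae_imp => x /[apply] /eqP; rewrite subr_eq0 => /eqP.
Qed.

End weak_pairs.

(** * Traces *)

Section L1_squeeze.
Context d (T : measurableType d) (R : realType) (mu : {measure set T -> \bar R}).
Variables (D : set T) (mD : measurable D).

(** Nonnegative majorants of arbitrarily small integral have infimum zero at almost every point. In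
    this way an approximation in $L^1$ of the rectangle becomes an exact statement on almost every
    line. *)
Lemma L1_squeeze (q : T -> R) :
  (forall eps, 0 < eps -> exists r : T -> R, [/\ rintegrable mu D r,
     forall x, D x -> 0 <= r x, \int[mu]_(x in D) r x <= eps &
     {ae mu, forall x, D x -> q x <= r x}]) ->
  {ae mu, forall x, D x -> q x <= 0}.
Proof.
move=> H.
have H' (n : nat) : exists r : T -> R, [/\ rintegrable mu D r,
     forall x, D x -> 0 <= r x, \int[mu]_(x in D) r x <= n.+1%:R^-1 &
     {ae mu, forall x, D x -> q x <= r x}].
  by apply: H; rewrite invr_gt0.
pose r n := sval (cid (H' n)).
have rP n := svalP (cid (H' n)).
have small (m : nat) : {ae mu, forall x, D x -> exists n, r n x < m.+1%:R^-1}.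
  (* Where no majorant is below [m.+1%:R^-1], this constant times the indicator lies below every
     [r n]; its integral is therefore zero. *)
  pose A := \bigcap_n (D `&` [set x | m.+1%:R^-1 <= r n x]).
  have mA : measurable A.
    apply: bigcap_measurable => // n _.
    have [ri _ _ _] := rP n; have mr := rintegrable_measurable ri.
    have -> : [set x | m.+1%:R^-1 <= r n x] = (r n) @^-1` `[m.+1%:R^-1, +oo[.
      by apply/seteqP; split => x /=; rewrite in_itv/= andbT.
    by apply: mr => //; exact: measurable_itv.
  have m0 : 0 < m.+1%:R^-1 :> R by rewrite invr_gt0.
  have mind : measurable_fun D (\1_A : T -> R) by apply: measurable_funTS; exact: measurable_indic.
  have le n x : D x -> m.+1%:R^-1 * \1_A x <= r n x.
    move=> Dx; rewrite indicE; case: (boolP (x \in A)) => [|_] /=.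
      by rewrite inE mulr1 => /(_ n Logic.I)[].
    by rewrite mulr0; have [_ + _ _] := rP n; apply.
  have i1 : rintegrable mu D (fun x => m.+1%:R^-1 * \1_A x).
    have [ri r0 _ _] := rP 0%N.
    apply: (rintegrable_le mD _ _ ri); first exact: measurable_funM.
    by move=> x Dx; rewrite ger0_norm ?le// mulr_ge0// ltW.
  have : {ae mu, forall x, D x -> (m.+1%:R^-1 * \1_A x : R) = 0}.
    apply: (ae_eq0_of_Rintegral_norm mD i1).
    have E : \int[mu]_(x in D) `|m.+1%:R^-1 * \1_A x| = \int[mu]_(x in D) (m.+1%:R^-1 * \1_A x).
      by apply: eq_Rintegral => x _; rewrite ger0_norm// mulr_ge0// ltW.
    rewrite E leNgt; apply/negP => I0.
    have [n _ /(_ n (leqnn n)) nI] := near_infty_natSinv_lt (PosNum I0).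
    have [ri _ rI _] := rP n.
    have := le_Rintegral mD i1 ri (le n); apply/negP; rewrite -ltNge.
    exact: le_lt_trans rI nI.
  apply: ae_imp => x H0 Dx; apply: contrapT => nex.
  have Ax : A x.
    by move=> n _; split => //=; rewrite leNgt; apply/negP => rn; apply: nex; exists n.
  have := H0 Dx; rewrite indicE mem_set//= mulr1 => /eqP.
  by rewrite gt_eqF.
have all_small : {ae mu, forall x, forall m : nat, D x -> exists n, r n x < m.+1%:R^-1}.
  exact: ae_forall_count.
have all_le : {ae mu, forall x, forall n : nat, D x -> q x <= r n x}.
  by apply: ae_forall_count => n; have [] := rP n.
apply: ae_imp2 all_small all_le => x h1 h2 Dx.
rewrite leNgt; apply/negP => q0.
have [m _ /(_ m (leqnn m)) mq] := near_infty_natSinv_lt (PosNum q0).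
have [n rn] := h1 m Dx; have := h2 n Dx.
by rewrite leNgt (lt_trans rn mq).
Qed.

End L1_squeeze.

(** * From extended L2 norms to real integrals of squares *)

Section L2norms.
Context d (T : measurableType d) (R : realType) (mu : {measure set T -> \bar R}).
Variables (D : set T) (mD : measurable D).
Implicit Types f : T -> R.

Lemma L2norm_poweR f : (L2norm mu D f `^ 2 = \int[mu]_(x in D) (f x ^+ 2)%:E)%E.
Proof.
rewrite /L2norm poweR_Lnorm// [RHS]integral_mkcond; apply: eq_integral => x _.
rewrite !patchE; case: ifPn => _ /=.
  by rewrite powR_mulrn// real_normK// num_real.
by rewrite normr0 powR0.
Qed.

Lemma L2norm_expe f : (L2norm mu D f ^+ 2 = \int[mu]_(x in D) (f x ^+ 2)%:E)%E.
Proof.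
rewrite -L2norm_poweR; have := Lnorm_ge0 mu 2%:E ((EFin \o f) \_ D).
rewrite -/(L2norm mu D f); case: (L2norm mu D f) => [s|//|//] /=.
  by rewrite lee_fin => s0; rewrite powR_mulrn.
by rewrite mulyy ifF// pnatr_eq0.
Qed.

Lemma L2fun_sqintegrable f : L2fun mu D f -> sqintegrable mu D f.
Proof.
move=> [mf foo]; split => //; apply/integrableP; split.
  by apply/measurable_EFinP; exact: measurable_funX.
under eq_integral do rewrite /= ger0_norm ?sqr_ge0//.
by rewrite -L2norm_poweR poweR_lty.
Qed.

Lemma L2norm_cvg0 (I : Type) (F : set_system I) {FF : Filter F} (h : I -> T -> R) :
  (\forall n \near F, measurable_fun D (h n)) ->
  L2norm mu D (h n) @[n --> F] --> 0%E ->
  forall eps, 0 < eps -> \forall n \near F,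
    sqintegrable mu D (h n) /\ \int[mu]_(x in D) (h n x ^+ 2) <= eps.
Proof.
move=> mh h0 eps eps0.
(* A norm below both 1 and [eps] has its square below [eps]. *)
have : (0 : \bar R) \in ([set y | (y < (Num.min 1 eps)%:E)%E] : set (\bar R)).
  by rewrite inE /= lte_fin lt_min ltr01.
rewrite inE => /(open_ereal_lt_ereal) => nb.
have e1 : (0 < (Num.min 1 eps)%:E :> \bar R)%E by rewrite lte_fin lt_min ltr01.
have : \forall n \near F, (L2norm mu D (h n) < (Num.min 1 eps)%:E)%E.
  exact: (h0 _ nb).
apply: filterS2 mh => n mh hn.
have sq : sqintegrable mu D (h n).
  by apply: L2fun_sqintegrable; split => //; apply: (lt_le_trans hn); rewrite leey.
split => //.
have : (L2norm mu D (h n) ^+ 2 <= eps%:E)%E.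
  have := Lnorm_ge0 mu 2%:E ((EFin \o h n) \_ D); rewrite -/(L2norm mu D (h n)).
  case: (L2norm mu D (h n)) hn => [s|//|//]; rewrite lte_fin lt_min => /andP[s1 se].
  rewrite lee_fin => s0; rewrite -EFin_expe lee_fin expr2.
  by apply: (@le_trans _ _ (s * 1)); [rewrite ler_wpM2l// ltW|rewrite mulr1 ltW].
by rewrite L2norm_expe (EFin_Rintegral mD sq.2) lee_fin.
Qed.

Lemma Rintegral_norm_le f m : (mu D <= m%:E)%E -> sqintegrable mu D f ->
  (\int[mu]_(x in D) `|f x|) ^+ 2 <= m * \int[mu]_(x in D) (f x ^+ 2).
Proof.
move=> Dm fi; have Doo : (mu D < +oo)%E by apply: le_lt_trans Dm _; rewrite ltry.
have c1 := sqintegrable_cst mD 1 Doo.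
have := cauchy_schwarz_Rintegral mD c1 (sqintegrable_norm mD fi).
under eq_Rintegral do rewrite /= mul1r.
move=> /le_trans; apply.
under [X in _ * X <= _]eq_Rintegral do rewrite real_normK ?num_real//.
rewrite ler_wpM2r ?Rintegral_ge0//; first by move=> x _; exact: sqr_ge0.
under eq_Rintegral do rewrite /= expr1n.
rewrite Rintegral_cst// mul1r.
by rewrite -lee_fin fineK// ge0_fin_numE.
Qed.

End L2norms.

Section smooth_plane.
Context (R : realType).
Implicit Types phi : R * R -> R.

Let slice_affine y (h e x : R) : h *: (e, 0 : R) + (x, y) = (h *: e + x, y).
Proof. by congr pair; rewrite /= [_ *: 0]mulr0 add0r. Qed.

Lemma continuous_pairl (y : R) : continuous (fun x : R => (x, y)).
Proof.
move=> x A /nbhs_ballP[e e0 eA]; apply/nbhs_ballP; exists e => // x' x'e; apply: eA.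
by split => //=; exact: ballxx.
Qed.

Lemma continuous_pairr (x : R) : continuous (fun y : R => (x, y)).
Proof.
move=> y A /nbhs_ballP[e e0 eA]; apply/nbhs_ballP; exists e => // y' y'e; apply: eA.
by split => //=; exact: ballxx.
Qed.

Lemma smooth_slice phi y : smooth phi -> smooth (fun x => phi (x, y)).
Proof. exact: (smooth_comp_affine (E := fun e => (e, 0)) (slice_affine y) (@continuous_pairl y)). Qed.

Lemma derive_slice phi y : 'D_(1 : R) (fun x => phi (x, y)) = (fun x => 'D_(1, 0) phi (x, y)).
Proof. exact: (derive_comp_affine (E := fun e => (e, 0)) (slice_affine y) phi). Qed.

Let swap_affine (h : R) (e x : R * R) :
  h *: unstable.swap e + unstable.swap x = unstable.swap (h *: e + x).
Proof. by []. Qed.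

Let swap_continuous : continuous (@unstable.swap R R).
Proof.
move=> [x y] A /nbhs_ballP[e e0 eA]; apply/nbhs_ballP; exists e => // -[x' y'] [? ?].
by apply: eA; split.
Qed.

Lemma smooth_swap phi : smooth phi -> smooth (fun z => phi (unstable.swap z)).
Proof. exact: (smooth_comp_affine (E := @unstable.swap R R) swap_affine swap_continuous). Qed.

Lemma derive_swap phi e :
  'D_e (fun z => phi (unstable.swap z)) = (fun z => 'D_(unstable.swap e) phi (unstable.swap z)).
Proof. exact: (derive_comp_affine (E := @unstable.swap R R) swap_affine phi). Qed.

End smooth_plane.

Lemma rectangle_measure (R : realType) (a b c d : R) : a < b -> c < d ->
  (@lebesgue_measure R \x @lebesgue_measure R)%E
    ((`]a, b[%classic : set (measurableTypeR R)) `*` (`]c, d[%classic : set (measurableTypeR R))) =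
  ((b - a) * (d - c))%:E.
Proof.
move=> ab cd; rewrite product_measure1E; [|exact: measurable_itv|exact: measurable_itv].
transitivity (@lebesgue_measure R `]a, b[ * @lebesgue_measure R `]c, d[)%E => //.
by rewrite !lebesgue_measure_itv/= !lte_fin ab cd.
Qed.

Section traces.
Context (R : realType).
Notation mu := (@lebesgue_measure R).
Notation mm := (mu \x mu)%E.
Notation Rm := (measurableTypeR R).
Variables (a b c d : R) (ab : a < b) (cd : c < d).
Notation X := (`]a, b[%classic : set Rm).
Notation Y := (`]c, d[%classic : set Rm).
Implicit Types w wx F G : R * R -> R.

Let mX : measurable X. Proof. exact: measurable_itv. Qed.
Let mY : measurable Y. Proof. exact: measurable_itv. Qed.
Let mXY : measurable (X `*` Y). Proof. exact: measurableX. Qed.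

(** [S] integrates from the side that carries the zero trace: the primitive from the left end, or
    minus the integral up to the right end. The three hypotheses are what the two cases share. *)
Variable S : (R -> R) -> R -> R.
Hypothesis S_integrable : forall k, rintegrable mu X k -> rintegrable mu X (S k).
Hypothesis S_sub : forall k l x, rintegrable mu X k -> rintegrable mu X l -> X x ->
  S (fun s => k s - l s) x = S k x - S l x.
Hypothesis S_le : forall k x, rintegrable mu X k -> X x ->
  `|S k x| <= \int[mu]_(s in X) `|k s|.

(** For approximants with [F = f + S G], the defect of [w] on a line is at most the error of [F],
    plus that of [G] under [S], plus the boundary value [f]. The integral of this bound over the
    lines is as small as desired. *)
Lemma trace_representation w wx :
  rintegrable mm (X `*` Y) w -> rintegrable mm (X `*` Y) wx ->
  (forall eps, 0 < eps -> exists F G (f : R -> R),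
     [/\ forall x y, X x -> Y y -> F (x, y) = f y + S (fun s => G (s, y)) x,
         rintegrable mm (X `*` Y) (fun z => F z - w z) /\
           \int[mm]_(z in X `*` Y) `|F z - w z| <= eps,
         rintegrable mm (X `*` Y) (fun z => G z - wx z) /\
           \int[mm]_(z in X `*` Y) `|G z - wx z| <= eps &
         rintegrable mu Y f /\ \int[mu]_(y in Y) `|f y| <= eps]) ->
  {ae mu, forall y, Y y -> {ae mu, forall x, X x -> w (x, y) = S (fun s => wx (s, y)) x}}.
Proof.
move=> wi wxi H.
have [wY _ _] := fubini_swapped mX mY wi.
have [wxY _ _] := fubini_swapped mX mY wxi.
pose q y := \int[mu]_(x in X) `|w (x, y) - S (fun s => wx (s, y)) x|.
have q0 : {ae mu, forall y, Y y -> q y <= 0}.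
  apply: L1_squeeze => // eps eps0.
  have ba0 : 0 < b - a by rewrite subr_gt0.
  (* The three errors enter with weights $1$, $b-a$ and $b-a$. *)
  pose e := eps / (1 + 2 * (b - a)).
  have de : 0 < 1 + 2 * (b - a) by lra.
  have e0 : 0 < e by rewrite divr_gt0.
  have [F [G [f [FE [Fi FI] [Gi GI] [fi fI]]]]] := H e e0.
  have [FY Fi' FE'] := fubini_swapped mX mY (rintegrable_norm Fi).
  have [GY Gi' GE'] := fubini_swapped mX mY (rintegrable_norm Gi).
  have [FY0 _ _] := fubini_swapped mX mY Fi.
  have [GY0 _ _] := fubini_swapped mX mY Gi.
  pose r y := \int[mu]_(x in X) `|F (x, y) - w (x, y)| + ((b - a) * `|f y| +
     (b - a) * \int[mu]_(x in X) `|G (x, y) - wx (x, y)|).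
  have r1 : rintegrable mu Y (fun y => (b - a) * `|f y|).
    by apply: rintegrableZ => //; exact: rintegrable_norm.
  have r2 : rintegrable mu Y (fun y => (b - a) * \int[mu]_(x in X) `|G (x, y) - wx (x, y)|).
    exact: rintegrableZ.
  exists r; split.
  - by apply: rintegrableD => //; exact: rintegrableD.
  - move=> y _; rewrite !addr_ge0// ?mulr_ge0 ?Rintegral_ge0// ltW//.
  - rewrite RintegralD//; last exact: rintegrableD.
    rewrite RintegralD// !RintegralZl//; last exact: rintegrable_norm.
    rewrite -FE' -GE'; apply: (@le_trans _ _ (e + ((b - a) * e + (b - a) * e))).
      by rewrite lerD// lerD// ler_wpM2l// ltW.
    by rewrite (_ : _ + _ = e * (1 + 2 * (b - a))); [rewrite /e divfK// gt_eqF|ring].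
  - have FG : {ae mu, forall y, Y y -> rintegrable mu X (fun x => F (x, y) - w (x, y)) /\
        rintegrable mu X (fun x => G (x, y) - wx (x, y))}.
      by apply: ae_imp2 FY0 GY0 => y h1 h2 Yy; split; [exact: h1|exact: h2].
    apply: ae_imp3 FG wY wxY => y FG' wY' wxY' Yy.
    have [i3 i4] := FG' Yy; have i1 := wY' Yy; have i2 := wxY' Yy.
    have iG : rintegrable mu X (fun x => G (x, y)).
      have := rintegrableD mX i4 i2; apply: (eq_rintegrable mX) => x _; by rewrite subrK.
    have iS := S_integrable i2.
    have iSG := S_integrable i4.
    have ic k : rintegrable mu X (cst k) by exact: AC_rintegrable (AC_cst a b k).
    rewrite /q /r; set g := \int[mu]_(x in X) `|G (x, y) - wx (x, y)|.
    have -> : (b - a) * `|f y| + (b - a) * g = \int[mu]_(x in X) (`|f y| + g).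
      rewrite Rintegral_cst//= lebesgue_measure_itv/= lte_fin ab /=; ring.
    rewrite -(RintegralD mX (rintegrable_norm i3) (ic _)).
    apply: le_Rintegral => //.
    + by apply: rintegrable_norm; exact: rintegrableB.
    + by apply: rintegrableD => //; exact: rintegrable_norm.
    + move=> x Xx.
      have -> : w (x, y) - S (fun s => wx (s, y)) x =
          - (F (x, y) - w (x, y)) + (f y + S (fun s => G (s, y) - wx (s, y)) x).
        by rewrite FE// (S_sub (k := fun s => G (s, y))) //; ring.
      apply: (le_trans (ler_normD _ _)); rewrite normrN lerD2l.
      by apply: (le_trans (ler_normD _ _)); rewrite lerD2l; exact: S_le.
apply: ae_imp3 q0 wY wxY => y q0 wY wxY Yy.
have i1 := wY Yy; have i2 := S_integrable (wxY Yy).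
have := @ae_eq0_of_Rintegral_norm _ _ _ mu _ mX _ (rintegrableB mX i1 i2) (q0 Yy).
by apply: ae_imp => x /[apply] /eqP; rewrite subr_eq0 => /eqP.
Qed.

Variable e : R.
Hypothesis S_smooth : forall (F : R -> R) x, smooth F -> X x -> F x = F e + S ('D_(1 : R) F) x.

(* [w] has x-derivative [wx] and vanishes on the side [x = e]. *)
Definition trace_approx (w wx : R * R -> R) := forall eps, 0 < eps -> exists phi : R * R -> R,
  [/\ smooth phi,
     sqintegrable mm (X `*` Y) (fun z => phi z - w z) /\
       \int[mm]_(z in X `*` Y) (phi z - w z) ^+ 2 <= eps,
     sqintegrable mm (X `*` Y) (fun z => 'D_(1, 0) phi z - wx z) /\
       \int[mm]_(z in X `*` Y) ('D_(1, 0) phi z - wx z) ^+ 2 <= eps &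
     sqintegrable mu Y (fun y => phi (e, y)) /\
       \int[mu]_(y in Y) phi (e, y) ^+ 2 <= eps].

Lemma trace_slices w wx : sqintegrable mm (X `*` Y) w -> sqintegrable mm (X `*` Y) wx ->
  trace_approx w wx ->
  {ae mu, forall y, Y y -> {ae mu, forall x, X x -> w (x, y) = S (fun s => wx (s, y)) x}}.
Proof.
move=> wi wxi H.
have mmE := rectangle_measure ab cd.
have muE : mu Y = (d - c)%:E by rewrite lebesgue_measure_itv/= lte_fin cd.
have mmle : (mm (X `*` Y) <= ((b - a) * (d - c))%:E)%E by rewrite mmE.
have mule : (mu Y <= (d - c)%:E)%E by rewrite muE.
have mmoo : (mm (X `*` Y) < +oo)%E by rewrite mmE ltry.
have muoo : (mu Y < +oo)%E by rewrite muE ltry.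
apply: trace_representation; [exact: sqintegrable_rintegrable|exact: sqintegrable_rintegrable|].
move=> eps eps0.
have m1 : 0 <= (b - a) * (d - c) by rewrite mulr_ge0// subr_ge0 ltW.
have m2 : 0 <= d - c by rewrite subr_ge0 ltW.
(* [m] is positive and dominates the measures of the rectangle and of the side, so that by
   Cauchy-Schwarz an integral of squares below [eps ^+ 2 / m] gives an $L^1$ error below [eps] on
   both. *)
pose m := (b - a) * (d - c) + (d - c) + 1.
have m0 : 0 < m by rewrite ltr_wpDl// addr_ge0.
have small k I (s : R) : 0 <= k -> k <= m -> 0 <= I -> s ^+ 2 <= k * I -> I <= eps ^+ 2 / m -> s <= eps.
  move=> k0 km I0 sI Ie; rewrite leNgt; apply/negP => es.
  have : eps ^+ 2 < s ^+ 2 by rewrite ltr_pXn2r// nnegrE ltW// (lt_trans eps0).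
  apply/negP; rewrite -leNgt; apply: (le_trans sI).
  apply: (@le_trans _ _ (m * (eps ^+ 2 / m))); first by apply: ler_pM.
  by rewrite mulrC divfK// gt_eqF.
have [phi [sphi [w1 w2] [x1 x2] [f1 f2]]] := H (eps ^+ 2 / m) (divr_gt0 (exprn_gt0 _ eps0) m0).
have sq0 (g : R * R -> R) : 0 <= \int[mm]_(z in X `*` Y) (g z) ^+ 2.
  by apply: Rintegral_ge0 => z _; exact: sqr_ge0.
exists phi, ('D_(1, 0) phi), (fun y => phi (e, y)); split.
- move=> x y Xx Yy; rewrite (S_smooth (smooth_slice y sphi) Xx); congr (_ + S _ _).
  exact: derive_slice.
- split; first exact: sqintegrable_rintegrable w1.
  have := Rintegral_norm_le mXY mmle w1.
  by move=> /small; apply=> //; rewrite /m; lra.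
- split; first exact: sqintegrable_rintegrable x1.
  have := Rintegral_norm_le mXY mmle x1.
  by move=> /small; apply=> //; rewrite /m; lra.
- split; first exact: sqintegrable_rintegrable f1.
  have := Rintegral_norm_le mY mule f1.
  move=> /small; apply=> //; first by rewrite /m; lra.
  by apply: Rintegral_ge0 => z _; exact: sqr_ge0.
Qed.

End traces.

Section trace_sides.
Context (R : realType).
Notation mu := (@lebesgue_measure R).
Notation mm := (mu \x mu)%E.
Notation Rm := (measurableTypeR R).
Variables (a b c d : R) (ab : a < b) (cd : c < d).
Notation X := (`]a, b[%classic : set Rm).
Notation Y := (`]c, d[%classic : set Rm).
Implicit Types w wx : R * R -> R.

Lemma trace_left w wx : sqintegrable mm (X `*` Y) w -> sqintegrable mm (X `*` Y) wx ->
  trace_approx a b c d a w wx ->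
  {ae mu, forall y, Y y -> {ae mu, forall x, X x -> w (x, y) = \int[mu]_(s in `]a, x[) wx (s, y)}}.
Proof.
apply: (trace_slices ab cd (S := fun k x => \int[mu]_(s in `]a, x[) k s)).
- by move=> k ki; exact: AC_rintegrable (AC_left ki).
- move=> k l x ki li; rewrite /= in_itv/= => /andP[ax xb].
  by rewrite RintegralB//; apply: rintegrable_sub (lexx a) (ltW xb) _.
- move=> k x ki; rewrite /= in_itv/= => /andP[ax xb].
  have := AC_bound (AC_left ki) (x := x); rewrite /= set_itvoo_eq0 Rintegral_set0 normr0 add0r.
  by apply; rewrite !ltW.
- move=> F x sF; rewrite /= in_itv/= => /andP[ax xb].
  by apply: (AC_smooth (ltW ab) sF).2; rewrite !ltW.
Qed.

Lemma trace_right w wx : sqintegrable mm (X `*` Y) w -> sqintegrable mm (X `*` Y) wx ->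
  trace_approx a b c d b w wx ->
  {ae mu, forall y, Y y -> {ae mu, forall x, X x -> w (x, y) = - \int[mu]_(s in `]x, b[) wx (s, y)}}.
Proof.
apply: (trace_slices ab cd (S := fun k x => - \int[mu]_(s in `]x, b[) k s)).
- by move=> k ki; exact: AC_rintegrable (AC_right ki).
- move=> k l x ki li; rewrite /= in_itv/= => /andP[ax xb].
  rewrite RintegralB//; [ring|exact: rintegrable_sub (ltW ax) (lexx b) _|].
  exact: rintegrable_sub (ltW ax) (lexx b) _.
- move=> k x ki; rewrite /= in_itv/= => /andP[ax xb]; rewrite normrN.
  have kx := rintegrable_sub (ltW ax) (lexx b) ki.
  apply: (@le_trans _ _ (\int[mu]_(s in `]x, b[) `|k s|)).
    by apply: le_normr_Rintegral => //; exact: measurable_itv.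
  rewrite (@Rintegral_oo_split _ a b x (fun s => `|k s|)) ?lerDr ?Rintegral_ge0 ?ltW//.
  exact: rintegrable_norm.
- move=> F x sF; rewrite /= in_itv/= => /andP[ax xb].
  have FAC := AC_smooth (ltW ab) sF.
  have xin : a <= x <= b by rewrite !ltW.
  rewrite (FAC.2 x xin) (FAC.2 b) ?lexx ?ltW// (Rintegral_oo_split xin FAC.1); ring.
Qed.

End trace_sides.

Section has_trace.
Context (R : realType).
Notation mu := (@lebesgue_measure R).
Notation mm := (mu \x mu)%E.
Notation Rm := (measurableTypeR R).
Variables (a b c d : R) (ab : a < b) (cd : c < d).
Notation X := (`]a, b[%classic : set Rm).
Notation Y := (`]c, d[%classic : set Rm).
Implicit Types w wx wy : R * R -> R.

Let mX : measurable X. Proof. exact: measurable_itv. Qed.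
Let mY : measurable Y. Proof. exact: measurable_itv. Qed.
Let mXY : measurable (X `*` Y). Proof. exact: measurableX. Qed.

(** The four convergences hold eventually within [eps], so that one smooth function serves for all
    of them. Continuity of [gamma] makes its values on the boundary measurable. *)
Lemma has_trace_approx (gamma : R -> R * R) (I : set R) w : measurable (I : set Rm) ->
  continuous gamma -> has_trace (X `*` Y) gamma I w (cst 0) ->
  exists wx wy, [/\ [/\ sqintegrable mm (X `*` Y) w, sqintegrable mm (X `*` Y) wx &
      sqintegrable mm (X `*` Y) wy], weak_dxy (X `*` Y) 1 0 w wx, weak_dxy (X `*` Y) 0 1 w wy &
    forall eps, 0 < eps -> exists phi : R * R -> R,
  [/\ smooth phi,
     sqintegrable mm (X `*` Y) (fun z => phi z - w z) /\
       \int[mm]_(z in X `*` Y) (phi z - w z) ^+ 2 <= eps,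
     sqintegrable mm (X `*` Y) (fun z => 'D_(1, 0) phi z - wx z) /\
       \int[mm]_(z in X `*` Y) ('D_(1, 0) phi z - wx z) ^+ 2 <= eps,
     sqintegrable mm (X `*` Y) (fun z => 'D_(0, 1) phi z - wy z) /\
       \int[mm]_(z in X `*` Y) ('D_(0, 1) phi z - wy z) ^+ 2 <= eps &
     sqintegrable mu I (fun y => phi (gamma y)) /\
       \int[mu]_(y in I) phi (gamma y) ^+ 2 <= eps]].
Proof.
move=> mI cg [wx [wy [phi [[w2 wx2 wy2] [dx dy] sphi [c0 cx cy] ct]]]].
have q0 := L2fun_sqintegrable w2; have qx := L2fun_sqintegrable wx2.
have qy := L2fun_sqintegrable wy2.
exists wx, wy; split => // eps eps0.
have mc (g : R * R -> R) : continuous g -> measurable_fun (X `*` Y : set (Rm * Rm)) g.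
  by move=> /continuous_measurable_plane; exact: measurable_funTS.
have mB (g h : R * R -> R) : continuous g -> sqintegrable mm (X `*` Y) h ->
    measurable_fun (X `*` Y : set (Rm * Rm)) (fun z => g z - h z).
  by move=> cgg [mh _]; apply: measurable_funB => //; exact: mc.
have nearn (P : nat -> Prop) : (forall n, P n) -> \forall n \near \oo, P n by exact: nearW.
have n0 := L2norm_cvg0 (FF := eventually_filter) mXY (nearn _ (fun n => mB _ _ (smooth_continuous (sphi n)) q0)) c0 eps0.
have nx := L2norm_cvg0 (FF := eventually_filter) mXY
  (nearn _ (fun n => mB _ _ (smooth_continuous (smooth_derive ((1, 0) : R * R) (sphi n))) qx)) cx eps0.
have ny := L2norm_cvg0 (FF := eventually_filter) mXY
  (nearn _ (fun n => mB _ _ (smooth_continuous (smooth_derive ((0, 1) : R * R) (sphi n))) qy)) cy eps0.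
have mt n : measurable_fun (I : set Rm) (fun s => phi n (gamma s) - cst 0 s).
  apply: measurable_funB => //; apply: measurable_funTS; apply: continuous_measurable_fun.
  by move=> s; apply: continuous_comp; [exact: cg|exact: smooth_continuous].
have nt := L2norm_cvg0 (FF := eventually_filter) mI (nearn _ mt) ct eps0.
have [n [h0 [hx [hy ht]]]] : exists n,
   (sqintegrable mm (X `*` Y) (fun z => phi n z - w z) /\
     \int[mm]_(z in X `*` Y) (phi n z - w z) ^+ 2 <= eps) /\
   ((sqintegrable mm (X `*` Y) (fun z => dxy 1 0 (phi n) z - wx z) /\
     \int[mm]_(z in X `*` Y) (dxy 1 0 (phi n) z - wx z) ^+ 2 <= eps) /\
   ((sqintegrable mm (X `*` Y) (fun z => dxy 0 1 (phi n) z - wy z) /\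
     \int[mm]_(z in X `*` Y) (dxy 0 1 (phi n) z - wy z) ^+ 2 <= eps) /\
   (sqintegrable mu I (fun s => phi n (gamma s) - cst 0 s) /\
     \int[mu]_(s in I) (phi n (gamma s) - cst 0 s) ^+ 2 <= eps))).
  have I2 (P Q : nat -> Prop) : (\forall n \near \oo, P n) -> (\forall n \near \oo, Q n) ->
      \forall n \near \oo, P n /\ Q n by move=> hP hQ; apply: filterI.
  have [n _ /(_ n (leqnn n))[h1 [h2 [h3 h4]]]] := I2 _ _ n0 (I2 _ _ nx (I2 _ _ ny nt)).
  by exists n.
exists (phi n); split => //.
move: ht => [ht1 ht2]; split.
  by apply: eq_sqintegrable ht1 => // s _; rewrite subr0.
by apply: le_trans ht2; under [X in _ <= X]eq_Rintegral do rewrite subr0.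
Qed.

Lemma sqintegrable_congr (f g g' : R * R -> R) eps : measurable_fun (X `*` Y : set (Rm * Rm)) f ->
  sqintegrable mm (X `*` Y) g' ->
  {ae mm, forall z, (X `*` Y) z -> g z = g' z} ->
  sqintegrable mm (X `*` Y) (fun z => f z - g z) /\
    \int[mm]_(z in X `*` Y) (f z - g z) ^+ 2 <= eps ->
  sqintegrable mm (X `*` Y) (fun z => f z - g' z) /\
    \int[mm]_(z in X `*` Y) (f z - g' z) ^+ 2 <= eps.
Proof.
move=> mf [mg' _] gg' [[m2 i2] le2].
have m' : measurable_fun (X `*` Y : set (Rm * Rm)) (fun z => f z - g' z).
  exact: measurable_funB mf mg'.
have ms : measurable_fun (X `*` Y : set (Rm * Rm)) (fun z => (f z - g' z) ^+ 2).
  exact: measurable_funX.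
have E : {ae mm, forall z, (X `*` Y) z -> (f z - g z) ^+ 2 = (f z - g' z) ^+ 2}.
  by apply: ae_imp gg' => z gz Dz; rewrite gz.
split; first by split => //; exact: (ae_eq_rintegrable mXY ms E).
by rewrite -(ae_eq_Rintegral mXY (rintegrable_measurable i2) ms E).
Qed.

Lemma sqintegrable_swap (f : R * R -> R) : sqintegrable mm (X `*` Y) f ->
  sqintegrable mm (Y `*` X) (fun z => f (unstable.swap z)) /\
  \int[mm]_(z in Y `*` X) f (unstable.swap z) ^+ 2 = \int[mm]_(z in X `*` Y) f z ^+ 2.
Proof.
move=> [mf fi]; have [i2 E] := rintegrable_swap mX mY fi.
by split => //; split => //; exact: measurable_fun_swap.
Qed.

Let mc (g : R * R -> R) : smooth g -> measurable_fun (X `*` Y : set (Rm * Rm)) g.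
Proof. by move=> /smooth_continuous/continuous_measurable_plane; exact: measurable_funTS. Qed.

Let mcx (g : R * R -> R) e : smooth g -> measurable_fun (X `*` Y : set (Rm * Rm)) ('D_e g).
Proof. by move=> sg; apply: mc; exact: smooth_derive. Qed.

Let D_oo : (mm (X `*` Y) < +oo)%E. Proof. by rewrite rectangle_measure// ltry. Qed.

Lemma has_trace_vertical e w wx : has_trace (X `*` Y) (fun y => (e, y)) Y w (cst 0) ->
  sqintegrable mm (X `*` Y) wx -> xpair a b c d w wx ->
  trace_approx a b c d e w wx.
Proof.
move=> ht wxi dx.
have [wx' [wy [[w2 wx2 _] dx' _ H]]] := has_trace_approx mY (@continuous_pairr _ e) ht.
(* [w] is its own weak derivative of order zero. This turns the derivative supplied by the trace
   into an [xpair], which uniqueness then identifies with [wx]. *)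
have d0 : weak_dxy (X `*` Y) 0 0 w w.
  have [lw _ _] := dx'; split => // phi _.
  by apply: eq_integral => z _; rewrite expr0 mul1r.
have E := xpair_unique (sqintegrable_rintegrable mXY D_oo wx2)
  (sqintegrable_rintegrable mXY D_oo wxi) (weak_xpair d0 dx') dx.
move=> eps /H[phi [sphi h0 hx _ hy]]; exists phi; split => //.
by apply: sqintegrable_congr hx => //; exact: mcx.
Qed.

(** The exchange of coordinates makes the side vertical, and the roles of the two first derivatives
    are interchanged. *)
Lemma has_trace_horizontal e w wy : has_trace (X `*` Y) (fun x => (x, e)) X w (cst 0) ->
  sqintegrable mm (X `*` Y) wy -> weak_dxy (X `*` Y) 0 1 w wy ->
  trace_approx c d a b e (fun z => w (unstable.swap z)) (fun z => wy (unstable.swap z)).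
Proof.
move=> ht wyi dy.
have [wx [wy' [[w2 _ wy2] _ dy' H]]] := has_trace_approx mX (@continuous_pairl _ e) ht.
have E := weak_unique wy2.1 wyi.1 dy' dy.
move=> eps /H[phi [sphi h0 _ hy ht']].
have h1 := sqintegrable_congr (mcx (0, 1) sphi) wyi E hy.
exists (fun z => phi (unstable.swap z)); split; last exact: ht'.
- exact: smooth_swap.
- by have [i1 i2] := sqintegrable_swap h0.1; split => //; rewrite i2; exact: h0.2.
- have [i1 i2] := sqintegrable_swap h1.1.
  have Ez z : 'D_(0, 1) phi (unstable.swap z) = 'D_(1, 0) (fun z : R * R => phi (unstable.swap z)) z.
    exact: (esym (congr1 (fun f : R * R -> R => f z) (derive_swap phi ((1, 0) : R * R)))).
  split; first by apply: (eq_sqintegrable (measurableX mY mX) _ i1) => z _; congr (_ - _); exact: Ez.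
  apply: le_trans h1.2; rewrite -i2 le_eqVlt; apply/orP; left; apply/eqP.
  by apply: eq_Rintegral => z _; congr ((_ - _) ^+ 2); exact/esym/Ez.
Qed.

Lemma has_trace_left w wx : has_trace (X `*` Y) (fun y => (a, y)) Y w (cst 0) ->
  sqintegrable mm (X `*` Y) w ->
  sqintegrable mm (X `*` Y) wx -> xpair a b c d w wx ->
  {ae mu, forall y, Y y -> {ae mu, forall x, X x -> w (x, y) = \int[mu]_(s in `]a, x[) wx (s, y)}}.
Proof. by move=> ht wi wxi dx; apply: trace_left => //; exact: has_trace_vertical. Qed.

Lemma has_trace_right w wx : has_trace (X `*` Y) (fun y => (b, y)) Y w (cst 0) ->
  sqintegrable mm (X `*` Y) w ->
  sqintegrable mm (X `*` Y) wx -> xpair a b c d w wx ->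
  {ae mu, forall y, Y y -> {ae mu, forall x, X x -> w (x, y) = - \int[mu]_(s in `]x, b[) wx (s, y)}}.
Proof. by move=> ht wi wxi dx; apply: trace_right => //; exact: has_trace_vertical. Qed.

Lemma has_trace_bottom w wy : has_trace (X `*` Y) (fun x => (x, c)) X w (cst 0) ->
  sqintegrable mm (X `*` Y) w ->
  sqintegrable mm (X `*` Y) wy -> weak_dxy (X `*` Y) 0 1 w wy ->
  {ae mu, forall x, X x -> {ae mu, forall y, Y y -> w (x, y) = \int[mu]_(s in `]c, y[) wy (x, s)}}.
Proof.
move=> ht wi wyi dy.
apply: (trace_left cd ab (sqintegrable_swap wi).1 (sqintegrable_swap wyi).1).
exact: has_trace_horizontal.
Qed.

Lemma has_trace_top w wy : has_trace (X `*` Y) (fun x => (x, d)) X w (cst 0) ->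
  sqintegrable mm (X `*` Y) w ->
  sqintegrable mm (X `*` Y) wy -> weak_dxy (X `*` Y) 0 1 w wy ->
  {ae mu, forall x, X x -> {ae mu, forall y, Y y -> w (x, y) = - \int[mu]_(s in `]y, d[) wy (x, s)}}.
Proof.
move=> ht wi wyi dy.
apply: (trace_right cd ab (sqintegrable_swap wi).1 (sqintegrable_swap wyi).1).
exact: has_trace_horizontal.
Qed.

End has_trace.

(** * The energy inequality at a fixed time *)

Lemma Rintegral_cst0 d (T : measurableType d) (R : realType) (mu : {measure set T -> \bar R})
  (D : set T) : \int[mu]_(x in D) 0 = 0 :> R.
Proof. by rewrite /Rintegral integral0. Qed.

(* [n], [x], [y], [c] stand for the integrals of v^2, v_x^2, v_y^2 and v^3. *)
Lemma energy_inequality_arith (R : realFieldType) (A2 P Q n x y c : R) : 0 < A2 -> 0 < P -> 0 < Q ->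
  3 * P + Q - 1 = 2 * A2 -> 0 <= n -> P * n <= x -> Q * n <= y ->
  n < 9 * A2 ^+ 2 / (16 * (P + Q)) -> c ^+ 4 <= 16 * n ^+ 4 * (x * y) ->
  2 / 3 * c <= A2 * n + 3 * (x - P * n) + (y - Q * n).
Proof.
move=> A0 P0 Q0 PQ n0 Px Qy nthr c4.
set Z := _ + _ + _.
pose al := x - P * n; pose be := y - Q * n.
have al0 : 0 <= al by rewrite subr_ge0.
have be0 : 0 <= be by rewrite subr_ge0.
have PQ0 : 0 < P + Q by rewrite addr_gt0.
have nPQ : 16 * n * (P + Q) < 9 * A2 ^+ 2.
  by move: nthr; rewrite ltr_pdivlMr ?mulr_gt0//; lra.
have APQ : A2 <= 3 / 2 * (P + Q) by lra.
have nA : 4 / 9 * n <= A2.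
  rewrite -(ler_pM2r PQ0); apply: (@le_trans _ _ (A2 ^+ 2 / 4)); first by lra.
  by rewrite expr2; nra.
have An0 : 0 <= A2 * n by apply: mulr_ge0 => //; exact: ltW.
have Z0 : 0 <= A2 * n + (al + be) by exact: addr_ge0 An0 (addr_ge0 al0 be0).
have ZZ : A2 * n + (al + be) <= Z by rewrite /Z -/al -/be; lra.
(* In the expanded square, $A_2^2n^2$ absorbs the part $(P+Q)n$ of $x+y$ by the bound on $n$, and
   the mixed term absorbs the excess [al + be] by [nA]. *)
have Z2 : 8 / 9 * n ^+ 2 * (x + y) <= Z ^+ 2.
  apply: (@le_trans _ _ ((A2 * n + (al + be)) ^+ 2)); last first.
    by rewrite lerXn2r ?nnegrE// (le_trans Z0).
  have -> : x + y = (P + Q) * n + (al + be) by rewrite /al /be; ring.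
  have h1 : 8 / 9 * n ^+ 2 * ((P + Q) * n) <= A2 ^+ 2 * n ^+ 2.
    have n20 := sqr_ge0 n.
    have -> : 8 / 9 * n ^+ 2 * ((P + Q) * n) = (8 / 9 * (n * (P + Q))) * n ^+ 2 by ring.
    by apply: ler_wpM2r => //; have := sqr_ge0 A2; lra.
  have h2 : 8 / 9 * n ^+ 2 * (al + be) <= 2 * A2 * n * (al + be).
    have -> : 8 / 9 * n ^+ 2 * (al + be) = (4 / 9 * n) * (2 * n * (al + be)) by ring.
    have -> : 2 * A2 * n * (al + be) = A2 * (2 * n * (al + be)) by ring.
    by rewrite ler_wpM2r// !mulr_ge0// addr_ge0.
  have h3 := sqr_ge0 (al + be).
  rewrite (_ : (A2 * n + (al + be)) ^+ 2 =
    A2 ^+ 2 * n ^+ 2 + 2 * A2 * n * (al + be) + (al + be) ^+ 2); last by ring.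
  rewrite mulrDr.
  by apply: (@le_trans _ _ (A2 ^+ 2 * n ^+ 2 + 2 * A2 * n * (al + be))); [exact: lerD|rewrite lerDl].
have Zp : 0 <= Z by exact: le_trans Z0 ZZ.
rewrite leNgt; apply/negP => cZ.
have : Z ^+ 4 < (2 / 3 * c) ^+ 4 by rewrite ltr_pXn2r// nnegrE// ltW// (le_lt_trans Zp).
apply/negP; rewrite -leNgt.
have -> : (2 / 3 * c) ^+ 4 = 16 / 81 * c ^+ 4 by field.
apply: (@le_trans _ _ (16 / 81 * (16 * n ^+ 4 * (x * y)))); first by rewrite ler_wpM2l// divr_ge0.
apply: (@le_trans _ _ ((8 / 9 * n ^+ 2 * (x + y)) ^+ 2)); last first.
  rewrite (_ : Z ^+ 4 = (Z ^+ 2) ^+ 2); last by ring.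
  rewrite lerXn2r ?nnegrE ?sqr_ge0// !mulr_ge0 ?sqr_ge0//.
  have : 0 <= P * n by rewrite mulr_ge0// ltW.
  have : 0 <= Q * n by rewrite mulr_ge0// ltW.
  by lra.
have -> : 16 / 81 * (16 * n ^+ 4 * (x * y)) = 64 / 81 * n ^+ 4 * (4 * (x * y)) by field.
have -> : (8 / 9 * n ^+ 2 * (x + y)) ^+ 2 = 64 / 81 * n ^+ 4 * (x + y) ^+ 2 by field.
apply: ler_wpM2l; last by have := sqr_ge0 (x - y); rewrite sqrrB sqrrD; lra.
by rewrite mulr_ge0// exprn_ge0.
Qed.

(** [t1] to [t4] are the integrals of $(1+x)v$ against $v_x$, $vv_x$, $v_{xxx}$ and $v_{xyy}$; [q]
    is two thirds of the cubic integral, and [y] is the decay rate times the weighted mass. *)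
Lemma energy_combination (R : realFieldType) (a b n q t1 t2 t3 t4 A2 P Q y : R) :
  3 * a - n - q <= 2 * t1 + 2 * t2 + 2 * t3 -> b <= 2 * t4 ->
  q <= A2 * n + 3 * (a - P * n) + (b - Q * n) -> y <= A2 * n -> 3 * P + Q - 1 = 2 * A2 ->
  2 * - (t1 + t2 + t3 + t4) <= - y.
Proof.
move=> h1 h2 h3 h4 E; have : (3 * P + Q - 1) * n = 2 * A2 * n by rewrite E.
by rewrite !mulrDl => h; lra.
Qed.

Section fixed_time.
Context (R : realType).
Notation mu := (@lebesgue_measure R).
Notation mm := (mu \x mu)%E.
Notation Rm := (measurableTypeR R).
Variables (L B : R) (L0 : 0 < L) (B0 : 0 < B).
Notation X := (`]0, L[%classic : set Rm).
Notation Y := (`]- B, B[%classic : set Rm).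
Notation D := (X `*` Y).
Implicit Types v : R * R -> R.

Let mX : measurable X. Proof. exact: measurable_itv. Qed.
Let mY : measurable Y. Proof. exact: measurable_itv. Qed.
Let mD : measurable D. Proof. exact: measurableX. Qed.
Let BB : - B < B. Proof. by rewrite gtrN. Qed.
Let weight (z : R * R) : R := 1 + z.1.

Lemma weight_bound z : D z -> 1 <= weight z <= 1 + L.
Proof. by rewrite /= !in_itv/= => -[/andP[z0 zL] _]; rewrite /weight lerDl lerD2l !ltW. Qed.

Lemma measurable_weight : measurable_fun (D : set (Rm * Rm)) weight.
Proof.
by rewrite /weight; apply: measurable_funD => //; apply: measurable_funTS; exact: measurable_fst.
Qed.

Lemma sqintegrable_weight v : sqintegrable mm D v -> sqintegrable mm D (fun z => weight z * v z).
Proof.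
apply: (sqintegrable_bounded mD (M := 1 + L) measurable_weight) => z /weight_bound/andP[w1 wL].
by rewrite ger0_norm// (le_trans _ w1).
Qed.

Lemma rintegrable_weight v : rintegrable mm D v -> rintegrable mm D (fun z => weight z * v z).
Proof.
apply: (rintegrable_bounded mD (M := 1 + L) measurable_weight) => z /weight_bound/andP[w1 wL].
by rewrite ger0_norm// (le_trans _ w1).
Qed.

Variables v vx vy vxy vxxx vxyy : R * R -> R.

(** [V], [P], [Q] stand for $v$, $v_x$, $v_{xx}$ along a horizontal line. The last is not tied to a
    function on the rectangle, since $v_{xx}$ is integrated by parts only inside the line. *)
Definition x_slices := {ae mu, forall y, Y y -> exists V P Q,
  [/\ [/\ AC 0 L V P, AC 0 L P Q & AC 0 L Q (fun x => vxxx (x, y))],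
     V 0 = 0, V L = 0, P L = 0 &
     {ae mu, forall x, X x -> v (x, y) = V x} /\
     {ae mu, forall x, X x -> vx (x, y) = P x}]}.

(** [S] stands for $v_{xy}$ on a vertical line. No end values are asked of it, because it is
    multiplied by [V], which vanishes at both ends. *)
Definition y_slices := {ae mu, forall x, X x -> exists V S,
  [/\ AC (- B) B V (fun y => vy (x, y)), AC (- B) B S (fun y => vxyy (x, y)),
     V (- B) = 0, V B = 0 &
     {ae mu, forall y, Y y -> v (x, y) = V y} /\
     {ae mu, forall y, Y y -> vxy (x, y) = S y}]}.

Definition vy_slices := {ae mu, forall y, Y y -> exists P,
  [/\ AC 0 L P (fun x => vxy (x, y)), P L = 0 &
     {ae mu, forall x, X x -> vy (x, y) = P x}]}.

Hypotheses (iv : sqintegrable mm D v) (ivx : sqintegrable mm D vx) (ivy : sqintegrable mm D vy)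
  (ivxy : sqintegrable mm D vxy) (ivxxx : sqintegrable mm D vxxx) (ivxyy : sqintegrable mm D vxyy).
Hypotheses (Hx : x_slices) (Hy : y_slices) (Hvy : vy_slices).

Let N := \int[mm]_(z in D) v z ^+ 2.
Let a := \int[mm]_(z in D) vx z ^+ 2.
Let b := \int[mm]_(z in D) vy z ^+ 2.
Let F y := 2 * \int[mu]_(x in X) `|v (x, y) * vx (x, y)|.
Let G x := 2 * \int[mu]_(y in Y) `|v (x, y) * vy (x, y)|.

Lemma ae_swapped (P : R * R -> bool) : measurable_fun (D : set (Rm * Rm)) P ->
  {ae mu, forall y, Y y -> {ae mu, forall x, X x -> P (x, y)}} ->
  {ae mm, forall z, D z -> P z}.
Proof.
move=> mP H.
have mP' : measurable_fun (Y `*` X : set (Rm * Rm)) (fun z => P (unstable.swap z)).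
  apply: (measurable_comp (F := (D : set (Rm * Rm)))) => //.
    by move=> _ [z [z1 z2] <-].
  by apply: measurable_funTS; exact: measurable_swap.
have /ae_swap := ae_of_slices mY mX mP' H.
by apply: ae_imp => -[x y] /= h [xX yY]; apply: h.
Qed.

Let msx (f : R * R -> R) y : measurable_fun (D : set (Rm * Rm)) f -> Y y -> measurable_fun X (fun x => f (x, y)).
Proof. by move=> mf Yy; exact: (measurable_slice mY mX (measurable_fun_swap mX mY mf) Yy). Qed.

Let msy (f : R * R -> R) x : measurable_fun (D : set (Rm * Rm)) f -> X x -> measurable_fun Y (fun y => f (x, y)).
Proof. exact: measurable_slice. Qed.

Let le_slices_x f g : rintegrable mm D f -> rintegrable mm D g ->
  {ae mu, forall y, Y y -> \int[mu]_(x in X) f (x, y) <= \int[mu]_(x in X) g (x, y)} ->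
  \int[mm]_(z in D) f z <= \int[mm]_(z in D) g z.
Proof.
move=> fi gi H; have [_ jf ->] := fubini_swapped mX mY fi.
by have [_ jg ->] := fubini_swapped mX mY gi; exact: ae_le_Rintegral.
Qed.

Let le_slices_y f g : rintegrable mm D f -> rintegrable mm D g ->
  {ae mu, forall x, X x -> \int[mu]_(y in Y) f (x, y) <= \int[mu]_(y in Y) g (x, y)} ->
  \int[mm]_(z in D) f z <= \int[mm]_(z in D) g z.
Proof.
move=> fi gi H; have [_ jf ->] := fubini_slices mX mY fi.
by have [_ jg ->] := fubini_slices mX mY gi; exact: ae_le_Rintegral.
Qed.

Let poincare_x : 8 / L ^+ 2 * N <= a.
Proof.
rewrite /N /a -RintegralZl//; last exact: iv.2.
apply: le_slices_x; [exact: rintegrableZ iv.2|exact: ivx.2|].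
have [jv _ _] := fubini_swapped mX mY iv.2.
have [jvx _ _] := fubini_swapped mX mY ivx.2.
apply: ae_imp3 Hx jv jvx => y Hxy jv jvx Yy.
have [V [P [Q [[VP PQ _] V0 VL PL [vV vxP]]]]] := Hxy Yy.
rewrite RintegralZl//; last exact: jv.
have m1 := msx iv.1 Yy; have m2 := msx ivx.1 Yy.
have mV := AC_measurable VP; have mP := AC_measurable PQ.
have Evx : {ae mu, forall x, X x -> vx (x, y) ^+ 2 = P x ^+ 2}.
  by apply: ae_imp vxP => x E Xx; rewrite E.
have -> : \int[mu]_(x in X) v (x, y) ^+ 2 = \int[mu]_(x in X) V x ^+ 2.
  apply: (ae_eq_Rintegral mX) => //; [exact: measurable_funX|exact: measurable_funX|].
  by apply: ae_imp vV => x E Xx; rewrite E.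
have mvx2 : measurable_fun X (fun x => vx (x, y) ^+ 2) by exact: measurable_funX.
have mP2 : measurable_fun X (fun x => P x ^+ 2) by exact: measurable_funX.
rewrite (ae_eq_Rintegral mX mvx2 mP2 Evx).
have sqP : sqintegrable mu X P by split => //; exact: (ae_eq_rintegrable mX mP2 Evx (jvx Yy)).
by have := poincare_slice (ltW L0) VP V0 VL sqP; rewrite subr0.
Qed.

Let poincare_y : 2 / B ^+ 2 * N <= b.
Proof.
rewrite /N /b -RintegralZl//; last exact: iv.2.
apply: le_slices_y; [exact: rintegrableZ iv.2|exact: ivy.2|].
have [jv _ _] := fubini_slices mX mY iv.2.
have [jvy _ _] := fubini_slices mX mY ivy.2.
apply: ae_imp3 Hy jv jvy => x Hyx jv jvy Xx.
have [V [S [VP _ V0 VL [vV _]]]] := Hyx Xx.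
rewrite RintegralZl//; last exact: jv.
have m1 := msy iv.1 Xx; have mV := AC_measurable VP.
have -> : \int[mu]_(y in Y) v (x, y) ^+ 2 = \int[mu]_(y in Y) V y ^+ 2.
  apply: (ae_eq_Rintegral mY) => //; [exact: measurable_funX|exact: measurable_funX|].
  by apply: ae_imp vV => y E Yy; rewrite E.
have sqP : sqintegrable mu Y (fun y => vy (x, y)) by split; [exact: msy ivy.1 Xx|exact: jvy].
(* The interval has length $2B$, and $8/(2B)^2=2/B^2$. *)
have := poincare_slice (ltW BB) VP V0 VL sqP.
by rewrite (_ : (B - - B) ^+ 2 = 4 * B ^+ 2); [rewrite (_ : 8 / _ = 2 / B ^+ 2)//; field; rewrite gt_eqF|ring].
Qed.

Let sup_x : {ae mm, forall z, D z -> v z ^+ 2 <= F z.2}.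
Proof.
have ivv := sqintegrable_mul mD iv ivx.
have [_ jF _] := fubini_swapped mX mY (rintegrable_norm ivv).
apply: ae_swapped.
  apply: measurable_fun_ler; first by apply: measurable_funX; exact: iv.1.
  have mF : measurable_fun Y F := rintegrable_measurable (rintegrableZ mY 2 jF).
  exact: measurable_fun_snd mF.
apply: ae_imp Hx => y Hxy Yy.
have [V [P [Q [[VP PQ _] V0 VL PL [vV vxP]]]]] := Hxy Yy.
have E : F y = 2 * \int[mu]_(x in X) `|V x * P x|.
  rewrite /F; congr (_ * _); apply: (ae_eq_Rintegral mX).
  - apply: measurableT_comp => //; apply: measurable_funM; [exact: msx iv.1 Yy|exact: msx ivx.1 Yy].
  - apply: measurableT_comp => //; apply: measurable_funM; [exact: AC_measurable VP|exact: AC_measurable PQ].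
  - by apply: ae_imp2 vV vxP => x E1 E2 Xx; rewrite E1// E2.
apply: ae_imp vV => x Ex Xx; rewrite Ex// E; apply: sup_slice => //.
by move: Xx; rewrite /= in_itv/= => /andP[? ?]; rewrite !ltW.
Qed.

Let sup_y : {ae mm, forall z, D z -> v z ^+ 2 <= G z.1}.
Proof.
have ivv := sqintegrable_mul mD iv ivy.
have [_ jG _] := fubini_slices mX mY (rintegrable_norm ivv).
apply: (ae_of_slices mX mY (P := fun z => v z ^+ 2 <= G z.1)).
  apply: measurable_fun_ler; first by apply: measurable_funX; exact: iv.1.
  have mG : measurable_fun X G := rintegrable_measurable (rintegrableZ mX 2 jG).
  exact: measurable_fun_fst mG.
apply: ae_imp Hy => x Hyx Xx.
have [V [S [VP _ V0 VL [vV _]]]] := Hyx Xx.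
have E : G x = 2 * \int[mu]_(y in Y) `|V y * vy (x, y)|.
  rewrite /G; congr (_ * _); apply: (ae_eq_Rintegral mY).
  - apply: measurableT_comp => //; apply: measurable_funM; [exact: msy iv.1 Xx|exact: msy ivy.1 Xx].
  - apply: measurableT_comp => //; apply: measurable_funM; [exact: AC_measurable VP|exact: msy ivy.1 Xx].
  - by apply: ae_imp vV => y E1 Yy; rewrite E1.
apply: ae_imp vV => y Ey Yy; rewrite Ey// E; apply: sup_slice => //.
by move: Yy; rewrite /= in_itv/= => /andP[? ?]; rewrite !ltW.
Qed.

Let normed_product f g : sqintegrable mm D f -> sqintegrable mm D g ->
  (2 * \int[mm]_(z in D) `|f z * g z|) ^+ 2 <=
  4 * (\int[mm]_(z in D) f z ^+ 2) * (\int[mm]_(z in D) g z ^+ 2).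
Proof.
move=> fi gi.
have := cauchy_schwarz_Rintegral mD (sqintegrable_norm mD fi) (sqintegrable_norm mD gi).
under eq_Rintegral do rewrite -normrM.
under [X in _ <= X * _ -> _]eq_Rintegral do rewrite real_normK ?num_real//.
under [X in _ <= _ * X -> _]eq_Rintegral do rewrite real_normK ?num_real//.
by move=> H; rewrite exprMn -mulrA (_ : 2 ^+ 2 = 4); [rewrite ler_wpM2l|ring].
Qed.

(** Since $v^2$ is bounded by a function of $y$ and by a function of $x$, $v^4$ is bounded by their
    product, whose integral factors. Cauchy-Schwarz bounds the squares of the two factors by $4Na$
    and $4Nb$. The squared form avoids roots. *)
Let ladyzhenskaya : sqintegrable mm D (fun z => v z ^+ 2) /\
  (\int[mm]_(z in D) v z ^+ 4) ^+ 2 <= 16 * N ^+ 2 * (a * b).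
Proof.
have ivvx := sqintegrable_mul mD iv ivx; have ivvy := sqintegrable_mul mD iv ivy.
have [_ jF EF] := fubini_swapped mX mY (rintegrable_norm ivvx).
have [_ jG EG] := fubini_slices mX mY (rintegrable_norm ivvy).
have jF2 : rintegrable mu Y F by exact: rintegrableZ.
have jG2 : rintegrable mu X G by exact: rintegrableZ.
have [iGF EGF] := rintegrable_tensor mX mY jG2 jF2.
have F0 y : 0 <= F y by rewrite mulr_ge0// Rintegral_ge0.
have G0 x : 0 <= G x by rewrite mulr_ge0// Rintegral_ge0.
have mv4 : measurable_fun (D : set (Rm * Rm)) (fun z => v z ^+ 4) by apply: measurable_funX; exact: iv.1.
have E4 z : v z ^+ 4 = v z ^+ 2 * v z ^+ 2 by ring.
have vGF : {ae mm, forall z, D z -> v z ^+ 4 <= G z.1 * F z.2}.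
  by apply: ae_imp2 sup_x sup_y => z h1 h2 Dz; rewrite E4; apply: ler_pM; rewrite ?sqr_ge0 ?h1 ?h2.
have i4 : rintegrable mm D (fun z => v z ^+ 4).
  apply: (rintegrable_ae_le mD mv4 _ iGF); apply: ae_imp vGF => z vGF Dz.
  have v0 : 0 <= v z ^+ 4 by rewrite E4; apply: mulr_ge0; exact: sqr_ge0.
  by rewrite ger0_norm//; exact: vGF.
split.
  split; first by apply: measurable_funX; exact: iv.1.
  by apply: eq_rintegrable i4 => // z _; ring.
have le4 : \int[mm]_(z in D) v z ^+ 4 <= (2 * \int[mm]_(z in D) `|v z * vy z|) *
    (2 * \int[mm]_(z in D) `|v z * vx z|).
  apply: (@le_trans _ _ (\int[mm]_(z in D) (G z.1 * F z.2))).
    exact: (ae_le_Rintegral mD i4 iGF vGF).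
  rewrite EGF le_eqVlt; apply/orP; left; apply/eqP; congr (_ * _).
    by rewrite EG RintegralZl.
  by rewrite EF RintegralZl.
have I0 : 0 <= \int[mm]_(z in D) v z ^+ 4.
  apply: Rintegral_ge0 => z _.
  by rewrite (_ : v z ^+ 4 = (v z ^+ 2) ^+ 2); [exact: sqr_ge0|ring].
apply: (@le_trans _ _ ((4 * N * b) * (4 * N * a))); last by rewrite le_eqVlt; apply/orP; left; apply/eqP; ring.
apply: (@le_trans _ _ (((2 * \int[mm]_(z in D) `|v z * vy z|) *
    (2 * \int[mm]_(z in D) `|v z * vx z|)) ^+ 2)); first by rewrite lerXn2r ?nnegrE// (le_trans I0).
rewrite exprMn; apply: ler_pM; rewrite ?sqr_ge0//; exact: normed_product.
Qed.

(** Cauchy-Schwarz for $v\cdot v^2$ gives $(\int v^3)^2\le N\int v^4$; squaring brings in the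
    preceding bound. *)
Let cube_bound : rintegrable mm D (fun z => v z ^+ 3) /\
  (\int[mm]_(z in D) v z ^+ 3) ^+ 4 <= 16 * N ^+ 4 * (a * b).
Proof.
have [i4 H4] := ladyzhenskaya.
have E3 z : v z * v z ^+ 2 = v z ^+ 3 by ring.
split; first by apply: eq_rintegrable (sqintegrable_mul mD iv i4) => // z _.
have := cauchy_schwarz_Rintegral mD iv i4.
under eq_Rintegral do rewrite E3.
under [X in _ <= _ * X -> _]eq_Rintegral do rewrite -exprM.
rewrite -/N => H.
rewrite (_ : 4 = 2 * 2)%N// exprM.
apply: (@le_trans _ _ ((N * \int[mm]_(x in D) v x ^+ (2 * 2)) ^+ 2)).
  by rewrite lerXn2r ?nnegrE ?sqr_ge0// (le_trans _ H)// sqr_ge0.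
rewrite exprMn; apply: (@le_trans _ _ (N ^+ 2 * (16 * N ^+ 2 * (a * b)))).
  by rewrite ler_wpM2l ?sqr_ge0.
by rewrite le_eqVlt; apply/orP; left; apply/eqP; ring.
Qed.

Let i_energy : [/\ rintegrable mm D (fun z => (weight z * v z) * vx z),
   rintegrable mm D (fun z => (weight z * v z ^+ 2) * vx z),
   rintegrable mm D (fun z => (weight z * v z) * vxxx z) &
   rintegrable mm D (fun z => (weight z * v z) * vxyy z)].
Proof.
have [i4 _] := ladyzhenskaya.
by split; apply: (sqintegrable_mul mD) => //; exact: sqintegrable_weight.
Qed.

Let energy_x : 3 * a - N - 2 / 3 * \int[mm]_(z in D) v z ^+ 3 <=
  2 * \int[mm]_(z in D) (weight z * v z * vx z) +
  2 * \int[mm]_(z in D) (weight z * v z ^+ 2 * vx z) +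
  2 * \int[mm]_(z in D) (weight z * v z * vxxx z).
Proof.
have [i1 i2 i3 _] := i_energy; have [c3 _] := cube_bound.
pose f z := 3 * vx z ^+ 2 + - v z ^+ 2 + - (2 / 3) * v z ^+ 3.
pose g z := 2 * (weight z * v z * vx z) + 2 * (weight z * v z ^+ 2 * vx z) + 2 * (weight z * v z * vxxx z).
have j1 : rintegrable mm D (fun z => 3 * vx z ^+ 2) by apply: rintegrableZ => //; exact: ivx.2.
have j2 : rintegrable mm D (fun z => - v z ^+ 2) by apply: rintegrableN; exact: iv.2.
have j3 : rintegrable mm D (fun z => - (2 / 3) * v z ^+ 3) by exact: rintegrableZ.
have j12 : rintegrable mm D (fun z => 3 * vx z ^+ 2 + - v z ^+ 2) by exact: rintegrableD.
have k1 : rintegrable mm D (fun z => 2 * (weight z * v z * vx z)) by exact: rintegrableZ.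
have k2 : rintegrable mm D (fun z => 2 * (weight z * v z ^+ 2 * vx z)) by exact: rintegrableZ.
have k3 : rintegrable mm D (fun z => 2 * (weight z * v z * vxxx z)) by exact: rintegrableZ.
have k12 := rintegrableD mD k1 k2.
have fi : rintegrable mm D f by exact: rintegrableD.
have gi : rintegrable mm D g by exact: rintegrableD.
have -> : 3 * a - N - 2 / 3 * \int[mm]_(z in D) v z ^+ 3 = \int[mm]_(z in D) f z.
  rewrite RintegralD// RintegralD// (RintegralN mD iv.2).
  by rewrite !RintegralZl ?mulNr//; exact: ivx.2.
have -> : 2 * \int[mm]_(z in D) (weight z * v z * vx z) +
  2 * \int[mm]_(z in D) (weight z * v z ^+ 2 * vx z) +
  2 * \int[mm]_(z in D) (weight z * v z * vxxx z) = \int[mm]_(z in D) g z.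
  by rewrite RintegralD// RintegralD// !RintegralZl.
apply: le_slices_x => //.
have [sf _ _] := fubini_swapped mX mY fi.
have [sg _ _] := fubini_swapped mX mY gi.
apply: ae_imp3 Hx sf sg => y Hxy sf sg Yy.
have [V [P [Q [[VP PQ Qr] V0 VL PL [vV vxP]]]]] := Hxy Yy.
have mV := AC_measurable VP; have mP := AC_measurable PQ.
have mr := msx ivxxx.1 Yy.
have m1 : measurable_fun X (fun x : R => 1 + x) by apply: measurable_funD => //; exact: measurable_funTS.
have mg' : measurable_fun X (fun x => 2 * (1 + x) * V x * (1 + V x) * P x + 2 * (1 + x) * V x * vxxx (x, y)).
  by repeat (apply: measurable_funM || apply: measurable_funD).
have mf' : measurable_fun X (fun x => 3 * P x ^+ 2 - V x ^+ 2 - 2 / 3 * V x ^+ 3).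
  by repeat (apply: measurable_funM || apply: measurable_funB || apply: measurable_funX).
have Ef : {ae mu, forall x, X x -> f (x, y) = 3 * P x ^+ 2 - V x ^+ 2 - 2 / 3 * V x ^+ 3}.
  by apply: ae_imp2 vV vxP => x E1 E2 Xx; rewrite /f E1// E2//; ring.
have Eg : {ae mu, forall x, X x -> g (x, y) =
    2 * (1 + x) * V x * (1 + V x) * P x + 2 * (1 + x) * V x * vxxx (x, y)}.
  by apply: ae_imp2 vV vxP => x E1 E2 Xx; rewrite /g E1// E2// /weight /=; ring.
rewrite (ae_eq_Rintegral mX (rintegrable_measurable (sf Yy)) mf' Ef).
rewrite (ae_eq_Rintegral mX (rintegrable_measurable (sg Yy)) mg' Eg).
exact: energy_slice (ltW L0) VP PQ Qr V0 VL PL.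
Qed.

(** The weight does not depend on $y$, so integration by parts on vertical lines moves one
    $y$-derivative: $\int wvv_{xyy}=-\int wv_yv_{xy}$. On horizontal lines $2wv_yv_{xy}+v_y^2$ is
    the derivative of $wv_y^2$, which has the favourable sign at $x=0$ and vanishes at $x=L$. *)
Let energy_y : b <= 2 * \int[mm]_(z in D) (weight z * v z * vxyy z).
Proof.
have [_ _ _ i4] := i_energy.
have k1 : rintegrable mm D (fun z => weight z * vy z * vxy z).
  by apply: (sqintegrable_mul mD) => //; exact: sqintegrable_weight.
have k2 : rintegrable mm D (fun z => 2 * (weight z * vy z * vxy z)) by exact: rintegrableZ.
have H1 : 0 <= \int[mm]_(z in D) (weight z * vy z * vxy z + weight z * v z * vxyy z).
  rewrite -[leLHS](Rintegral_cst0 mm D); have ki := rintegrableD mD k1 i4.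
  apply: le_slices_y => //; first exact: integrable0.
  have [sk _ _] := fubini_slices mX mY ki.
  apply: ae_imp2 Hy sk => x Hyx sk Xx; rewrite Rintegral_cst0.
  have [V [S [VP St V0 VL [vV vxyS]]]] := Hyx Xx.
  have mV := AC_measurable VP; have mS := AC_measurable St.
  have mt := msy ivxyy.1 Xx; have mq := msy ivy.1 Xx.
  have mVS : measurable_fun Y (fun y => vy (x, y) * S y + V y * vxyy (x, y)).
    by repeat (apply: measurable_funM || apply: measurable_funD).
  have vVS : {ae mu, forall y, Y y ->
      weight (x, y) * vy (x, y) * vxy (x, y) + weight (x, y) * v (x, y) * vxyy (x, y) =
      (1 + x) * (vy (x, y) * S y + V y * vxyy (x, y))}.
    by apply: ae_imp2 vV vxyS => y E1 E2 Yy; rewrite E1// E2// /weight /=; ring.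
  have mwVS : measurable_fun Y (fun y => (1 + x) * (vy (x, y) * S y + V y * vxyy (x, y))).
    exact: measurable_funM.
  rewrite (ae_eq_Rintegral mY (rintegrable_measurable (sk Xx)) mwVS vVS).
  have iwVS := ae_eq_rintegrable mY mwVS vVS (sk Xx).
  have x0 : 0 < 1 + x.
    by move: Xx; rewrite /= in_itv/= => /andP[? _]; rewrite addr_gt0.
  rewrite RintegralZl//; last first.
    apply: eq_rintegrable (rintegrableZ mY (1 + x)^-1 iwVS) => // y _.
    by rewrite mulrA mulVf ?mul1r// gt_eqF.
  by rewrite (product_slice (ltW BB) VP St V0 VL) mulr0.
have H2 : \int[mm]_(z in D) (vy z ^+ 2 + 2 * (weight z * vy z * vxy z)) <= 0.
  rewrite -[leRHS](Rintegral_cst0 mm D); have ki := rintegrableD mD ivy.2 k2.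
  apply: le_slices_x => //; first exact: integrable0.
  have [sk _ _] := fubini_swapped mX mY ki.
  apply: ae_imp2 Hvy sk => y Hvyy sk Yy; rewrite Rintegral_cst0.
  have [P [Pq PL vyP]] := Hvyy Yy.
  have mP := AC_measurable Pq; have mq := msx ivxy.1 Yy.
  have m1 : measurable_fun X (fun x : R => 1 + x) by apply: measurable_funD => //; exact: measurable_funTS.
  have mg' : measurable_fun X (fun x => P x ^+ 2 + 2 * (1 + x) * P x * vxy (x, y)).
    by repeat (apply: measurable_funM || apply: measurable_funD || apply: measurable_funX).
  have Eg : {ae mu, forall x, X x -> vy (x, y) ^+ 2 + 2 * (weight (x, y) * vy (x, y) * vxy (x, y)) =
      P x ^+ 2 + 2 * (1 + x) * P x * vxy (x, y)}.
    by apply: ae_imp vyP => x E1 Xx; rewrite E1// /weight /=; ring.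
  rewrite (ae_eq_Rintegral mX (rintegrable_measurable (sk Yy)) mg' Eg).
  exact: weighted_square_slice (ltW L0) Pq PL.
move: H1 H2; rewrite RintegralD// RintegralD//; last exact: ivy.2.
rewrite RintegralZl// -/b; lra.
Qed.

(** The weight lies between 1 and $1+L$. The lower bound passes the threshold from the weighted mass
    to $N$; the upper bound turns the remaining $A^2N$ back into the weighted mass and costs the
    factor $1/(1+L)$ in the rate. *)
Lemma energy_inequality A g : 0 < A ^+ 2 -> 24 / L ^+ 2 + 2 / B ^+ 2 - 1 = 2 * A ^+ 2 ->
  sqintegrable mm D g ->
  {ae mm, forall z, D z -> g z + (1 + v z) * vx z + vxxx z + vxyy z = 0} ->
  \int[mm]_(z in D) (weight z * v z ^+ 2) < 9 * A ^+ 4 / (16 * (8 / L ^+ 2 + 2 / B ^+ 2)) ->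
  2 * \int[mm]_(z in D) (weight z * v z * g z) <=
    - (A ^+ 2 / (1 + L)) * \int[mm]_(z in D) (weight z * v z ^+ 2).
Proof.
move=> A0 hA gi Hg ythr.
have [i1 i2 i3 i4] := i_energy.
have iy : rintegrable mm D (fun z => weight z * v z ^+ 2) by apply: rintegrable_weight iv.2.
set y := \int[mm]_(z in D) (weight z * v z ^+ 2) in ythr *.
have Ny : N <= y.
  apply: le_Rintegral => //; first exact: iv.2.
  by move=> z /weight_bound/andP[w1 _]; rewrite ler_peMl// sqr_ge0.
have yN : y <= (1 + L) * N.
  rewrite /N -RintegralZl//; last exact: iv.2.
  apply: le_Rintegral => //; first exact: rintegrableZ iv.2.
  by move=> z /weight_bound/andP[_ wL]; rewrite ler_wpM2r// sqr_ge0.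
have N0 : 0 <= N by apply: Rintegral_ge0 => z _; exact: sqr_ge0.
have ig : rintegrable mm D (fun z => weight z * v z * g z).
  by apply: (sqintegrable_mul mD) => //; exact: sqintegrable_weight.
have E : \int[mm]_(z in D) (weight z * v z * g z) =
  - (\int[mm]_(z in D) (weight z * v z * vx z) + \int[mm]_(z in D) (weight z * v z ^+ 2 * vx z) +
   \int[mm]_(z in D) (weight z * v z * vxxx z) + \int[mm]_(z in D) (weight z * v z * vxyy z)).
  have i12 := rintegrableD mD i1 i2; have i123 := rintegrableD mD i12 i3.
  have i1234 := rintegrableD mD i123 i4.
  rewrite -RintegralD// -RintegralD// -RintegralD// -RintegralN//.
  apply: (ae_eq_Rintegral mD); first exact: rintegrable_measurable ig.
    exact: rintegrable_measurable (rintegrableN i1234).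
  apply: ae_imp Hg => z /[apply] Ez.
  have -> : g z = - ((1 + v z) * vx z + vxxx z + vxyy z).
    by apply/eqP; rewrite -subr_eq0 opprK -[X in _ == X]Ez !addrA.
  ring.
have [_ c4] := cube_bound.
have L2 : 0 < 8 / L ^+ 2 by rewrite divr_gt0// exprn_gt0.
have B2 : 0 < 2 / B ^+ 2 by rewrite divr_gt0// exprn_gt0.
have hPQ : 3 * (8 / L ^+ 2) + 2 / B ^+ 2 - 1 = 2 * A ^+ 2 by rewrite -hA; field; rewrite !gt_eqF.
have hN : N < 9 * (A ^+ 2) ^+ 2 / (16 * (8 / L ^+ 2 + 2 / B ^+ 2)).
  by rewrite -exprM; exact: le_lt_trans Ny ythr.
have key := energy_inequality_arith A0 L2 B2 hPQ N0 poincare_x poincare_y hN c4.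
have yA : (A ^+ 2 / (1 + L)) * y <= A ^+ 2 * N.
  have L1 : 0 < 1 + L by rewrite addr_gt0.
  apply: (@le_trans _ _ (A ^+ 2 / (1 + L) * ((1 + L) * N))).
    by rewrite ler_wpM2l// divr_ge0 ?ltW.
  by rewrite mulrA divfK// gt_eqF.
rewrite E mulNr; exact: energy_combination energy_x energy_y key yA hPQ.
Qed.

End fixed_time.

(** * Slice representations from traces and weak derivatives *)

Section slice_representations.
Context (R : realType).
Notation mu := (@lebesgue_measure R).
Notation mm := (mu \x mu)%E.
Notation Rm := (measurableTypeR R).

(** Each end gives a representation of [g]. Comparing the two at a single point shows that [h] has
    integral zero, so the primitive from the left also vanishes at the right end. *)
Lemma zero_ends_AC (a b : R) (g h : R -> R) : a < b -> rintegrable mu `]a, b[ h ->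
  {ae mu, forall x, `]a, b[%classic x -> g x = \int[mu]_(s in `]a, x[) h s} ->
  {ae mu, forall x, `]a, b[%classic x -> g x = - \int[mu]_(s in `]x, b[) h s} ->
  exists V, [/\ AC a b V h, V a = 0, V b = 0 & {ae mu, forall x, `]a, b[%classic x -> g x = V x}].
Proof.
move=> ab hi g1 g2; exists (fun x => \int[mu]_(s in `]a, x[) h s); split => //.
- exact: AC_left.
- by rewrite set_itvoo_eq0 Rintegral_set0.
- have g12 : {ae mu, forall x, `]a, b[%classic x ->
      \int[mu]_(s in `]a, x[) h s = - \int[mu]_(s in `]x, b[) h s}.
    by apply: ae_imp2 g1 g2 => x e1 e2 Xx; rewrite -e1// -e2.
  have [x] := ae_exists_itv ab g12; rewrite /= in_itv/= => /andP[ax xb] E.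
  by rewrite (@Rintegral_oo_split _ a b x) ?ltW// E addNr.
Qed.

Variables (L B : R) (L0 : 0 < L) (B0 : 0 < B).
Notation X := (`]0, L[%classic : set Rm).
Notation Y := (`]- B, B[%classic : set Rm).
Notation D := (X `*` Y).

Let mX : measurable X. Proof. exact: measurable_itv. Qed.
Let mY : measurable Y. Proof. exact: measurable_itv. Qed.
Let mD : measurable D. Proof. exact: measurableX. Qed.
Let BB : - B < B. Proof. by rewrite gtrN. Qed.

Let D_oo : (mm D < +oo)%E. Proof. by rewrite rectangle_measure// ltry. Qed.

Variables v vx vy vxx vxy vxxx vxyy : R * R -> R.
Hypotheses (iv : sqintegrable mm D v) (ivx : sqintegrable mm D vx) (ivy : sqintegrable mm D vy)
  (ivxx : sqintegrable mm D vxx) (ivxy : sqintegrable mm D vxy)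
  (ivxxx : sqintegrable mm D vxxx) (ivxyy : sqintegrable mm D vxyy).
Hypotheses (w00 : weak_dxy D 0 0 v v) (w10 : weak_dxy D 1 0 v vx) (w01 : weak_dxy D 0 1 v vy)
  (w20 : weak_dxy D 2 0 v vxx) (w11 : weak_dxy D 1 1 v vxy)
  (w30 : weak_dxy D 3 0 v vxxx) (w12 : weak_dxy D 1 2 v vxyy).
Hypotheses (tl : has_trace D (fun y => (0, y)) Y v (cst 0))
  (tr : has_trace D (fun y => (L, y)) Y v (cst 0))
  (tb : has_trace D (fun x => (x, - B)) X v (cst 0))
  (tt : has_trace D (fun x => (x, B)) X v (cst 0))
  (tx : has_trace D (fun y => (L, y)) Y vx (cst 0)).

Let ri f : sqintegrable mm D f -> rintegrable mm D f.
Proof. by apply: sqintegrable_rintegrable => //; exact: D_oo. Qed.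

Lemma y_slices_of_traces : y_slices L B v vy vxy vxyy.
Proof.
have vb := has_trace_bottom L0 BB tb iv ivy w01.
have vt := has_trace_top L0 BB tt iv ivy w01.
have vxys := ypair_slices BB (ri ivxy) (ri ivxyy) (weak_ypair w11 w12).
have [vyi _ _] := fubini_slices mX mY (ri ivy).
have H : {ae mu, forall x, X x -> exists V, [/\ AC (- B) B V (fun y => vy (x, y)), V (- B) = 0,
    V B = 0 & {ae mu, forall y, Y y -> v (x, y) = V y}]}.
  by apply: ae_imp3 vb vt vyi => x vb vt vyi Xx; apply: zero_ends_AC; [|exact: vyi|exact: vb|exact: vt].
apply: ae_imp2 H vxys => x H vxys Xx.
have [V [VP V0 VB vV]] := H Xx; have [_ ti [C vC]] := vxys Xx.
exists V, (fun y => C + \int[mu]_(s in `]- B, y[) vxyy (x, s)); split => //.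
apply: AC_eq (AC_add (AC_cst _ _ C) (AC_left ti)) => y _; exact: add0r.
Qed.

Lemma x_slices_of_traces : x_slices L B v vx vxxx.
Proof.
have vl := has_trace_left L0 BB tl iv ivx (weak_xpair w00 w10).
have vr := has_trace_right L0 BB tr iv ivx (weak_xpair w00 w10).
have vxr := has_trace_right L0 BB tx ivx ivxx (weak_xpair w10 w20).
have vxxs := xpair_slices L0 (ri ivxx) (ri ivxxx) (weak_xpair w20 w30).
have [vxi _ _] := fubini_swapped mX mY (ri ivx).
have H : {ae mu, forall y, Y y -> exists V, [/\ AC 0 L V (fun x => vx (x, y)), V 0 = 0,
    V L = 0 & {ae mu, forall x, X x -> v (x, y) = V x}]}.
  by apply: ae_imp3 vl vr vxi => y vb vt vyi Yy; apply: zero_ends_AC; [|exact: vyi|exact: vb|exact: vt].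
apply: ae_imp3 H vxr vxxs => y H vxr vxxs Yy.
have [V [VP V0 VL vV]] := H Yy; have [xxi ti [C vC]] := vxxs Yy.
have P1 := AC_right xxi.
have Q1 : AC 0 L (fun x => C + \int[mu]_(s in `]0, x[) vxxx (s, y)) (fun x => vxxx (x, y)).
  by apply: AC_eq (AC_add (AC_cst _ _ C) (AC_left ti)) => x _; exact: add0r.
exists V, (fun x => - \int[mu]_(s in `]x, L[) vxx (s, y)),
  (fun x => C + \int[mu]_(s in `]0, x[) vxxx (s, y)); split => //.
- split => //.
    (* The density of [V] is [vx], which agrees almost everywhere with [P]; the density of [P] is
       replaced by [Q] in the same way. This links the three functions into one chain. *)
    by apply: AC_ae VP; [exact: AC_measurable P1|exact: vxr].
  by apply: AC_ae P1; [exact: AC_measurable Q1|].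
- by rewrite set_itvoo_eq0 Rintegral_set0 oppr0.
- by split => //; exact: vxr.
Qed.

Lemma vy_slices_of_traces : vy_slices L B vy vxy.
Proof.
have vr := has_trace_right L0 BB tr iv ivx (weak_xpair w00 w10).
have H := tangential_derivative L0 BB (ri iv) (ri ivx) (ri ivy) (ri ivxy)
  (weak_ypair w00 w01) (weak_ypair w10 w11) vr.
have [vxyi _ _] := fubini_swapped mX mY (ri ivxy).
apply: ae_imp2 H vxyi => y H vxyi Yy.
exists (fun x => - \int[mu]_(s in `]x, L[) vxy (s, y)); split.
- exact: AC_right (vxyi Yy).
- by rewrite set_itvoo_eq0 Rintegral_set0 oppr0.
- exact: H.
Qed.

Lemma energy_of_traces A g : 0 < A ^+ 2 -> 24 / L ^+ 2 + 2 / B ^+ 2 - 1 = 2 * A ^+ 2 ->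
  sqintegrable mm D g ->
  {ae mm, forall z, D z -> g z + (1 + v z) * vx z + vxxx z + vxyy z = 0} ->
  \int[mm]_(z in D) ((1 + z.1) * v z ^+ 2) < 9 * A ^+ 4 / (16 * (8 / L ^+ 2 + 2 / B ^+ 2)) ->
  2 * \int[mm]_(z in D) ((1 + z.1) * v z * g z) <=
    - (A ^+ 2 / (1 + L)) * \int[mm]_(z in D) ((1 + z.1) * v z ^+ 2).
Proof.
apply: (energy_inequality L0 B0 iv ivx ivy ivxy ivxxx ivxyy).
- exact: x_slices_of_traces.
- exact: y_slices_of_traces.
- exact: vy_slices_of_traces.
Qed.

End slice_representations.

(** * Bochner norms *)

Section product_measure.
Context d1 d2 (T1 : measurableType d1) (T2 : measurableType d2) (R : realType).
Variable m1 : {sigma_finite_measure set T1 -> \bar R}.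
Variable m2 : {sigma_finite_measure set T2 -> \bar R}.

Lemma sigma_finite_product : sigma_finite setT (m1 \x m2)%E.
Proof.
have [F TF Foo] := sigma_finiteT m1; have [G TG Goo] := sigma_finiteT m2.
exists (fun n => if unpickle n is Some (i, j) then F i `*` G j else set0).
  apply/esym; rewrite -subTset => -[x y] _.
  have : [set: T1] x by []. rewrite TF => -[i _ Fx].
  have : [set: T2] y by []. rewrite TG => -[j _ Gy].
  by exists (pickle (i, j)) => //; rewrite pickleK.
move=> n; case: (unpickle n) => [[i j]|]; last by rewrite measure0.
have [mF oF] := Foo i; have [mG oG] := Goo j; split; first exact: measurableX.
by rewrite product_measure1E// lte_mul_pinfty// ge0_fin_numE.
Qed.

(* The canonical sigma-finite structure on products is shadowed by the one of
   products of subprobabilities. *)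
Definition product_sigma_finite_measure :
    {sigma_finite_measure set (T1 * T2)%type -> \bar R} :=
  HB.pack (m1 \x m2)%E (Measure_isSigmaFinite.Build _ _ _ (m1 \x m2)%E sigma_finite_product).

End product_measure.

Lemma measurable_integral_sections d1 d2 (T1 : measurableType d1) (T2 : measurableType d2)
    (R : realType) (m1 : {sigma_finite_measure set T1 -> \bar R}) (D : set T1) (I : set T2)
    (v : T2 -> T1 -> R) : measurable D -> measurable I ->
  measurable_fun (D `*` I) (fun w => v w.2 w.1) ->
  measurable_fun setT ((fun t => (\int[m1]_(z in D) (v t z ^+ 2)%:E)%E) \_ I).
Proof.
move=> mD mI jv; set q := (X in X \_ I).
pose F (w : T1 * T2) : \bar R := ((fun w => (v w.2 w.1 ^+ 2)%:E) \_ (D `*` I)) w.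
have mF : measurable_fun setT F.
  apply/(measurable_restrictT _ (measurableX mD mI)).
  by apply/measurable_EFinP; exact: measurable_funX jv.
have F0 w : (0 <= F w)%E by rewrite /F patchE; case: ifPn => // _; rewrite lee_fin sqr_ge0.
have -> : q \_ I = fubini_G m1 F; last exact: measurable_fun_fubini_tonelli_G.
apply/funext => t; rewrite /fubini_G patchE; case: ifPn => [|/negP]; rewrite inE => It.
  rewrite /q [LHS]integral_mkcond; apply: eq_integral => z _.
  rewrite /F !patchE; case: (boolP (z \in D)) => zD; rewrite ?inE in zD.
    by rewrite mem_set.
  by rewrite memNset// => -[/mem_set]; rewrite (negbTE zD).
by apply/esym/integral0_eq => z _; rewrite /F patchE memNset// => -[_ ?].
Qed.

Section Bochner_norms.
Context (R : realType).
Notation mu := (@lebesgue_measure R).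
Notation mm := (mu \x mu)%E.
Notation Rm := (measurableTypeR R).
Variables (D : set (Rm * Rm)) (I : set Rm) (mD : measurable D) (mI : measurable I).
Implicit Types v : R -> R * R -> R.

Lemma jointly_measurable_slice v t : jointly_measurable D I v -> I t -> measurable_fun D (v t).
Proof.
move=> jv It.
exact: (measurable_slice mI mD (measurable_fun_swap mD mI jv) It).
Qed.

(** The squared norm is measurable in $t$ by Tonelli and integrable by hypothesis, hence finite at
    almost every time. *)
Lemma L2fun_ae v : jointly_measurable D I v ->
  ('N[mu]_2%:E[(fun t => L2norm mm D (v t)) \_ I] < +oo)%E ->
  {ae mu, forall t, I t -> L2fun mm D (v t)}.
Proof.
move=> jv Noo.
pose q t : \bar R := (\int[mm]_(z in D) (v t z ^+ 2)%:E)%E.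
have mq : measurable_fun setT (q \_ I).
  exact: (measurable_integral_sections (product_sigma_finite_measure mu mu) mD mI jv).
have iq : mu.-integrable setT (q \_ I).
  apply/integrableP; split => //.
  have := poweR_lty 2 Noo; rewrite poweR_Lnorm//.
  congr (_ < _)%E; apply: eq_integral => t _; rewrite !patchE; case: ifPn => // _.
    have q0 : (0 <= q t)%E by apply: integral_ge0 => z _; rewrite lee_fin sqr_ge0.
    by rewrite gee0_abs ?Lnorm_ge0// L2norm_poweR gee0_abs.
  by rewrite (_ : point = 0%E)// abse0 poweR0r.
have := integrable_ae measurableT iq.
apply: ae_imp => t /(_ Logic.I) + It; rewrite patchE mem_set// => qf.
split; first exact: jointly_measurable_slice jv It.
have qoo : (L2norm mm D (v t) `^ 2 < +oo)%E.
  by rewrite L2norm_poweR -ge0_fin_numE// integral_ge0// => z _; rewrite lee_fin sqr_ge0.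
have := Lnorm_ge0 mm 2%:E ((EFin \o v t) \_ D); rewrite -/(L2norm mm D (v t)).
move: qoo; case: (L2norm mm D (v t)) => [s _ _|oo|//]; first by rewrite ltry.
by move: oo; rewrite /= ifF// pnatr_eq0.
Qed.

Lemma L2bound_ae v : jointly_measurable D I v ->
  ('N[mu]_+oo%E[(fun t => L2norm mm D (v t)) \_ I] < +oo)%E ->
  exists M, 0 <= M /\ {ae mu, forall t, I t -> sqintegrable mm D (v t) /\
    \int[mm]_(z in D) (v t z ^+ 2) <= M}.
Proof.
move=> jv; rewrite unlock; rewrite ifT; last first.
  have E : @lebesgue_measure R [set: R] = +oo%E by rewrite -set_itvNyy lebesgue_measure_itv.
  by rewrite [X in (_ < X)%E]E.
set f := (fun t => L2norm mm D (v t)) \_ I => foo.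
have := ess_sup_inf.ess_sup_ge mu (abse \o f); move: foo; case: (ess_sup_inf.ess_sup _ _) => [s|//|] _.
  move=> H; exists (Num.max 0 s ^+ 2); split; first exact: sqr_ge0.
  apply: ae_imp H => t /= + It; rewrite /f patchE mem_set//.
  have n0 := Lnorm_ge0 mm 2%:E ((EFin \o v t) \_ D); rewrite -/(L2norm mm D (v t)) in n0.
  rewrite gee0_abs// => le_s.
  have sq : sqintegrable mm D (v t).
    apply: L2fun_sqintegrable => //; split; first exact: jointly_measurable_slice jv It.
    by apply: le_lt_trans le_s _; rewrite ltry.
  split => //.
  rewrite -lee_fin -(EFin_Rintegral mD sq.2) -L2norm_expe.
  move: n0 le_s; case: (L2norm mm D (v t)) => [r|//|//]; rewrite !lee_fin => r0 rs.
  have rm : r <= Num.max 0 s by rewrite le_max rs orbT.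
  by rewrite expr2; apply: ler_pM.
(* Here the essential supremum is [-oo], which no absolute value can reach. *)
move=> H; exists 0; split => //.
apply: ae_imp H => t /= + It; rewrite /f patchE mem_set//.
by rewrite leeNy_eq => /eqP E; have := abse_ge0 (L2norm mm D (v t)); rewrite E.
Qed.

End Bochner_norms.

Section spacetime.
Context d (T1 : measurableType d) (R : realType).
Notation mu := (@lebesgue_measure R).
Notation Rm := (measurableTypeR R).
Variables (m1 : {sigma_finite_measure set T1 -> \bar R}) (D : set T1) (mD : measurable D).

Lemma sqintegrable_spacetime (T M : R) (v : R -> T1 -> R) :
  measurable_fun (D `*` (`]0, T[%classic : set Rm)) (fun w => v w.2 w.1) ->
  {ae mu, forall t, `]0, T[%classic t -> sqintegrable m1 D (v t) /\
    \int[m1]_(z in D) (v t z ^+ 2) <= M} ->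
  sqintegrable (m1 \x mu)%E (D `*` (`]0, T[%classic : set Rm)) (fun w => v w.2 w.1).
Proof.
move=> jv H; split => //.
have mI : measurable (`]0, T[%classic : set Rm) by exact: measurable_itv.
have jv2 : measurable_fun (D `*` (`]0, T[%classic : set Rm)) (fun w => v w.2 w.1 ^+ 2).
  exact: measurable_funX.
have ms := measurable_fun_swap mD mI jv2.
have : rintegrable (mu \x m1)%E ((`]0, T[%classic : set Rm) `*` D) (fun w => v w.1 w.2 ^+ 2).
  apply: (fubini_tonelli_slices mI mD ms).
    by apply: ae_imp H => t H It; exact: (H It).1.2.
  exists (cst M); first exact: AC_rintegrable (AC_cst 0 T M).
  apply: ae_imp H => t H It /=; apply: le_trans (H It).2; rewrite le_eqVlt; apply/orP; left.
  by apply/eqP/eq_Rintegral => z _; rewrite ger0_norm ?sqr_ge0.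
by move=> /(rintegrable_swap mI mD)[].
Qed.

End spacetime.

(** * Weak derivatives in time *)

Section time_representation.
Context d (T1 : measurableType d) (R : realType).
Notation mu := (@lebesgue_measure R).
Notation Rm := (measurableTypeR R).
Variables (m1 : {sigma_finite_measure set T1 -> \bar R}) (A : set T1) (mA : measurable A).
Hypothesis Aoo : (m1 A < +oo)%E.
Variables (T : R) (T0 : 0 < T).
Notation I := (`]0, T[%classic : set Rm).
Notation mt := (m1 \x mu)%E.
Notation AI := (A `*` I).
Variables u g : R -> T1 -> R.
Hypotheses (iu : sqintegrable mt AI (fun w => u w.2 w.1))
  (ig : sqintegrable mt AI (fun w => g w.2 w.1)).

Let mI : measurable I. Proof. exact: measurable_itv. Qed.
Let mAI : measurable AI. Proof. exact: measurableX. Qed.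
Let Ioo : (mu I < +oo)%E. Proof. exact: measure_itvoo_lty. Qed.
Let AIoo : (mt AI < +oo)%E.
Proof.
rewrite product_measure1E//; apply: lte_mul_pinfty => //.
by rewrite ge0_fin_numE.
Qed.

Lemma fubini_slices_snd (B : set Rm) (f : T1 * R -> R) : measurable B -> rintegrable mt (A `*` B) f ->
  [/\ {ae mu, forall t, B t -> rintegrable m1 A (fun z => f (z, t))},
      rintegrable mu B (fun t => \int[m1]_(z in A) f (z, t)) &
      \int[mt]_(w in A `*` B) f w = \int[mu]_(t in B) \int[m1]_(z in A) f (z, t)].
Proof.
move=> mB fi; have [fi' E] := rintegrable_swap mA mB fi.
have [h1 h2 h3] := fubini_slices mB mA fi'.
by split => //; rewrite -E.
Qed.

Lemma ae_fst (P : T1 -> Prop) : {ae m1, forall z, P z} -> {ae mt, forall w, P w.1}.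
Proof.
move=> [N [mN N0 PN]]; exists (N `*` setT); split; first exact: measurableX.
  transitivity (m1 N * mu setT)%E; first exact: product_measure1E.
  by rewrite N0 mul0e.
by move=> w nP; split => //; exact: PN.
Qed.

Let gz : {ae m1, forall z, A z -> sqintegrable mu I (fun t => g t z)}.
Proof.
have [h _ _] := fubini_slices mA mI ig.2.
apply: ae_imp h => z h Az; split; last exact: h.
exact: (measurable_slice mA mI ig.1 Az).
Qed.

Let uz : {ae m1, forall z, A z -> sqintegrable mu I (fun t => u t z)}.
Proof.
have [h _ _] := fubini_slices mA mI iu.2.
apply: ae_imp h => z h Az; split; last exact: h.
exact: (measurable_slice mA mI iu.1 Az).
Qed.

Let J (w : T1 * R) := \int[mu]_(s in `]0, w.2[) g s w.1.

(** Joint measurability of a primitive with a parameter comes from Fubini on the triples $(z,t,s)$: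
    [J] is the integral over $s$ of [g s z] cut off at $s<t$. *)
Let measurable_J : measurable_fun AI J.
Proof.
pose K (w : (T1 * R) * R) := (w.2 < w.1.2)%R%:R * g w.2 w.1.1.
have mtime : measurable_fun (AI `*` I) (fun w : (T1 * Rm) * Rm => w.2 : R).
  by apply: measurable_funTS; exact: measurable_snd.
have mtime1 : measurable_fun (AI `*` I) (fun w : (T1 * Rm) * Rm => w.1.2 : R).
  by apply: measurable_funTS; exact: (measurableT_comp measurable_snd measurable_fst).
have mproj : measurable_fun setT (fun w : (T1 * Rm) * Rm => (w.1.1, w.2)).
  have m11 : measurable_fun setT (fun w : (T1 * Rm) * Rm => w.1.1).
    exact: (measurableT_comp measurable_fst measurable_fst).
  have m2 : measurable_fun setT (fun w : (T1 * Rm) * Rm => w.2) by exact: measurable_snd.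
  exact: measurable_fun_pair m11 m2.
have mg : measurable_fun (AI `*` I) (fun w : (T1 * Rm) * Rm => g w.2 w.1.1).
  apply: (measurable_comp (F := AI) (f := fun w : T1 * Rm => g w.2 w.1)
    (g := fun w : (T1 * Rm) * Rm => (w.1.1, w.2))) => //.
  - by move=> _ [[[z t] s] [[/= Az It] Is] <-].
  - exact: ig.1.
  - exact: measurable_funTS.
have mK : measurable_fun (AI `*` I) K.
  apply: measurable_funM => //; apply: measurable_fun_natr.
  exact: measurable_fun_ltr.
have gi := sqintegrable_rintegrable mAI AIoo ig.
have [_ Gi _] := fubini_slices mA mI (rintegrable_norm gi).
have [iG1 _] := rintegrable_tensor mA mI Gi (AC_rintegrable (AC_cst 0 T 1)).
have gw := ae_fst gz.
have slice w : AI w -> sqintegrable mu I (fun t => g t w.1) -> rintegrable mu I (fun s => K (w, s)).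
  move=> [Aw Iw] gw1; apply: (rintegrable_bounded mI (M := 1)).
  - apply: measurable_fun_natr; apply: measurable_fun_ltr; last exact: measurable_cst.
    by apply: measurable_funTS; exact: measurable_id.
  - by move=> s _; case: (s < w.2)%R; rewrite ?normr1 ?normr0.
  - exact: sqintegrable_rintegrable gw1.
have Ki : rintegrable (product_sigma_finite_measure m1 mu \x mu)%E (AI `*` I) K.
  apply: (fubini_tonelli_slices mAI mI mK).
    by apply: ae_imp gw => w gw1 AIw; apply: slice => //; exact: gw1 AIw.1.
  exists (fun w => (\int[mu]_(s in I) `|g s w.1|) * 1); first exact: iG1.
  apply: ae_imp gw => w gw1 AIw; rewrite mulr1.
  have gi1 := sqintegrable_rintegrable mI Ioo (gw1 AIw.1).
  apply: le_Rintegral => //.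
  - by apply: rintegrable_norm; apply: slice => //; exact: gw1 AIw.1.
  - exact: rintegrable_norm.
  - move=> s Is; rewrite /K normrM; case: (s < w.2)%R; rewrite ?normr1 ?normr0 ?mul1r ?mul0r//.
have [_ KJ _] := fubini_slices mAI mI Ki.
have := rintegrable_measurable KJ; apply: eq_measurable_fun => w; rewrite inE => -[Aw].
rewrite /= in_itv/= => /andP[w0 wT].
by rewrite /K /J /= Rintegral_lt// ltW.
Qed.

Let J_sq : {ae mt, forall w, AI w -> `|J w ^+ 2| <= (\int[mu]_(s in I) g s w.1 ^+ 2) * T}.
Proof.
apply: ae_imp (ae_fst gz) => -[z t] /= gz' [/= Az]; rewrite in_itv/= => /andP[t0 tT].
have gs := gz' Az; have gs' := sqintegrable_sub (lexx 0) (ltW tT) gs.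
rewrite ger0_norm ?sqr_ge0// /J /=; apply: (le_trans (cauchy_schwarz_slice (ltW t0) gs')).
rewrite subr0 mulrC; apply: ler_pM; [|exact: ltW| |exact: ltW].
  by apply: Rintegral_ge0 => s _; exact: sqr_ge0.
have tin : 0 <= t <= T by rewrite !ltW.
rewrite [leRHS](Rintegral_oo_split tin gs.2).
by rewrite lerDl Rintegral_ge0// => ? _; exact: sqr_ge0.
Qed.

Let sq_J : sqintegrable mt AI J.
Proof.
split; first exact: measurable_J.
have [_ Gi _] := fubini_slices mA mI ig.2.
have [iG1 _] := rintegrable_tensor mA mI Gi (AC_rintegrable (AC_cst 0 T T)).
apply: (rintegrable_ae_le mAI _ J_sq iG1).
by apply: measurable_funX; exact: measurable_J.
Qed.

(* [u] is known only for almost every time, so its initial value is recovered by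
   averaging. *)
Definition time_origin z := T^-1 * \int[mu]_(t in I) (u t z - J (z, t)).

Definition time_primitive t z := time_origin z + \int[mu]_(s in `]0, t[) g s z.

Let diff_sq : sqintegrable mt AI (fun w => u w.2 w.1 - J w).
Proof. exact: sqintegrableB iu sq_J. Qed.

Lemma sqintegrable_time_origin : sqintegrable m1 A time_origin.
Proof.
have [_ c1 _] := fubini_slices mA mI (sqintegrable_rintegrable mAI AIoo diff_sq).
have [c3 c2 _] := fubini_slices mA mI diff_sq.2.
have mc : measurable_fun A time_origin by exact: rintegrable_measurable (rintegrableZ mA T^-1 c1).
split => //; apply: (rintegrable_ae_le mA _ _ (rintegrableZ mA T^-1 c2)).
  exact: measurable_funX.
apply: ae_imp c3 => z c3 Az; rewrite ger0_norm ?sqr_ge0//.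
have sqd : sqintegrable mu I (fun t => u t z - J (z, t)).
  by split; [exact: (measurable_slice mA mI diff_sq.1 Az)|exact: c3].
have := cauchy_schwarz_slice (ltW T0) sqd; rewrite subr0 /time_origin exprMn => le2.
apply: (le_trans (ler_wpM2l (sqr_ge0 _) le2)).
by rewrite /= mulrA expr2 mulfVK ?gt_eqF.
Qed.

Lemma AC_time_primitive : {ae m1, forall z, A z ->
  AC 0 T (fun t => time_primitive t z) (fun t => g t z)}.
Proof.
apply: ae_imp gz => z gz' Az.
have gi := sqintegrable_rintegrable mI Ioo (gz' Az).
apply: AC_eq (AC_add (AC_cst _ _ (time_origin z)) (AC_left gi)) => t _; exact: add0r.
Qed.

Lemma time_primitive0 z : time_primitive 0 z = time_origin z.
Proof. by rewrite /time_primitive set_itvoo_eq0 Rintegral_set0 addr0. Qed.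

Hypothesis Hweak : forall F, test_itv 0 T F -> {ae m1, forall z, A z ->
  \int[mu]_(t in I) ('D_(1 : R) F t * u t z + F t * g t z) = 0}.

Let measurable_time_primitive : measurable_fun AI (fun w => time_primitive w.2 w.1).
Proof.
apply: measurable_funD; last exact: measurable_J.
exact: measurable_fun_fst sqintegrable_time_origin.1.
Qed.

(** For almost every [z], du Bois-Reymond yields a constant that comes with no measurability in [z].
    It equals the time average of [u - J], which is [time_origin] and is measurable; the identity on
    lines then passes to the product. *)
Lemma ae_time_primitive : {ae mt, forall w, AI w -> u w.2 w.1 = time_primitive w.2 w.1}.
Proof.
have [F [tF HF]] := countable_test_functions T0.
have H : {ae m1, forall z, forall i, A z ->
    \int[mu]_(t in I) ('D_(1 : R) (F i) t * u t z + F i t * g t z) = 0}.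
  by apply: ae_forall_count => i; exact: Hweak.
pose P (w : T1 * Rm) : bool := u w.2 w.1 == time_primitive w.2 w.1.
have mP : measurable_fun AI P by apply: measurable_fun_eqr; [exact: iu.1|exact: measurable_time_primitive].
suff : {ae mt, forall w, AI w -> P w} by apply: ae_imp => w /[apply] /eqP.
apply: (ae_of_slices mA mI mP).
apply: ae_imp3 H gz uz => z H gz' uz' Az.
have gi := sqintegrable_rintegrable mI Ioo (gz' Az).
have ui := sqintegrable_rintegrable mI Ioo (uz' Az).
have [c uc] := HF _ _ ui gi (fun i => H i Az).
suff cE : time_origin z = c by apply: ae_imp uc => t /[apply] E; rewrite /P /= E /time_primitive cE.
rewrite /time_origin.
have mJ : measurable_fun I (fun t => J (z, t)) := measurable_slice mA mI measurable_J Az.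
rewrite (ae_eq_Rintegral mI (g := cst c)) ?Rintegral_cst//.
- have E : fine (mu I) = T by rewrite lebesgue_measure_itv/= lte_fin T0 /= subr0.
  transitivity (T^-1 * (c * T)); first by congr (_ * (_ * _)); exact: E.
  by rewrite mulrCA mulVf ?mulr1// gt_eqF.
- by apply: measurable_funB => //; exact: rintegrable_measurable ui.
- by apply: ae_imp uc => t /[apply] ->; rewrite /J /= addrK.
Qed.

Lemma sqintegrable_time_primitive : sqintegrable mt AI (fun w => time_primitive w.2 w.1).
Proof.
have m2 : measurable_fun AI (fun w => time_primitive w.2 w.1 ^+ 2) by exact: measurable_funX.
split => //; apply: (ae_eq_rintegrable mAI m2 _ iu.2).
by apply: ae_imp ae_time_primitive => w /[apply] ->.
Qed.

Lemma ae_time_slices : {ae mu, forall t, I t -> {ae m1, forall z, A z -> u t z = time_primitive t z}}.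
Proof.
have := ae_slices (ae_swap ae_time_primitive).
by apply: ae_imp => t H It; apply: ae_imp H => z H Az; exact: H.
Qed.

Variables (w : T1 -> R) (W : R) (mw : measurable_fun A w) (wW : forall z, A z -> `|w z| <= W).

Definition weighted_energy t := \int[m1]_(z in A) (w z * time_primitive t z ^+ 2).

Definition weighted_power t := \int[m1]_(z in A) (w z * (2 * time_primitive t z * g t z)).

(** For almost every [z] the square of [time_primitive] is absolutely continuous in time. Its
    increment is integrated over [z] and the two integrals are exchanged, so nothing is
    differentiated under the integral sign. *)
Lemma AC_weighted_energy : AC 0 T weighted_energy weighted_power.
Proof.
have iUg := sqintegrable_mul mAI sqintegrable_time_primitive ig.
have mw1 : measurable_fun AI (fun x : T1 * Rm => w x.1) by exact: measurable_fun_fst.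
have ik : rintegrable mt AI (fun x => w x.1 * (2 * time_primitive x.2 x.1 * g x.2 x.1)).
  apply: (rintegrable_bounded mAI mw1 (M := W)); first by move=> x [Ax _]; exact: wW.
  by apply: eq_rintegrable (rintegrableZ mAI 2 iUg) => // x _; ring.
have [_ iP _] := fubini_slices_snd mI ik.
split => // t /andP[t0 tT].
have mIt : measurable (`]0, t[%classic : set Rm) by exact: measurable_itv.
have sIt : A `*` `]0, t[%classic `<=` AI.
  move=> [z s] /= [Az]; rewrite !in_itv/= => /andP[s0 st]; split => //.
  by rewrite s0 (lt_le_trans st).
have ikt : rintegrable mt (A `*` `]0, t[%classic)
    (fun x => w x.1 * (2 * time_primitive x.2 x.1 * g x.2 x.1)).
  by apply: integrableS ik => //; exact: measurableX.
have [_ _ E1] := fubini_slices_snd mIt ikt.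
have [_ iz E2] := fubini_slices mA mIt ikt.
rewrite -E1 E2.
have i0 : rintegrable m1 A (fun z => w z * time_primitive 0 z ^+ 2).
  apply: (rintegrable_bounded mA mw wW); apply: eq_rintegrable sqintegrable_time_origin.2 => // z _.
  by rewrite time_primitive0.
rewrite /weighted_energy -RintegralD//.
have giAI := sqintegrable_rintegrable mAI AIoo ig.
have git : rintegrable mt (A `*` `]0, t[%classic) (fun x => g x.2 x.1).
  by apply: integrableS giAI => //; exact: measurableX.
have [_ it _] := fubini_slices mA mIt git.
have mUt : measurable_fun A (time_primitive t).
  by apply: measurable_funD; [exact: sqintegrable_time_origin.1|exact: rintegrable_measurable it].
apply: (ae_eq_Rintegral mA).
- by apply: measurable_funM => //; exact: measurable_funX.
- exact: rintegrable_measurable (rintegrableD mA i0 iz).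
apply: ae_imp AC_time_primitive => z H Az; have Uz := H Az.
have [iUU EUU] := AC_mul Uz Uz.
rewrite [in LHS]expr2 EUU ?t0// -expr2 mulrDr; congr (_ + _).
rewrite -RintegralZl//; last exact: rintegrable_sub (lexx 0) tT iUU.
by apply: eq_Rintegral => s _; ring.
Qed.

End time_representation.

(** * Decay below a threshold *)

Section gronwall.
Context (R : realType).
Notation mu := (@lebesgue_measure R).
Notation Rm := (measurableTypeR R).
Implicit Types (Y h : R -> R) (c t s M : R).

Lemma is_derive_expR_scale c t :
  is_derive t (1 : R) (fun t : R => expR (c * t)) (c * expR (c * t)).
Proof.
have d1 : is_derive t 1 (fun t : R => c * t) c.
  have := @is_deriveZ _ _ _ (@id R) c t 1 1 (is_derive_id t 1).
  by rewrite /GRing.scale /= mulr1.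
rewrite mulrC; exact: (is_derive1_comp (is_derive_expR _) d1).
Qed.

Lemma smooth_expR c : smooth (fun t : R => expR (c * t)).
Proof.
have dE := is_derive_expR_scale c.
apply/smoothP => k; elim: k => [|k IH].
  have df (t : R) : derivable (fun t : R => expR (c * t)) t 1 by [].
  split; last exact: I.
  - by move=> t; apply/differentiable_continuous/derivable1_diffP.
  - by move=> t e; exact: (derive_real e (df t)).1.
apply: (@smooth_order1 _ _ _ (cst c \* (fun t : R => expR (c * t)))) => //.
by apply: smooth_orderM => //; exact: smooth_order_cst.
Qed.

Lemma AC_expR c (T : R) : 0 <= T -> AC 0 T (fun t => expR (c * t)) (fun t => c * expR (c * t)).
Proof.
move=> T0; apply: AC_eq (AC_smooth T0 (smooth_expR c)) => t _.
have dE := is_derive_expR_scale c t.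
exact: derive_val.
Qed.

Lemma AC_lipschitz (T : R) Y h M s t : AC 0 T Y h ->
  {ae mu, forall r, `]0, T[%classic r -> `|h r| <= M} -> 0 <= s -> s <= t -> t <= T ->
  `|Y t - Y s| <= M * (t - s).
Proof.
move=> [hi YE] hM s0 st tT.
have t0 : 0 <= t by exact: le_trans st.
rewrite (YE t) ?t0// (YE s) ?s0 ?(le_trans st)//.
have sin : 0 <= s <= t by rewrite s0.
have hit := rintegrable_sub (lexx 0) tT hi.
have hst := rintegrable_sub s0 tT hi.
rewrite (Rintegral_oo_split sin hit) opprD addrACA subrr add0r addrAC subrr add0r.
have mst : measurable (`]s, t[%classic : set Rm) by exact: measurable_itv.
apply: (le_trans (le_normr_Rintegral mst hst)).
have -> : M * (t - s) = \int[mu]_(r in `]s, t[) cst M r.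
  have E : fine (mu `]s, t[%classic) = t - s.
    by rewrite lebesgue_measure_itv/= lte_fin; case: ltP => //= ts; apply/esym/eqP; rewrite subr_eq0 eq_le st ts.
  by rewrite Rintegral_cst//; congr (_ * _); exact: esym E.
apply: (ae_le_Rintegral mst); first exact: rintegrable_norm.
  exact: AC_rintegrable (AC_cst s t M).
apply: ae_imp hM => r hM; rewrite /= in_itv/= => /andP[sr rt]; apply: hM.
by rewrite /= in_itv/= (le_lt_trans s0 sr) (lt_le_trans rt).
Qed.

(** The product of [Y] with $e^{ct}$ is absolutely continuous and its density is at most zero on
    []0, t[]. *)
Lemma gronwall_step c (T : R) Y h t : AC 0 T Y h -> 0 <= t <= T ->
  {ae mu, forall s, `]0, t[%classic s -> h s <= - c * Y s} ->
  Y t <= expR (- c * t) * Y 0.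
Proof.
move=> YA /andP[t0 tT] H.
have [ki kE] := AC_mul (AC_expR c t0) (AC_sub tT YA).
have mt : measurable (`]0, t[%classic : set Rm) by exact: measurable_itv.
have : expR (c * t) * Y t <= Y 0.
  rewrite (kE t) ?t0 ?lexx// mulr0 expR0 mul1r gerDl -[leRHS](Rintegral_cst0 mu `]0, t[).
  apply: (ae_le_Rintegral mt ki (AC_rintegrable (AC_cst 0 t 0))).
  apply: ae_imp H => s H Is; have := H Is.
  rewrite -(ler_pM2l (expR_gt0 (c * s))) => hs.
  by rewrite [leRHS](_ : _ = 0)// -mulrA mulrCA; move: hs; rewrite mulNr mulrN; lra.
by rewrite -ler_pdivlMl ?expR_gt0// -expRN mulNr.
Qed.

(* Since [Y] is Lipschitz, staying below the threshold propagates by time steps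
   of a fixed length. *)
Lemma gronwall_threshold c (T thr M : R) Y h : AC 0 T Y h -> 0 <= c ->
  (forall t, 0 <= Y t) ->
  {ae mu, forall r, `]0, T[%classic r -> `|h r| <= M} ->
  {ae mu, forall r, `]0, T[%classic r -> Y r < thr -> h r <= - c * Y r} ->
  Y 0 < thr ->
  forall t, 0 <= t <= T -> Y t <= expR (- c * t) * Y 0.
Proof.
move=> YA c0 Yge0 hM hY Y0.
(* In time [de] the function [Y] rises by less than [thr - Y 0]. The decay brings it back to at most
   [Y 0] at each multiple of [de], so the step length never has to shrink. The added 1 keeps the
   denominator positive. *)
pose de := (thr - Y 0) / (`|M| + 1).
have M1 : 0 < `|M| + 1 by rewrite ltr_wpDl.
have de0 : 0 < de by rewrite divr_gt0// subr_gt0.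
have Mde : M * de < thr - Y 0.
  apply: (@le_lt_trans _ _ (`|M| * de)); first by rewrite ler_wpM2r ?ler_norm// ltW.
  rewrite -[ltRHS](@mulfK _ (`|M| + 1)) ?gt_eqF// mulrAC -/de.
  by rewrite mulrC ltr_pM2l// ltrDl.
have decay t : 0 <= t -> expR (- c * t) * Y 0 <= Y 0.
  by move=> t0; rewrite ler_piMl// -expR0 ler_expR mulNr oppr_le0 mulr_ge0.
have H n : forall t, 0 <= t <= T -> t <= n%:R * de -> Y t <= expR (- c * t) * Y 0.
  elim: n => [|n IH] t /andP[t0 tT].
    rewrite mul0r => t0'; have -> : t = 0 by apply/eqP; rewrite eq_le t0 t0'.
    by rewrite mulr0 expR0 mul1r.
  move=> tn; apply: (gronwall_step YA); first by rewrite t0.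
  apply: ae_imp hY => s hY; rewrite /= in_itv/= => /andP[s0 st].
  have sT := lt_le_trans st tT.
  apply: hY; first by rewrite /= in_itv/= s0.
  (* Up to the last multiple of [de] the induction hypothesis keeps [Y] below the threshold; beyond
     it the Lipschitz bound does. *)
  have [sn|ns] := leP s (n%:R * de).
    by apply: (le_lt_trans (IH s _ sn)); rewrite ?ltW// (le_lt_trans (decay _ (ltW s0))).
  have nd0 : 0 <= n%:R * de by rewrite mulr_ge0// ltW.
  have nT : n%:R * de <= T by rewrite (le_trans (ltW ns))// ltW.
  have := AC_lipschitz YA hM nd0 (ltW ns) (ltW sT).
  have := IH (n%:R * de); rewrite nd0 nT lexx => /(_ isT isT) IHn.
  have := decay _ nd0 => dn L.
  have sde : s - n%:R * de <= de by move: tn; rewrite -natr1 mulrDl mul1r; lra.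
  have MM : M * (s - n%:R * de) <= `|M| * de.
    apply: (@le_trans _ _ (`|M| * (s - n%:R * de))).
      by rewrite ler_wpM2r ?ler_norm// subr_ge0 ltW.
    by rewrite ler_wpM2l.
  have Mde' : `|M| * de < thr - Y 0.
    rewrite -[ltRHS](@mulfK _ (`|M| + 1)) ?gt_eqF// mulrAC -/de.
    by rewrite mulrC ltr_pM2l// ltrDl.
  have := ler_norm (Y s - Y (n%:R * de)); lra.
move=> t tin; have [t0 _] := andP tin.
apply: (H (Num.trunc (t / de)).+1) => //.
rewrite -ler_pdivrMr//; apply: ltW; exact: truncnS_gt.
Qed.

End gronwall.

Lemma normr_mul2_le (R : realDomainType) (p q : R) : `|2 * (p * q)| <= p ^+ 2 + q ^+ 2.
Proof.
have := sqr_ge0 (p - q); have := sqr_ge0 (p + q).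
by rewrite sqrrB sqrrD ler_norml => h1 h2; apply/andP; split; lra.
Qed.

(** * Continuity of the weighted mass in L2 *)

Section weighted_continuity.
Context d (T : measurableType d) (R : realType) (mu : {measure set T -> \bar R}).
Variables (D : set T) (mD : measurable D) (w f : T -> R) (W : R).
Hypotheses (mw : measurable_fun D w) (wW : forall z, D z -> `|w z| <= W)
  (fi : sqintegrable mu D f).

Lemma weighted_square_continuous eps : 0 < eps -> exists de, 0 < de /\
  forall g, sqintegrable mu D g -> \int[mu]_(z in D) (g z - f z) ^+ 2 <= de ->
  `|\int[mu]_(z in D) (w z * g z ^+ 2) - \int[mu]_(z in D) (w z * f z ^+ 2)| <= eps.
Proof.
move=> eps0.
pose K := \int[mu]_(z in D) f z ^+ 2.
have K0 : 0 <= K by apply: Rintegral_ge0 => z _; exact: sqr_ge0.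
pose V := `|W| + 1.
have V0 : 0 < V by rewrite ltr_wpDl.
(* [|g^2 - f^2| <= (1 + 1/r) (g - f)^2 + r f^2] *)
pose r := eps / (2 * V * (K + 1)).
have K1 : 0 < K + 1 by rewrite ltr_wpDl.
have r0 : 0 < r by rewrite divr_gt0// !mulr_gt0.
pose k := 1 + r^-1.
have k0 : 0 < k by rewrite addr_gt0// invr_gt0.
(* [r] was chosen so that the term with $f^2$ contributes at most [eps / 2]; this radius does the
   same for the term with $(g-f)^2$. The 1 added to [K] covers the case $f=0$. *)
exists (eps / (2 * V * k)); split; first by rewrite divr_gt0// !mulr_gt0.
move=> g gi gf.
have di := sqintegrableB mD gi fi.
have wi (h : T -> R) : sqintegrable mu D h -> rintegrable mu D (fun z => w z * h z ^+ 2).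
  by move=> hi; apply: (rintegrable_bounded mD mw wW) hi.2.
have bi : rintegrable mu D (fun z => V * (k * (g z - f z) ^+ 2 + r * f z ^+ 2)).
  by apply: rintegrableZ => //; apply: rintegrableD => //; apply: rintegrableZ => //; [exact: di.2|exact: fi.2].
have gfi : rintegrable mu D (fun z => w z * g z ^+ 2 - w z * f z ^+ 2).
  by apply: rintegrableB => //; exact: wi.
rewrite -RintegralB//; [|exact: wi|exact: wi].
apply: (le_trans (le_normr_Rintegral mD gfi)).
apply: (@le_trans _ _ (\int[mu]_(z in D) (V * (k * (g z - f z) ^+ 2 + r * f z ^+ 2)))).
  apply: le_Rintegral => //; first exact: rintegrable_norm.
  move=> z Dz; rewrite -mulrBr normrM; apply: ler_pM => //.
    by rewrite (le_trans (wW Dz))// (le_trans (ler_norm W))// lerDl.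
  have -> : g z ^+ 2 - f z ^+ 2 = (g z - f z) ^+ 2 + 2 * (f z * (g z - f z)) by ring.
  set e := g z - f z.
  have : 0 <= r^-1 * (r * f z - e) ^+ 2 by rewrite mulr_ge0 ?sqr_ge0// invr_ge0 ltW.
  have : 0 <= r^-1 * (r * f z + e) ^+ 2 by rewrite mulr_ge0 ?sqr_ge0// invr_ge0 ltW.
  have -> : r^-1 * (r * f z + e) ^+ 2 = r * f z ^+ 2 + 2 * (f z * e) + r^-1 * e ^+ 2.
    by field; rewrite gt_eqF.
  have -> : r^-1 * (r * f z - e) ^+ 2 = r * f z ^+ 2 - 2 * (f z * e) + r^-1 * e ^+ 2.
    by field; rewrite gt_eqF.
  have := sqr_ge0 e; rewrite /k mulrDl mul1r ler_norml => h1 h2 h3.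
  by apply/andP; split; lra.
rewrite RintegralZl//; last first.
  by apply: rintegrableD => //; apply: rintegrableZ => //; [exact: di.2|exact: fi.2].
rewrite RintegralD//; [|by apply: rintegrableZ => //; exact: di.2|by apply: rintegrableZ => //; exact: fi.2].
rewrite !RintegralZl//; [|exact: fi.2|exact: di.2].
rewrite -/K mulrDr.
have h1 : V * (k * \int[mu]_(z in D) (g z - f z) ^+ 2) <= eps / 2.
  apply: (@le_trans _ _ (V * (k * (eps / (2 * V * k))))).
    by rewrite ler_wpM2l ?ler_wpM2l// ltW.
  by rewrite le_eqVlt; apply/orP; left; apply/eqP; field; rewrite !gt_eqF.
have h2 : V * (r * K) <= eps / 2.
  apply: (@le_trans _ _ (V * (r * (K + 1)))).
    by rewrite ler_wpM2l ?ler_wpM2l ?lerDl// ltW.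
  by rewrite le_eqVlt; apply/orP; left; apply/eqP; rewrite /r; field; rewrite !gt_eqF.
lra.
Qed.

End weighted_continuity.

(** * Regular solutions *)

Lemma ae_conj d (T : measurableType d) (R : realType) (mu : {measure set T -> \bar R})
    (D P Q : T -> Prop) :
  {ae mu, forall x, D x -> P x} -> {ae mu, forall x, D x -> Q x} ->
  {ae mu, forall x, D x -> P x /\ Q x}.
Proof. by apply: ae_imp2 => x p q Dx; split; [exact: p|exact: q]. Qed.

Lemma itv_right (R : realType) (t e : R) (P : R -> Prop) : 0 < e ->
  {ae @lebesgue_measure R, forall s, `]t, t + e[%classic s -> P s} ->
  exists2 s, t < s < t + e & P s.
Proof.
move=> e0 H; have te : t < t + e by rewrite ltrDl.
by have [s] := ae_exists_itv te H; rewrite /= in_itv/=; exists s.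
Qed.

Section decay.
Context (R : realType).
Notation mu := (@lebesgue_measure R).
Notation mm := (mu \x mu)%E.
Notation Rm := (measurableTypeR R).
Notation m2 := (product_sigma_finite_measure mu mu).
Variables (L B A : R) (L0 : 0 < L) (B0 : 0 < B).
Hypotheses (A0 : 0 < A ^+ 2) (hA : 24 / L ^+ 2 + 2 / B ^+ 2 - 1 = 2 * A ^+ 2).
Notation D := ((`]0, L[%classic : set Rm) `*` (`]- B, B[%classic : set Rm)).
Variables (u0 : R * R -> R) (u ut ux uxxx uxyy : R -> R * R -> R).
Hypothesis sol : regular_solution_with L B u0 u ut ux uxxx uxyy.

Let mD : measurable D. Proof. by apply: measurableX; exact: measurable_itv. Qed.
Let Doo : (mm D < +oo)%E. Proof. by rewrite rectangle_measure ?ltry// gtrN. Qed.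
Let c := A ^+ 2 / (1 + L).
Let thr := 9 * A ^+ 4 / (16 * (8 / L ^+ 2 + 2 / B ^+ 2)).
Let w (z : R * R) : R := 1 + z.1.
Let mass (f : R * R -> R) := \int[mm]_(z in D) (w z * f z ^+ 2).
Let mtimes : measurable (@times R : set Rm). Proof. exact: measurable_itv. Qed.

Let wD z : D z -> 1 <= w z <= 1 + L. Proof. exact: weight_bound. Qed.
Let mw : measurable_fun (D : set (Rm * Rm)) w. Proof. exact: measurable_weight. Qed.
Let wL z : D z -> `|w z| <= 1 + L.
Proof. by move=> /wD/andP[w1 wL]; rewrite ger0_norm// (le_trans _ w1). Qed.

Section horizon.
Variables (T : R) (T0 : 0 < T).
Notation I := (`]0, T[%classic : set Rm).

Let mI : measurable I. Proof. exact: measurable_itv. Qed.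

Let times_itv t : I t -> times t.
Proof. by rewrite /times /= !in_itv/= andbT => /andP[]. Qed.

(** The regularity clauses bound their own versions of the derivatives; this passes the bound to the
    versions in the equation. *)
Let sqintegrable_weak i j v g h : weak_dxy D i j v g -> weak_dxy D i j v h ->
  measurable_fun (D : set (Rm * Rm)) h -> sqintegrable mm D g -> sqintegrable mm D h.
Proof.
move=> wg wh mh [mg ig]; split => //.
apply: (ae_eq_rintegrable mD _ _ ig); first exact: measurable_funX.
by apply: ae_imp (weak_unique mg mh wg wh) => z E Dz; rewrite E.
Qed.

Lemma ae_bound_u : exists K, 0 <= K /\ {ae mu, forall t, I t -> sqintegrable mm D (u t) /\
  \int[mm]_(z in D) (u t z ^+ 2) <= K}.
Proof.
have [[d [dE dP]] _] := rs_regular_u sol T0.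
have [[jm _] N] := dP 0%N 0%N isT; rewrite dE in jm N.
exact: (L2bound_ae mD mI jm N).
Qed.

Lemma ae_bound_ut : exists K, 0 <= K /\ {ae mu, forall t, I t -> sqintegrable mm D (ut t) /\
  \int[mm]_(z in D) (ut t z ^+ 2) <= K}.
Proof.
have [[d [dE dP]] _] := rs_regular_ut sol T0.
have [[jm _] N] := dP 0%N 0%N isT; rewrite dE in jm N.
exact: (L2bound_ae mD mI jm N).
Qed.

Lemma ae_equation : {ae mu, forall t, I t -> {ae mm, forall z, D z ->
  ut t z + (1 + u t z) * ux t z + uxxx t z + uxyy t z = 0}}.
Proof.
have H : {ae (m2 \x mu)%E, forall w : (R * R) * R, (rect L B `*` times) w ->
  ut w.2 w.1 + (1 + u w.2 w.1) * ux w.2 w.1 + uxxx w.2 w.1 + uxyy w.2 w.1 = 0}.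
  exact: rs_equation sol.
have := ae_slices (ae_swap H); apply: ae_imp => t Ht It.
by apply: ae_imp Ht => z Hz Dz; apply: Hz; split => //; exact: times_itv.
Qed.

Lemma ae_dissipation : {ae mu, forall t, I t -> mass (u t) < thr ->
  2 * \int[mm]_(z in D) (w z * u t z * ut t z) <= - c * mass (u t)}.
Proof.
(* The clause with $H^3$ is taken because it bounds $u_{xxx}$ and $u_{xyy}$ separately, and not only
   their sum. *)
have [_ [d [dE dP]]] := rs_regular_u sol T0.
have dH i j : (i + j <= 3)%N -> {ae mu, forall t, I t ->
    sqintegrable mm D (d i j t) /\ weak_dxy D i j (u t) (d i j t)}.
  move=> ij; have [[jm wk] N] := dP i j ij.
  apply: ae_imp2 (L2fun_ae mD mI jm N) wk => t l wk It; split; last exact: wk.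
  exact: L2fun_sqintegrable (l It).
have sub i j v : space_derivative (rect L B) times i j u v ->
    {ae mu, forall t, I t -> measurable_fun (D : set (Rm * Rm)) (v t) /\ weak_dxy D i j (u t) (v t)}.
  move=> [jm]; apply: ae_imp => t wk It; have tt := times_itv It; split; last exact: wk.
  exact: (jointly_measurable_slice mD mtimes jm tt).
have tra P : {ae mu1, forall t, 0 < t -> P t} -> {ae mu, forall t, I t -> P t}.
  by apply: ae_imp => t H; rewrite /= in_itv/= => /andP[t0 _]; exact: H.
have [M [_ Mut]] := ae_bound_ut.
have h1 := ae_conj (dH 0%N 0%N isT) (ae_conj (dH 1%N 0%N isT) (ae_conj (dH 0%N 1%N isT)
  (ae_conj (dH 2%N 0%N isT) (ae_conj (dH 1%N 1%N isT) (ae_conj (dH 3%N 0%N isT) (dH 1%N 2%N isT)))))).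
have h2 := ae_conj (sub _ _ _ (rs_ux sol)) (ae_conj (sub _ _ _ (rs_uxxx sol)) (sub _ _ _ (rs_uxyy sol))).
have h3 := ae_conj (tra _ (rs_left sol)) (ae_conj (tra _ (rs_right sol)) (ae_conj (tra _ (rs_bottom sol))
  (ae_conj (tra _ (rs_top sol)) (tra _ (rs_right_ux sol))))).
have h4 := ae_conj Mut ae_equation.
have h12 := ae_conj h1 h2; have h34 := ae_conj h3 h4.
apply: ae_imp2 h12 h34 => t h12 h34 It.
have [[[i00 w00] [[i10 w10] [[i01 w01] [[i20 w20] [[i11 w11] [[i30 w30] [i12 w12]]]]]]]
  [[mx wx] [[mxxx wxxx] [mxyy wxyy]]]] := h12 It.
have [[tl [tr [tb [tt tx]]]] [[iut _] eqn]] := h34 It.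
rewrite dE in i00 w00.
have ix := sqintegrable_weak w10 wx mx i10.
have ixxx := sqintegrable_weak w30 wxxx mxxx i30.
have ixyy := sqintegrable_weak w12 wxyy mxyy i12.
exact: (energy_of_traces L0 B0 i00 ix i01 i20 i11 ixxx ixyy w00 wx w01 w20 w11 wxxx wxyy
  tl tr tb tt tx A0 hA iut eqn).
Qed.

Let iu : sqintegrable (m2 \x mu)%E (D `*` I) (fun w => u w.2 w.1).
Proof.
have [[d [dE dP]] _] := rs_regular_u sol T0.
have [[jm _] N] := dP 0%N 0%N isT; rewrite dE in jm N.
by have [K [_ H]] := ae_bound_u; exact: (sqintegrable_spacetime (m1 := m2) mD jm H).
Qed.

Let iut : sqintegrable (m2 \x mu)%E (D `*` I) (fun w => ut w.2 w.1).
Proof.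
have [[d [dE dP]] _] := rs_regular_ut sol T0.
have [[jm _] N] := dP 0%N 0%N isT; rewrite dE in jm N.
by have [K [_ H]] := ae_bound_ut; exact: (sqintegrable_spacetime (m1 := m2) mD jm H).
Qed.

(** A test function on []0, T[] is also one on the half-line, and its support cuts the integrals
    over the half-line down to []0, T[], where finiteness is known. *)
Let weak_time F : test_itv 0 T F -> {ae m2, forall z, D z ->
  \int[mu]_(t in I) ('D_(1 : R) F t * u t z + F t * ut t z) = 0}.
Proof.
move=> tF; have [_ wk] := rs_ut sol.
have tdF := test_itv_derive tF.
have tt : test_function (@times R) F.
  have [sF cF sub] := test_function_itv tF; split => // t /sub; exact: times_itv.
have [uz _ _] := fubini_slices mD mI iu.2.
have [utz _ _] := fubini_slices mD mI iut.2.
have restrict (f G : R -> R) : test_itv 0 T G -> (forall t, G t = 0 -> f t = 0) ->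
    (\int[mu1]_(t in times) (f t)%:E = \int[mu]_(t in I) (f t)%:E)%E.
  move=> [_ [p [q [p0 qT Gpq]]]] fG.
  rewrite [LHS]integral_mkcond [RHS]integral_mkcond; apply: eq_integral => t _.
  rewrite !patchE; case: (boolP (t \in I)) => [tI|tI].
    by rewrite mem_set//; apply: times_itv; rewrite inE in tI.
  case: ifPn => // tt'; rewrite fG// Gpq//; apply: contra tI => /andP[pt tq].
  by rewrite inE /= in_itv/= (lt_le_trans p0 pt) (le_lt_trans tq qT).
apply: ae_imp3 (wk F tt) uz utz => z wk' uz utz Dz.
have Ioo : (mu I < +oo)%E by exact: measure_itvoo_lty.
have iuz : rintegrable mu I (fun t => u t z).
  by apply: (sqintegrable_rintegrable mI Ioo); split; [exact: (measurable_slice mD mI iu.1 Dz)|exact: uz].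
have iutz : rintegrable mu I (fun t => ut t z).
  by apply: (sqintegrable_rintegrable mI Ioo); split; [exact: (measurable_slice mD mI iut.1 Dz)|exact: utz].
have i1 : rintegrable mu I (fun t => 'D_(1 : R) F t * u t z) by exact: test_itv_rintegrable tdF iuz.
have i2 : rintegrable mu I (fun t => F t * ut t z) by exact: test_itv_rintegrable tF iutz.
have := wk' Dz.
rewrite (restrict (fun t => u t z * 'D_(1 : R) F t) _ tdF); last by move=> t ->; rewrite mulr0.
rewrite (restrict (fun t => - (ut t z * F t)) _ tF); last by move=> t ->; rewrite mulr0 oppr0.
have i1' : rintegrable mu I (fun t => u t z * 'D_(1 : R) F t).
  by apply: eq_rintegrable i1 => // t _; rewrite mulrC.
have i2' : rintegrable mu I (fun t => - (ut t z * F t)).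
  by apply: rintegrableN; apply: eq_rintegrable i2 => // t _; rewrite mulrC.
rewrite (EFin_Rintegral mI i1') (EFin_Rintegral mI i2') => -[E].
rewrite RintegralD//.
under [X in X + _]eq_Rintegral do rewrite mulrC.
rewrite E -RintegralD//; transitivity (\int[mu]_(t in I) (0 : R)); last exact: Rintegral_cst0.
by apply: eq_Rintegral => t _; ring.
Qed.

Let Y := weighted_energy m2 D T u ut w.
Let h := weighted_power m2 D T u ut w.

Let YA : AC 0 T Y h.
Proof. exact: (AC_weighted_energy (m1 := m2) mD Doo T0 iu iut weak_time mw wL). Qed.

Let Y_ge0 t : 0 <= Y t.
Proof.
apply: Rintegral_ge0 => z /wD/andP[w1 _].
by rewrite mulr_ge0 ?sqr_ge0// (le_trans _ w1).
Qed.

(** The absolutely continuous energy [Y] is the weighted mass of [u t], and its density the power,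
    only at almost every time. The remaining times are reached by continuity in $L^2$. *)
Let good : {ae mu, forall t, I t -> [/\ sqintegrable mm D (u t), Y t = mass (u t) &
  h t = 2 * \int[mm]_(z in D) (w z * u t z * ut t z)]}.
Proof.
have [K [_ HK]] := ae_bound_u; have [M [_ HM]] := ae_bound_ut.
have H := ae_time_slices (m1 := m2) mD Doo T0 iu iut weak_time.
have mU := (sqintegrable_time_primitive (m1 := m2) mD Doo T0 iu iut weak_time).1.
apply: ae_imp3 H HK HM => t H HK HM It.
have uU := H It; have [su _] := HK It; have [sut _] := HM It.
have mUt : measurable_fun (D : set (Rm * Rm)) (time_primitive T u ut t).
  exact: (jointly_measurable_slice mD mI mU It).
split; first exact: su.
- apply: (ae_eq_Rintegral mD).
  + by apply: measurable_funM => //; exact: measurable_funX.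
  + by apply: measurable_funM => //; apply: measurable_funX; exact: su.1.
  + by apply: ae_imp uU => z E Dz; rewrite E.
- have ik : rintegrable mm D (fun z => w z * u t z * ut t z).
    by apply: (sqintegrable_mul mD) => //; exact: (sqintegrable_bounded mD mw wL).
  rewrite -RintegralZl; [|exact: mD|exact: ik].
  apply: (ae_eq_Rintegral mD).
  + apply: measurable_funM => //; apply: measurable_funM; last exact: sut.1.
    exact: measurable_funM.
  + apply: measurable_funM => //; apply: measurable_funM; last exact: sut.1.
    by apply: measurable_funM => //; exact: su.1.
  + by apply: ae_imp uU => z E Dz; rewrite E//; ring.
Qed.

Let power_bound : exists M, 0 <= M /\ {ae mu, forall t, I t -> `|h t| <= M}.
Proof.
have [K [K0 HK]] := ae_bound_u; have [M [M0 HM]] := ae_bound_ut.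
have L1 : 0 <= 1 + L by rewrite addr_ge0// ltW.
exists ((1 + L) * (K + M)); split; first by apply: mulr_ge0 => //; exact: addr_ge0.
apply: ae_imp3 good HK HM => t gd HK HM It.
have [_ _ ->] := gd It; have [su uK] := HK It; have [sut utM] := HM It.
have ik : rintegrable mm D (fun z => w z * u t z * ut t z).
  by apply: (sqintegrable_mul mD) => //; exact: (sqintegrable_bounded mD mw wL).
have ik2 : rintegrable mm D (fun z => 2 * (w z * u t z * ut t z)) by exact: rintegrableZ.
have iS : rintegrable mm D (fun z => u t z ^+ 2 + ut t z ^+ 2).
  by apply: rintegrableD => //; [exact: su.2|exact: sut.2].
rewrite -RintegralZl//; apply: (le_trans (le_normr_Rintegral mD ik2)).
apply: (@le_trans _ _ (\int[mm]_(z in D) ((1 + L) * (u t z ^+ 2 + ut t z ^+ 2)))).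
  apply: le_Rintegral => //; [exact: rintegrable_norm|exact: rintegrableZ|].
  move=> z Dz; have -> : 2 * (w z * u t z * ut t z) = w z * (2 * (u t z * ut t z)) by ring.
  rewrite normrM; apply: ler_pM => //; first exact: wL.
  exact: normr_mul2_le.
rewrite RintegralZl// ler_wpM2l// RintegralD//; [|exact: su.2|exact: sut.2].
exact: lerD.
Qed.

Let cvg_near f (F : set_system R) {FF : Filter F} : sqintegrable mm D f ->
  (\forall t \near F, 0 < t) ->
  L2norm mu2 (rect L B) (fun z => u t z - f z) @[t --> F] --> 0%E ->
  forall eps, 0 < eps -> \forall t \near F, sqintegrable mm D (u t) ->
    `|mass (u t) - mass f| <= eps.
Proof.
move=> fi Fpos cF eps eps0.
have [de [de0 H]] := weighted_square_continuous mD mw wL fi eps0.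
have mF : \forall t \near F, measurable_fun (D : set (Rm * Rm)) (fun z => u t z - f z).
  apply: filterS Fpos => t t0; apply: measurable_funB; last exact: fi.1.
  by have [] := rs_L2 sol t0.
have := L2norm_cvg0 (FF := FF) mD mF cF de0.
by apply: filterS => t [_ le_de] iut'; apply: H.
Qed.

(** By definition [Y 0] is the mass of the averaged origin, not of [u0]. The two are compared
    through one small time at which [Y] is the mass of [u]: [Y] is Lipschitz, and [u] tends to [u0]
    in $L^2$. *)
Let Y_origin : Y 0 = mass u0.
Proof.
have [M [M0 HM]] := power_bound.
have [u0L c0] := rs_initial sol.
have i0 := L2fun_sqintegrable u0L.
apply/eqP; rewrite -subr_eq0 -normr_le0; apply/ler_addgt0Pr => eps eps0; rewrite add0r.
have pos : \forall t \near (0 : R)^'+, 0 < t by exact: nbhs_right_gt.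
have e2 : 0 < eps / 2 by rewrite divr_gt0.
have : \forall t \near (0 : R)^'+, sqintegrable mm D (u t) -> `|mass (u t) - mass u0| <= eps / 2.
  exact: cvg_near i0 pos c0 _ e2.
move=> /nbhs_ballP[e /= e0 He].
(* [e] makes the mass of [u t] close to that of [u0], [T] keeps the time inside the horizon, and the
   last bound gives [M * t <= eps / 2]. *)
pose r := Num.min e (Num.min T (eps / (2 * (M + 1)))).
have M1 : 0 < M + 1 by rewrite ltr_wpDl.
have r0 : 0 < r by rewrite !lt_min e0 T0 divr_gt0// mulr_gt0.
have H : {ae mu, forall t, `]0, 0 + r[%classic t -> I t /\ [/\ sqintegrable mm D (u t), Y t = mass (u t) &
  h t = 2 * \int[mm]_(z in D) (w z * u t z * ut t z)]}.
  apply: ae_imp good => t gd; rewrite /= !in_itv/= add0r !lt_min => /andP[t0 /and3P[_ tT _]].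
  by have It : I t by [rewrite /= in_itv/= t0]; split => //; exact: gd.
have [t] := itv_right r0 H; rewrite add0r !lt_min => /andP[t0 /and3P[te tT tM]] [_ [sut Yt _]].
have := He t; rewrite /ball /= sub0r normrN gtr0_norm// => /(_ te t0 sut).
rewrite -Yt => d1.
have := AC_lipschitz YA HM (lexx 0) (ltW t0) (ltW tT); rewrite subr0 => d2.
have d3 : M * t <= eps / 2.
  apply: (@le_trans _ _ ((M + 1) * t)); first by rewrite ler_wpM2r ?lerDl// ltW.
  by rewrite mulrC -ler_pdivlMr// ltW//; move: tM; rewrite invfM mulrA.
move: (Y 0) (Y t) (mass u0) d1 d2 => y0 y1 m d1 d2.
have -> : y0 - m = (y1 - m) - (y1 - y0) by ring.
apply: (le_trans (ler_normB _ _)); rewrite [leRHS]splitr.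
by apply: lerD => //; exact: le_trans d2 d3.
Qed.

(** Gronwall's bound concerns [Y], while the claim is made at every time for the continuous
    representative. It is transferred from a nearby time [s] at which [Y s] is the mass of [u s]. *)
Lemma decay_before t : 0 < t -> t < T -> mass u0 < thr ->
  mass (u t) <= expR (- c * t) * mass u0.
Proof.
move=> t0 tT uthr.
have [M [M0 HM]] := power_bound.
have L1 : 0 < 1 + L by rewrite addr_gt0.
have c0 : 0 <= c by rewrite divr_ge0// ltW.
have dis : {ae mu, forall r, I r -> Y r < thr -> h r <= - c * Y r}.
  apply: ae_imp2 good ae_dissipation => r gd diss Ir.
  by have [_ -> ->] := gd Ir; exact: diss.
have Ythr : Y 0 < thr by rewrite Y_origin.
have grw := gronwall_threshold YA c0 Y_ge0 HM dis Ythr.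
apply/ler_addgt0Pr => eps eps0.
have it := L2fun_sqintegrable (rs_L2 sol t0).
have pos : \forall s \near t, 0 < s by exact: lt_nbhsr.
have : \forall s \near t, sqintegrable mm D (u s) -> `|mass (u s) - mass (u t)| <= eps.
  exact: cvg_near it pos (rs_continuous sol t0) _ eps0.
move=> /nbhs_ballP[e /= e0 He].
pose r := Num.min e (T - t).
have r0 : 0 < r by rewrite lt_min e0 subr_gt0.
have H : {ae mu, forall s, `]t, t + r[%classic s -> sqintegrable mm D (u s) /\ Y s = mass (u s)}.
  apply: ae_imp good => s gd; rewrite /= in_itv/= => /andP[ts sr].
  have sT : s < T.
    by apply: (lt_le_trans sr); rewrite -lerBrDl ge_min lexx orbT.
  have Is : I s by rewrite /= in_itv/= (lt_trans t0 ts).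
  by have [] := gd Is.
(* The nearby time is taken to the right of [t], so that $e^{-cs}\le e^{-ct}$ and the exponential
   adds no error. *)
have [s /andP[ts sr] [ius Ys]] := itv_right r0 H.
have sT : s < T by apply: (lt_le_trans sr); rewrite -lerBrDl ge_min lexx orbT.
have se : `|t - s| < e.
  rewrite distrC gtr0_norm ?subr_gt0// ltrBlDl; apply: (lt_le_trans sr).
  by rewrite lerD2l ge_min lexx.
have := He s se ius; rewrite -Ys ler_norml => /andP[d1 _].
have := grw s; rewrite (ltW (lt_trans t0 ts)) (ltW sT) => /(_ isT) d2.
have d3 : expR (- c * s) * Y 0 <= expR (- c * t) * mass u0.
  rewrite Y_origin ler_wpM2r//; first by rewrite -Y_origin.
  by rewrite ler_expR !mulNr lerN2 ler_wpM2l// ltW.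
rewrite -lerBlDr; apply: le_trans (le_trans d2 d3).
by move: d1; rewrite lerBrDr addrC.
Qed.

End horizon.

Lemma mass_decay t : 0 < t -> mass u0 < thr -> mass (u t) <= expR (- c * t) * mass u0.
Proof.
move=> t0; apply: (@decay_before (t + 1)); rewrite ?addr_gt0//.
by rewrite ltrDl.
Qed.

Lemma L2dot_mass f : sqintegrable mm D f ->
  L2dot (rect L B) (fun z => (1 + z.1)%R) (fun z => (f z ^+ 2)%R) = (mass f)%:E.
Proof.
move=> fi; apply: EFin_Rintegral => //.
exact: (rintegrable_bounded mD mw wL fi.2).
Qed.

Lemma L2norm_le_mass f : sqintegrable mm D f ->
  (L2norm mu2 (rect L B) f ^+ 2 <= (mass f)%:E)%E.
Proof.
move=> fi; rewrite (L2norm_expe _ _) (EFin_Rintegral mD fi.2) lee_fin.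
apply: le_Rintegral => //; first exact: fi.2.
  exact: (rintegrable_bounded mD mw wL fi.2).
by move=> z /wD/andP[w1 _]; rewrite ler_peMl// sqr_ge0.
Qed.

End decay.

Theorem theorem7p1 (R : realType) (B L A : R) (hB : 0 < B) (hL : 0 < L)
    (hA : 24 / L ^+ 2 + 2 / B ^+ 2 - 1 = 2 * A ^+ 2) (hA0 : 0 < 2 * A ^+ 2) :
  9 * A ^+ 4 / (16 * (8 / L ^+ 2 + 2 / B ^+ 2)) =
    (3 * A ^+ 2 * L * B) ^+ 2 / (32 * (4 * B ^+ 2 + L ^+ 2)) /\
  forall u0 : R * R -> R,
    (L2dot (rect L B) (fun z => (1 + z.1)%R) (fun z => (u0 z ^+ 2)%R) <
      (9 * A ^+ 4 / (16 * (8 / L ^+ 2 + 2 / B ^+ 2)))%:E)%E ->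
  forall u : R -> R * R -> R, regular_solution L B u0 u ->
  forall t : R, 0 < t ->
    (L2norm mu2 (rect L B) (u t) ^+ 2 <=
       L2dot (rect L B) (fun z => (1 + z.1)%R) (fun z => (u t z ^+ 2)%R) <=
       (expR (- (A ^+ 2 / (1 + L)) * t))%:E *
         L2dot (rect L B) (fun z => (1 + z.1)%R) (fun z => (u0 z ^+ 2)%R))%E.
Proof.
split.
  by field; rewrite !gt_eqF ?addr_gt0 ?mulr_gt0 ?exprn_gt0.
move=> u0 hu0 u [ut [ux [uxxx [uxyy sol]]]] t t0.
have A0 : 0 < A ^+ 2 by move: hA0; rewrite pmulr_rgt0.
have iu := L2fun_sqintegrable (rs_L2 sol t0).
have iu0 := L2fun_sqintegrable (rs_initial sol).1.
move: hu0; rewrite (L2dot_mass iu0) (L2dot_mass iu) -EFinM !lee_fin lte_fin => hu0.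
apply/andP; split; first exact: L2norm_le_mass.
exact: (mass_decay hL hB A0 hA sol t0 hu0).
Qed.
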